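(* Let $n\ge 1$, let $U\subset\mathbb{C}^n$ be a connected open set, and let $g$ be a radial Kähler metric on $U$ with constant scalar curvature $\rho$. Then the third Tian–Yau–Zelditch coefficient $a_3$ of $g$ is a constant function on $U$ if and only if the second Tian–Yau–Zelditch coefficient $a_2$ of $g$ is a constant function on $U$.
   Context: A Kähler metric $g$ on a connected open set $U\subset\mathbb{C}^n$ with coordinates $z=(z_1,\dots,z_n)$ is called radial if it admits a (smooth) Kähler potential $\Phi:U\to\mathbb{R}$ depending only on $|z|^2=|z_1|^2+\cdots+|z_n|^2$. Its Kähler form is $\omega=\frac{i}{2}\partial\bar\partial\Phi$ and $g_{i\bar j}=\frac{\partial^2\Phi}{\partial z_i\partial\bar z_j}$ (positive definite Hermitian matrix). Conventions for a Kähler metric $g=(g_{i\bar j})$ (summation over repeated indices): $g^{j\bar i}$ is the inverse matrix, $g_{k\bar i}g^{j\bar i}=\delta_{kj}$; the curvature tensor is $R_{i\bar jk\bar l}=\frac{\partial^2 g_{i\bar l}}{\partial z_k\partial\bar z_j}-g^{q\bar p}\frac{\partial g_{i\bar p}}{\partial z_k}\frac{\partial g_{q\bar l}}{\partial\bar z_j}$; the Ricci tensor is $\mathrm{Ric}_{i\bar j}=-\frac{\partial^2\log\det(g_{k\bar l})}{\partial z_i\partial\bar z_j}$; the scalar curvature is $\rho=g^{i\bar j}\mathrm{Ric}_{i\bar j}$; the Laplacian on functions is $\Delta f=g^{i\bar j}\frac{\partial^2 f}{\partial z_i\partial\bar z_j}$. Let $\mathrm{Ric}_{i\bar j,k}=\nabla_k\mathrm{Ric}_{i\bar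 j}$ and $\mathrm{Ric}_{i\bar j,k\bar l}=\nabla_{\bar l}\nabla_k\mathrm{Ric}_{i\bar j}$ denote covariant derivatives in the directions $\partial/\partial z_k$ and $\partial/\partial\bar z_l$. The following scalar functions are defined by their values at an arbitrary point, written in holomorphic coordinates for which $g_{i\bar j}=\delta_{ij}$ at that point (all indices summed from $1$ to $n$): $|R|^2=\sum|R_{i\bar jk\bar l}|^2$, $|\mathrm{Ric}|^2=\sum|\mathrm{Ric}_{i\bar j}|^2$, $|D'\rho|^2=\sum|\partial\rho/\partial z_i|^2$, $|D'\mathrm{Ric}|^2=\sum|\mathrm{Ric}_{i\bar j,k}|^2$, $\sigma_3(\mathrm{Ric})=\sum\mathrm{Ric}_{i\bar j}\mathrm{Ric}_{j\bar k}\mathrm{Ric}_{k\bar i}$, $R(\mathrm{Ric},\mathrm{Ric})=\sum R_{i\bar jk\bar l}\mathrm{Ric}_{j\bar i}\mathrm{Ric}_{l\bar k}$, $\mathrm{Ric}(R,R)=\sum\mathrm{Ric}_{i\bar j}R_{j\bar kp\bar q}R_{k\bar iq\bar p}$, $\mathrm{div}\,\mathrm{div}(\rho\,\mathrm{Ric})=2|D'\rho|^2+\sum\mathrm{Ric}_{i\bar j}\frac{\partial^2\rho}{\partial z_j\partial\bar z_i}+\rho\Delta\rho$, $\mathrm{div}\,\mathrm{div}(R,\mathrm{Ric})=-\sum\mathrm{Ric}_{i\bar j}\frac{\partial^2\rho}{\partial z_j\partial\bar z_i}-2|D'\mathrm{Ric}|^2+\sum\mathrm{Ric}_{i\bar j,k\bar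 l}R_{j\bar il\bar k}-R(\mathrm{Ric},\mathrm{Ric})-\sigma_3(\mathrm{Ric})$. The Tian–Yau–Zelditch coefficients of $g$ are the functions (defined for any Kähler metric, regardless of the existence of the asymptotic expansion of the distortion function) $$a_1=\tfrac12\rho,\qquad a_2=\tfrac13\Delta\rho+\tfrac1{24}\big(|R|^2-4|\mathrm{Ric}|^2+3\rho^2\big),$$ $$a_3=\tfrac18\Delta\Delta\rho+\tfrac1{24}\mathrm{div}\,\mathrm{div}(R,\mathrm{Ric})-\tfrac16\mathrm{div}\,\mathrm{div}(\rho\,\mathrm{Ric})+\tfrac1{48}\Delta\big(|R|^2-4|\mathrm{Ric}|^2+8\rho^2\big)+\tfrac1{48}\rho\big(\rho^2-4|\mathrm{Ric}|^2+|R|^2\big)+\tfrac1{24}\big(\sigma_3(\mathrm{Ric})-\mathrm{Ric}(R,R)-R(\mathrm{Ric},\mathrm{Ric})\big).$$ *)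

(* Defs.v *)
From HB Require Import structures.
From mathcomp Require Import all_boot all_order all_algebra.
From mathcomp Require Import all_classical all_reals all_analysis.
From mathcomp Require Import complex.
Import Order.TTheory GRing.Theory Num.Theory numFieldNormedType.Exports.

Set Implicit Arguments.
Unset Strict Implicit.
Unset Printing Implicit Defensive.

Local Open Scope classical_set_scope.
Local Open Scope ring_scope.
Local Open Scope complex_scope.
Local Open Scope sesquilinear_scope.

(* The norm topology of R[i], and its normed module structure over itself, as
   the library provides for a variable numFieldType. *)
HB.instance Definition _ (R : realType) :=
  PseudoPointedMetric.copy R[i] R[i]^o.
HB.instance Definition _ (R : realType) := NormedModule.copy R[i] R[i]^o.

(* C^n is 'rV[R[i]]_n, with the library's (product) topology; a scalar function
   is complex valued even when its values are real. *)
Section Calculus.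
Context {R : realType} {n : nat}.
Notation C := R[i].
Notation Cn := 'rV[C]_n.
Implicit Types (U : set Cn) (f : Cn -> C) (v z : Cn).

Definition line f z v (t : R) : C := f (z + t%:C *: v).

Definition derivable_dir f z v : Prop :=
  derivable (fun t => complex.Re (line f z v t)) 0 1 /\
  derivable (fun t => complex.Im (line f z v t)) 0 1.

(* Derivative at z in the real direction v: d/dt f (z + t v) at t = 0. *)
Definition ddir v f z : C :=
  derive1 (fun t => complex.Re (line f z v t)) 0 +i*
  derive1 (fun t => complex.Im (line f z v t)) 0.

(* With z_k = x_k + i y_k, the directions of d/dx_k and d/dy_k. *)
Definition xdir (k : 'I_n) : Cn := delta_mx 0 k.
Definition ydir (k : 'I_n) : Cn := 'i *: delta_mx 0 k.

(* Wirtinger derivatives d/dz_k and d/d\bar z_k. *)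
Definition dz (k : 'I_n) f z : C :=
  (ddir (xdir k) f z - 'i * ddir (ydir k) f z) / 2.
Definition dzb (k : 'I_n) f z : C :=
  (ddir (xdir k) f z + 'i * ddir (ydir k) f z) / 2.

(* Class C^m on U in the 2n real coordinates (used for open U only, so that the
   values of f outside U play no role). *)
Fixpoint class_C (m : nat) U f : Prop :=
  (forall z, U z -> {for z, continuous f}) /\
  if m is m'.+1 then
    forall k : 'I_n,
      [/\ forall z, U z -> derivable_dir f z (xdir k),
          forall z, U z -> derivable_dir f z (ydir k),
          class_C m' U (ddir (xdir k) f) &
          class_C m' U (ddir (ydir k) f)]
  else True.

Definition smooth_on U f : Prop := forall m, class_C m U f.

Definition constant_on U f : Prop := exists c : C, forall z, U z -> f z = c.

End Calculus.

Section KahlerMetrics.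
Context {R : realType} {n : nat}.
Notation C := R[i].
Notation Cn := 'rV[C]_n.
(* A metric is the matrix-valued function g with entries
   (g z) i j = g_{i \bar j}(z). *)
Implicit Types (U : set Cn) (g : Cn -> 'M[C]_n) (f : Cn -> C) (z : Cn).

(* The order of R[i] satisfies 0 < c only for c real. *)
Definition posdef_hermitian (A : 'M[C]_n) : Prop :=
  A ^t* = A /\ forall v : Cn, v != 0 -> 0 < (v *m A *m v ^t*) 0 0.

Definition kahler_metric U g : Prop :=
  [/\ forall i j, smooth_on U (fun z => g z i j),
      forall z, U z -> posdef_hermitian (g z) &
      forall i j k z, U z ->
        dz k (fun z => g z i j) z = dz i (fun z => g z k j) z].

Definition kahler_potential U g (Phi : Cn -> R) : Prop :=
  smooth_on U (fun z => (Phi z)%:C) /\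
  forall z, U z -> forall i j, g z i j = dz i (dzb j (fun z => (Phi z)%:C)) z.

Definition sqnorm z : C := \sum_i `|z 0 i| ^+ 2.

Definition radial U g : Prop :=
  exists2 Phi : Cn -> R, kahler_potential U g Phi &
    forall z w, U z -> U w -> sqnorm z = sqnorm w -> Phi z = Phi w.

(* Since g_{k \bar i} g^{j \bar i} = delta_{kj}, the coefficient g^{j \bar i}
   is the (i, j) entry of the inverse of the matrix (g_{i \bar j}). *)
Definition ginv g (j i : 'I_n) z : C := invmx (g z) i j.

Definition Riem g (i j k l : 'I_n) z : C :=
  dz k (dzb j (fun z => g z i l)) z -
  \sum_p \sum_q ginv g q p z * dz k (fun z => g z i p) z
                             * dzb j (fun z => g z q l) z.

(* det g is a positive real wherever g is positive definite. *)
Definition logdet g z : C := (ln (complex.Re (\det (g z))))%:C.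

Definition Ric g (i j : 'I_n) z : C := - dz i (dzb j (logdet g)) z.

Definition scal g z : C := \sum_i \sum_j ginv g i j z * Ric g i j z.

Definition Lap g f z : C := \sum_i \sum_j ginv g i j z * dz i (dzb j f) z.

(* Chern (= Levi-Civita) connection:
   nabla_{d/dz_k} d/dz_i = sum_q Gamma^q_{k i} d/dz_q; the only other nonzero
   Christoffel symbols are the conjugates of these. *)
Definition Gamma g (q k i : 'I_n) z : C :=
  \sum_p ginv g q p z * dz k (fun z => g z i p) z.

(* nabla_k Ric_{i \bar j} *)
Definition DRic g (i j k : 'I_n) z : C :=
  dz k (Ric g i j) z - \sum_q Gamma g q k i z * Ric g q j z.

(* nabla_{\bar l} nabla_k Ric_{i \bar j} *)
Definition DDRic g (i j k l : 'I_n) z : C :=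
  dzb l (DRic g i j k) z - \sum_q (Gamma g q l j z)^*%R * DRic g i q k z.

(* Coordinates w with z = z_0 + w E, hence d/dw_i = sum_a E_{i a} d/dz_a, in
   which the metric is the identity at z_0: E is a basis of the holomorphic
   tangent space which is unitary for g z_0. The scalars below do not depend on
   which one is chosen. *)
Definition unitary_frame (A E : 'M[C]_n) : Prop := E *m A *m E ^t* = 1%:M.

Definition frame g z : 'M[C]_n := xget 1%:M [set E | unitary_frame (g z) E].

Lemma unitary_frame_exists (A : 'M[C]_n) :
  posdef_hermitian A -> exists E, unitary_frame A E.
Proof.
move=> [Ah Ap].
have /orthomx_spectralP : A \is normalmx by apply/normalmxP; rewrite Ah.
set P := spectralmx A; set d := spectral_diag A => AE.
have Pu : P \is unitarymx by exact: spectral_unitarymx.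
have PP : P *m P^t* = 1%:M by apply/unitarymxP.
have dE : P *m A *m P^t* = diag_mx d.
  rewrite AE invmx_unitary // !mulmxA PP mul1mx -mulmxA PP mulmx1 //.
have dp i : 0 < d 0 i.
  have := Ap (row i P); rewrite -row_mul.
  have -> : (row i (P *m A) *m (row i P)^t*) 0 0 = (P *m A *m P^t*) i i.
    rewrite !mxE; apply: eq_bigr => j _; by rewrite !mxE.
  rewrite dE !mxE eqxx mulr1n; apply.
  apply/eqP => r0; have := congr1 (fun M : 'M[R[i]]_n => M i i) PP.
  rewrite -[LHS]/((P *m P^t*) i i) !mxE eqxx big1 => [/eqP|j _].
    by rewrite eq_sym oner_eq0.
  by move/rowP : r0 => /(_ j); rewrite !mxE => ->; rewrite mul0r.
pose s := \row_i (sqrtC (d 0 i))^-1.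
exists (diag_mx s *m P); rewrite /unitary_frame.
have -> : (diag_mx s *m P)^t* = P^t* *m diag_mx s.
  rewrite trmx_mul map_mxM tr_diag_mx map_diag_mx; congr (_ *m diag_mx _).
  apply/rowP => i; rewrite !mxE fmorphV /= geC0_conj // sqrtC_ge0; exact: ltW.
rewrite !mulmxA -(mulmxA _ P A) -(mulmxA _ (P *m A)) dE !mulmx_diag.
apply/matrixP => i j; rewrite !mxE; case: eqVneq => // ->.
rewrite !mulr1n mulrAC -invfM -expr2 sqrtCK mulVf //; exact: lt0r_neq0.
Qed.

Lemma frameP g z :
  posdef_hermitian (g z) -> unitary_frame (g z) (frame g z).
Proof. by move=> /unitary_frame_exists gE; exact: (xgetPex 1%:M gE). Qed.

(* Components of covariant tensors in the coordinates w; the 2nd and 4th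
   indices are antiholomorphic. *)
Definition frame1 (E : 'M[C]_n) (T : 'I_n -> C) i : C := \sum_a E i a * T a.

Definition frame2 (E : 'M[C]_n) (T : 'I_n -> 'I_n -> C) i j : C :=
  \sum_a \sum_b E i a * (E j b)^*%R * T a b.

Definition frame3 (E : 'M[C]_n) (T : 'I_n -> 'I_n -> 'I_n -> C) i j k : C :=
  \sum_a \sum_b \sum_c E i a * (E j b)^*%R * E k c * T a b c.

Definition frame4 (E : 'M[C]_n) (T : 'I_n -> 'I_n -> 'I_n -> 'I_n -> C)
    i j k l : C :=
  \sum_a \sum_b \sum_c \sum_d
    E i a * (E j b)^*%R * E k c * (E l d)^*%R * T a b c d.

Section UnitaryComponents.
Variables (g : Cn -> 'M[C]_n) (z : Cn).
Definition uR := frame4 (frame g z) (fun i j k l => Riem g i j k l z).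
Definition uRic := frame2 (frame g z) (fun i j => Ric g i j z).
Definition uDRic := frame3 (frame g z) (fun i j k => DRic g i j k z).
Definition uDDRic := frame4 (frame g z) (fun i j k l => DDRic g i j k l z).
Definition uDscal := frame1 (frame g z) (fun i => dz i (scal g) z).
Definition uDDscal := frame2 (frame g z) (fun i j => dz i (dzb j (scal g)) z).
End UnitaryComponents.

Definition normsqR g z : C :=
  \sum_i \sum_j \sum_k \sum_l `|uR g z i j k l| ^+ 2.

Definition normsqRic g z : C := \sum_i \sum_j `|uRic g z i j| ^+ 2.

Definition normsqDscal g z : C := \sum_i `|uDscal g z i| ^+ 2.

Definition normsqDRic g z : C := \sum_i \sum_j \sum_k `|uDRic g z i j k| ^+ 2.

Definition sigma3 g z : C :=
  \sum_i \sum_j \sum_k uRic g z i j * uRic g z j k * uRic g z k i.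

Definition R_Ric_Ric g z : C :=
  \sum_i \sum_j \sum_k \sum_l uR g z i j k l * uRic g z j i * uRic g z l k.

Definition Ric_R_R g z : C :=
  \sum_i \sum_j \sum_k \sum_p \sum_q
    uRic g z i j * uR g z j k p q * uR g z k i q p.

(* sum of Ric_{i \bar j} d^2 rho / dz_j d\bar z_i *)
Definition Ric_DDscal g z : C :=
  \sum_i \sum_j uRic g z i j * uDDscal g z j i.

Definition divdiv_scal_Ric g z : C :=
  2 * normsqDscal g z + Ric_DDscal g z + scal g z * Lap g (scal g) z.

Definition divdiv_R_Ric g z : C :=
  - Ric_DDscal g z - 2 * normsqDRic g z
  + (\sum_i \sum_j \sum_k \sum_l uDDRic g z i j k l * uR g z j i l k)
  - R_Ric_Ric g z - sigma3 g z.

Definition TYZ_a2 g z : C :=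
  Lap g (scal g) z / 3
  + (normsqR g z - 4 * normsqRic g z + 3 * scal g z ^+ 2) / 24.

Definition TYZ_a3 g z : C :=
  Lap g (Lap g (scal g)) z / 8
  + divdiv_R_Ric g z / 24
  - divdiv_scal_Ric g z / 6
  + Lap g (fun z => normsqR g z - 4 * normsqRic g z + 8 * scal g z ^+ 2) z / 48
  + scal g z * (scal g z ^+ 2 - 4 * normsqRic g z + normsqR g z) / 48
  + (sigma3 g z - Ric_R_R g z - R_Ric_Ric g z) / 24.

End KahlerMetrics.

(* Main.v *)
(* Write x = |z|^2, Phi = phi(x) and y = x phi'(x). Since the metric is
   phi'(x) delta_ij + phi''(x) \bar z_i z_j, constancy of the scalar curvature,
   rho = n (n + 1) K, is an ODE for phi' which integrates to
     phi'' = phi'^2 (B / y^n + D / y^(n+1) - K),   B and D constant.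
   All curvature quantities are then polynomials in b = B / y^n, c = D / y^(n+1),
   K and 1 / y, and a_2, a_3 become explicit polynomials in 1 / y. Their
   leading coefficients are n (n^2 - 1) (n + 2) D^2 / 24 and
   n (n^2 - 1) (n + 1) (n + 2) (2 n + 3) D^3 / 24, and, once D = 0, the
   coefficients n (n^2 - 1) (n - 2) B^2 / 24 and
   n^2 (n^2 - 1) (n - 2) (2 n + 1) B^3 / 24. Since y is a strictly monotone
   function of x, each of a_2 and a_3 is constant exactly when n = 1, or D = 0 and
   either n = 2 or B = 0. If the origin lies in U, letting x tend to 0 in the ODE gives
   B = D = 0. For n = 1, phi' may vanish, but the metric is unchanged when a / x is
   added to phi', and the same computation applies. *)

(* The polynomial form of the curvature comes from symmetry. In a frame unitary for [g z] the metric
   is the identity and [proj z] a multiple of a rank one projector [Q]. Ricci then lies in the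
   algebra spanned by [1 - Q] and [Q], while the curvature and the second covariant derivative of
   Ricci are sums of [tens] of such matrices, so every contraction is a trace in a commutative
   algebra. The ODE can be integrated explicitly because, with [y] as independent variable, it is
   twice an exact derivative. Two obstacles shape the rest. Smoothness is given for the potential on
   [U], not for phi: it is recovered by inverting |z|^2 explicitly along a coordinate line. This
   fails at the origin, where only the evenness of t |-> phi (t^2) and limits are available.
   Moreover a_3 contains derivatives of curvature, so its formula needs an open set on which one
   model of the metric is valid; the auxiliary function [lam] makes the same identities serve off
   the origin and around it. Finally, constancy gives back coefficients because a polynomial in 1 /
   y with infinitely many zeros vanishes. *)
Require Import Defs.
From mathcomp Require Import all_boot all_order all_algebra.
From mathcomp Require Import all_classical all_reals all_analysis.
From mathcomp Require Import complex.
From mathcomp Require Import ring lra zify.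
Import Order.TTheory GRing.Theory Num.Theory numFieldNormedType.Exports.
Set Implicit Arguments.
Unset Strict Implicit.
Unset Printing Implicit Defensive.
Local Open Scope classical_set_scope.
Local Open Scope ring_scope.
Local Open Scope sesquilinear_scope.
Local Notation "x %:C" := (real_complex _ x) : ring_scope.

(** * Derivatives of functions of one variable *)

Section OneVariable.
Context {R : realType}.
Implicit Types (f h : R -> R) (x a b : R).

Lemma derivable_is_derive1 f x : derivable f x 1 -> is_derive x 1 f (derive1 f x).
Proof. by move=> fx; rewrite derive1E; apply: DeriveDef. Qed.

Lemma is_derive1_val f x a : is_derive x 1 f a -> derive1 f x = a.
Proof. by move=> fx; rewrite derive1E; exact: derive_val. Qed.

Lemma is_derive1D f h x a b : is_derive x 1 f a -> is_derive x 1 h b ->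
  is_derive x 1 (fun t => f t + h t) (a + b).
Proof. exact: is_deriveD. Qed.

Lemma is_derive1B f h x a b : is_derive x 1 f a -> is_derive x 1 h b ->
  is_derive x 1 (fun t => f t - h t) (a - b).
Proof. exact: is_deriveB. Qed.

Lemma is_derive1N f x a : is_derive x 1 f a -> is_derive x 1 (fun t => - f t) (- a).
Proof. exact: is_deriveN. Qed.

Lemma is_derive1M f h x a b : is_derive x 1 f a -> is_derive x 1 h b ->
  is_derive x 1 (fun t => f t * h t) (a * h x + f x * b).
Proof.
move=> fa hb; have := is_deriveM fa hb.
by rewrite addrC /GRing.scale/= (mulrC (h x)).
Qed.

Lemma is_derive1V f x a : f x != 0 -> is_derive x 1 f a ->
  is_derive x 1 (fun t => (f t)^-1) (- a / f x ^+ 2).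
Proof.
move=> f0 fa; have := is_deriveV f0 fa.
by rewrite /GRing.scale/= mulNr mulrC mulNr.
Qed.

Lemma is_derive1X f m x a : is_derive x 1 f a ->
  is_derive x 1 (fun t => f t ^+ m) (m%:R * f x ^+ m.-1 * a).
Proof.
move=> fa; have := @is_deriveX _ _ f m x 1 a fa.
rewrite (_ : f ^+ m = fun t => f t ^+ m) //.
apply/funext => t; elim: m => [|m IH]; first by rewrite !expr0.
by rewrite !exprS -IH.
Qed.

Lemma is_derive1_id x : is_derive x 1 (fun t : R => t) 1.
Proof. exact: is_derive_id. Qed.

Lemma is_derive1_cst x a : is_derive x 1 (fun _ : R => a) 0.
Proof. exact: is_derive_cst. Qed.

Lemma is_derive1_ext f h x a : (\forall t \near x, f t = h t) ->
  is_derive x 1 f a -> is_derive x 1 h a.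
Proof. exact: near_eq_is_derive. Qed.

Lemma is_derive1_chain f h x a b : is_derive (h x) 1 f a -> is_derive x 1 h b ->
  is_derive x 1 (fun t => f (h t)) (a * b).
Proof. exact: is_derive1_comp. Qed.

(** Derivatives are assembled from the rules above as proof terms; this fits the result to the
    wanted function and value, leaving an identity for [ring] or [field]. *)
Lemma eq_is_derive1 f h x a b : is_derive x 1 f a -> f =1 h -> a = b ->
  is_derive x 1 h b.
Proof. by move=> fa /funext <- <-. Qed.

End OneVariable.

(** * Wirtinger calculus *)

Section Wirtinger.
Context {R : realType} {n : nat}.
Local Notation C := R[i].
Local Notation Cn := 'rV[C]_n.
Implicit Types (f h : Cn -> C) (v z : Cn) (k : 'I_n) (c d : C).

(** Relational form of [ddir]. It carries differentiability along with the value, which the product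
    and chain rules need, whereas [derive1] has a value even where no derivative exists. *)
Definition is_ddir v f z d : Prop :=
  is_derive (0 : R) (1 : R) (fun t => complex.Re (line f z v t)) (complex.Re d) /\
  is_derive (0 : R) (1 : R) (fun t => complex.Im (line f z v t)) (complex.Im d).

Lemma line0 f z v : line f z v 0 = f z.
Proof. by rewrite /line /= scale0r addr0. Qed.

Lemma ddir_val v f z d : is_ddir v f z d -> ddir v f z = d.
Proof.
case=> /is_derive1_val h1 /is_derive1_val h2; rewrite /ddir h1 h2.
by case: d {h1 h2}.
Qed.

Lemma derivable_is_ddir v f z : derivable_dir f z v -> is_ddir v f z (ddir v f z).
Proof.
by case=> h1 h2; split; [exact: derivable_is_derive1 h1|
                         exact: derivable_is_derive1 h2].
Qed.

Lemma is_ddir_cst v z c : is_ddir v (fun=> c) z 0.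
Proof. by split; exact: is_derive1_cst. Qed.

Let ReD (a b : C) : complex.Re (a + b) = complex.Re a + complex.Re b.
Proof. by case: a b => [? ?] [? ?]. Qed.

Let ImD (a b : C) : complex.Im (a + b) = complex.Im a + complex.Im b.
Proof. by case: a b => [? ?] [? ?]. Qed.

Let ReM (a b : C) : complex.Re (a * b) =
  complex.Re a * complex.Re b - complex.Im a * complex.Im b.
Proof. by case: a b => [? ?] [? ?]. Qed.

Let ImM (a b : C) : complex.Im (a * b) =
  complex.Re a * complex.Im b + complex.Im a * complex.Re b.
Proof. by case: a b => [? ?] [? ?]. Qed.

Let ReJ (a : C) : complex.Re a^* = complex.Re a.
Proof. by case: a. Qed.

Let ImJ (a : C) : complex.Im a^* = - complex.Im a.
Proof. by case: a. Qed.

Lemma is_ddirD v f h z c d : is_ddir v f z c -> is_ddir v h z d ->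
  is_ddir v (fun w => f w + h w) z (c + d).
Proof.
move=> [f1 f2] [h1 h2]; split.
  apply: (eq_is_derive1 (is_derive1D f1 h1)) => [t|]; exact/esym/ReD.
apply: (eq_is_derive1 (is_derive1D f2 h2)) => [t|]; exact/esym/ImD.
Qed.

Lemma is_ddirM v f h z c d : is_ddir v f z c -> is_ddir v h z d ->
  is_ddir v (fun w => f w * h w) z (c * h z + f z * d).
Proof.
move=> [f1 f2] [h1 h2]; split.
  apply: (eq_is_derive1 (is_derive1B (is_derive1M f1 h1) (is_derive1M f2 h2))).
    by move=> t; exact/esym/ReM.
  by rewrite !line0 ReD !ReM opprD addrACA.
apply: (eq_is_derive1 (is_derive1D (is_derive1M f1 h2) (is_derive1M f2 h1))).
  by move=> t; exact/esym/ImM.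
by rewrite !line0 ImD !ImM; ring.
Qed.

Lemma is_ddir_conj v f z d : is_ddir v f z d ->
  is_ddir v (fun w => (f w)^*) z d^*.
Proof.
move=> [f1 f2]; split.
  by apply: (eq_is_derive1 f1) => [t|]; exact/esym/ReJ.
by apply: (eq_is_derive1 (is_derive1N f2)) => [t|]; exact/esym/ImJ.
Qed.

Lemma is_ddir_real v f z (d phi' : R) (phi : R -> R) :
  (forall w, f w = (complex.Re (f w))%:C) ->
  is_ddir v f z d%:C -> is_derive (complex.Re (f z)) 1 phi phi' ->
  is_ddir v (fun w => (phi (complex.Re (f w)))%:C) z (phi' * d)%:C.
Proof.
move=> fR [f1 _] phiP; split; last exact: is_derive1_cst.
by apply: is_derive1_chain f1; rewrite line0.
Qed.

Lemma continuous_real_complex : continuous (fun t : R => t%:C : C).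
Proof.
move=> t; apply/cvgrPdist_lt => e e0.
have eR : e = (complex.Re e)%:C.
  by case: e e0 => a b; rewrite ltcE /= => /andP[/eqP -> _].
have e0' : 0 < complex.Re e by move: e0; rewrite {1}eR ltcR.
near=> s.
rewrite eR -rmorphB /= normc_def /= expr0n /= addr0 sqrtr_sqr ltcR.
by near: s; apply: cvgr_dist_lt.
Unshelve. all: by end_near. Qed.

Lemma continuous_line z v : continuous (fun t : R => z + t%:C *: v).
Proof.
move=> t; apply: cvgD; first exact: cvg_cst.
by apply: cvgZr_tmp; exact: continuous_real_complex.
Qed.

Lemma cvg_line z v : (fun t : R => z + t%:C *: v) @ (0:R) --> z.
Proof. by have := @continuous_line z v 0; rewrite /continuous_at /= scale0r addr0. Qed.

Lemma near_line z v (P : Cn -> Prop) : (\forall w \near z, P w) ->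
  \forall t \near (0:R), P (z + t%:C *: v).
Proof. exact: (@cvg_line z v P). Qed.

Lemma is_ddir_near v f h z d : (\forall w \near z, f w = h w) ->
  is_ddir v f z d -> is_ddir v h z d.
Proof.
move=> fh; have {}fh := @near_line z v _ fh; move=> [f1 f2]; split.
  apply: is_derive1_ext f1; near=> t; rewrite /line; congr complex.Re.
  by near: t; exact: fh.
apply: is_derive1_ext f2; near=> t; rewrite /line; congr complex.Im.
by near: t; exact: fh.
Unshelve. all: by end_near. Qed.

(* df/dz_k = c and df/d\bar z_k = d. *)
Definition is_wirt k f z c d :=
  is_ddir (xdir k) f z (c + d) /\ is_ddir (ydir k) f z ('i * (c - d)).

Lemma dz_val k f z c d : is_wirt k f z c d -> dz k f z = c.
Proof.
move=> [/ddir_val fx /ddir_val fy]; rewrite /dz fx fy mulrA -expr2 sqrCi.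
have -> : c + d - -1 * (c - d) = c * 2 by ring.
by rewrite mulfK // pnatr_eq0.
Qed.

Lemma dzb_val k f z c d : is_wirt k f z c d -> dzb k f z = d.
Proof.
move=> [/ddir_val fx /ddir_val fy]; rewrite /dzb fx fy mulrA -expr2 sqrCi.
have -> : c + d + -1 * (c - d) = d * 2 by ring.
by rewrite mulfK // pnatr_eq0.
Qed.

Lemma eq_is_wirt k f h z c d c' d' : is_wirt k f z c d -> f =1 h ->
  c = c' -> d = d' -> is_wirt k h z c' d'.
Proof. by move=> fcd /funext <- <- <-. Qed.

Lemma is_wirt_near k f h z c d : (\forall w \near z, f w = h w) ->
  is_wirt k f z c d -> is_wirt k h z c d.
Proof. by move=> fh [f1 f2]; split; apply: is_ddir_near fh _. Qed.

Lemma is_wirt_cst k z c : is_wirt k (fun=> c) z 0 0.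
Proof.
by split; rewrite ?addr0 ?subrr ?mulr0; exact: is_ddir_cst.
Qed.

Lemma is_wirtD k f h z a b c d : is_wirt k f z a b -> is_wirt k h z c d ->
  is_wirt k (fun w => f w + h w) z (a + c) (b + d).
Proof.
move=> [fx fy] [hx hy]; split.
  by rewrite addrACA; exact: is_ddirD.
by rewrite opprD addrACA mulrDr; exact: is_ddirD.
Qed.

Lemma is_wirtM k f h z a b c d : is_wirt k f z a b -> is_wirt k h z c d ->
  is_wirt k (fun w => f w * h w) z (a * h z + f z * c) (b * h z + f z * d).
Proof.
move=> [fx fy] [hx hy]; split.
  by rewrite addrACA -mulrDl -mulrDr; exact: is_ddirM.
rewrite (_ : 'i * _ = 'i * (a - b) * h z + f z * ('i * (c - d))); last by ring.
exact: is_ddirM.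
Qed.

Lemma is_wirt_sum (I : Type) (r : seq I) k (F : I -> Cn -> C) z (a b : I -> C) :
  (forall i, is_wirt k (F i) z (a i) (b i)) ->
  is_wirt k (fun w => \sum_(i <- r) F i w) z (\sum_(i <- r) a i) (\sum_(i <- r) b i).
Proof.
move=> Fab; elim: r => [|i r IH].
  rewrite !big_nil; apply: (eq_is_wirt (is_wirt_cst k z 0)) => // w.
  by rewrite big_nil.
rewrite !big_cons; apply: (eq_is_wirt (is_wirtD (Fab i) IH)) => // w.
by rewrite big_cons.
Qed.

Lemma is_wirt_conj k f z a b : is_wirt k f z a b ->
  is_wirt k (fun w => (f w)^* ) z b^* a^*.
Proof.
move=> [fx fy]; split.
  by rewrite addrC -rmorphD; exact: is_ddir_conj.
rewrite (_ : 'i * _ = ('i * (a - b))^*); first exact: is_ddir_conj.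
by rewrite rmorphM rmorphB /= conjCi mulNr -mulrN opprB.
Qed.

Lemma is_wirt_coord k (i : 'I_n) z :
  is_wirt k (fun w => w 0 i) z (i == k)%:R 0.
Proof.
have H v : is_ddir v (fun w => w 0 i) z (v 0 i).
  split; rewrite /line.
    apply: (eq_is_derive1 (is_derive1D (is_derive1_cst 0 (complex.Re (z 0 i)))
      (is_derive1M (is_derive1_id 0) (is_derive1_cst 0 (complex.Re (v 0 i)))))).
      move=> t; rewrite !mxE ReD ReM /=; ring.
    by ring.
  apply: (eq_is_derive1 (is_derive1D (is_derive1_cst 0 (complex.Im (z 0 i)))
    (is_derive1M (is_derive1_id 0) (is_derive1_cst 0 (complex.Im (v 0 i)))))).
    move=> t; rewrite !mxE ImD ImM /=; ring.
  by ring.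
split; [have := H (xdir k)|have := H (ydir k)];
  by rewrite !mxE !eqxx /= ?addr0 ?subr0 eq_sym.
Qed.

Definition sqn z : R := complex.Re (sqnorm z).

Lemma sqnormE z : sqnorm z = \sum_i z 0 i * (z 0 i)^*.
Proof. by apply: eq_bigr => i _; rewrite sqr_normc. Qed.

Lemma sqnC z : (sqn z)%:C = sqnorm z.
Proof.
have : 0 <= sqnorm z by apply: sumr_ge0 => i _; rewrite exprn_ge0.
by rewrite /sqn; case: (sqnorm z) => a b; rewrite lecE /= => /andP[/eqP -> _].
Qed.

Lemma is_wirt_sqnorm k z : is_wirt k (@sqnorm R n) z (z 0 k)^* (z 0 k).
Proof.
have H i := is_wirtM (is_wirt_coord k i z) (is_wirt_conj (is_wirt_coord k i z)).
apply: (eq_is_wirt (is_wirt_sum _ H)) => [w||]; first exact/esym/sqnormE.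
  rewrite (bigD1 k)//= big1 => [|i /negbTE ->].
    by rewrite eqxx mul1r conjC0 mulr0 !addr0.
  by rewrite mul0r conjC0 mulr0 addr0.
rewrite (bigD1 k)//= big1 => [|i /negbTE ->].
  by rewrite eqxx mul0r conjC1 mulr1 add0r addr0.
by rewrite mul0r conjC0 mulr0 addr0.
Qed.

Definition rad (phi : R -> R) z : C := (phi (sqn z))%:C.

Lemma is_wirt_rad k (phi : R -> R) (d : R) z : is_derive (sqn z) 1 phi d ->
  is_wirt k (rad phi) z (d%:C * (z 0 k)^* ) (d%:C * z 0 k).
Proof.
move=> phid; have [hx hy] := is_wirt_sqnorm k z.
(* [is_ddir_real] works with real derivatives: those of |z|^2 along [xdir k] and [ydir k] are twice
   the real and imaginary parts of z_k. *)
have RJ (a : C) : a + a^* = (complex.Re a + complex.Re a)%:C.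
  by case: a => a b; apply/eqP; rewrite eq_complex /= subrr !eqxx.
have IJ (a : C) : 'i * (a^* - a) = (complex.Im a + complex.Im a)%:C.
  case: a => a b; rewrite -complexiE; apply/eqP.
  rewrite eq_complex ReM ImM !ReD !ImD; apply/andP; split; apply/eqP => /=; ring.
split.
  have -> : d%:C * (z 0 k)^* + d%:C * z 0 k =
      (d * (complex.Re (z 0 k) + complex.Re (z 0 k)))%:C.
    by rewrite rmorphM /= -RJ -mulrDr addrC.
  apply: is_ddir_real => //; first by move=> w; exact/esym/sqnC.
  by rewrite -RJ addrC.
have -> : 'i * (d%:C * (z 0 k)^* - d%:C * z 0 k) =
      (d * (complex.Im (z 0 k) + complex.Im (z 0 k)))%:C.
  by rewrite rmorphM /= -IJ -mulrBr mulrCA.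
apply: is_ddir_real => //; first by move=> w; exact/esym/sqnC.
by rewrite -IJ.
Qed.

End Wirtinger.

(** * Contractions *)

Section Contractions.
Context {F : comNzRingType} {n : nat}.
Implicit Types (A B X Y : 'M[F]_n) (i j k l m p q : 'I_n).

(** Symmetric in [i] and [k], while exchanging [j] and [l] exchanges [X] and [Y]. This covers the
    curvature and also the second covariant derivative of Ricci, whose two mixed coefficients
    differ. *)
Definition tens X Y i j k l : F := X i j * Y k l + Y i l * X k j.

(** Of the four products of terms, two close a loop and produce a trace factor, and two chain the
    matrices into a single product. *)
Lemma contr_tens_tens X Y X' Y' j m :
  \sum_k \sum_p \sum_q tens X Y j k p q * tens X' Y' k m q p =
  (\tr (Y *m Y') *: (X *m X') + X *m Y' *m Y *m X' + Y *m Y' *m X *m X'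
   + \tr (X *m Y') *: (Y *m X')) j m.
Proof.
have h1 : \sum_k \sum_p \sum_q X j k * Y p q * (X' k m * Y' q p) =
    (\tr (Y *m Y') *: (X *m X')) j m.
  rewrite !mxE mulr_sumr; apply: eq_bigr => k _.
  rewrite mulr_suml; apply: eq_bigr => p _.
  by rewrite !mxE mulr_suml; apply: eq_bigr => q _; ring.
have h2 : \sum_k \sum_p \sum_q X j k * Y p q * (Y' k p * X' q m) =
    (X *m Y' *m Y *m X') j m.
  rewrite !mxE; under eq_bigr do rewrite exchange_big /=.
  rewrite exchange_big /=; apply: eq_bigr => q _.
  rewrite !mxE mulr_suml exchange_big /=; apply: eq_bigr => p _.
  by rewrite !mxE !mulr_suml; apply: eq_bigr => k _; ring.
have h3 : \sum_k \sum_p \sum_q Y j q * X p k * (X' k m * Y' q p) =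
    (Y *m Y' *m X *m X') j m.
  rewrite !mxE; apply: eq_bigr => k _.
  rewrite !mxE mulr_suml; apply: eq_bigr => p _.
  by rewrite !mxE !mulr_suml; apply: eq_bigr => q _; ring.
have h4 : \sum_k \sum_p \sum_q Y j q * X p k * (Y' k p * X' q m) =
    (\tr (X *m Y') *: (Y *m X')) j m.
  rewrite !mxE mulr_suml exchange_big /=; apply: eq_bigr => p _.
  rewrite !mxE mulr_suml; apply: eq_bigr => k _.
  by rewrite mulr_sumr; apply: eq_bigr => q _; ring.
rewrite [RHS]mxE [X in _ = X + _]mxE [X in _ = X + _ + _]mxE -h1 -h2 -h3 -h4.
rewrite -!big_split /=; apply: eq_bigr => k _.
rewrite -!big_split /=; apply: eq_bigr => p _.
rewrite -!big_split /=; apply: eq_bigr => q _.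
by rewrite /tens; ring.
Qed.

Lemma contr_tens_mx X Y A :
  \sum_i \sum_j \sum_k \sum_l tens X Y i j k l * A j i * A l k =
  \tr (X *m A) * \tr (Y *m A) + \tr (Y *m A *m X *m A).
Proof.
have h1 : \sum_i \sum_j \sum_k \sum_l X i j * Y k l * A j i * A l k =
    \tr (X *m A) * \tr (Y *m A).
  rewrite mulr_suml; apply: eq_bigr => i _.
  rewrite !mxE mulr_suml; apply: eq_bigr => j _.
  rewrite mulr_sumr; apply: eq_bigr => k _.
  by rewrite !mxE mulr_sumr; apply: eq_bigr => l _; ring.
have h2 : \sum_i \sum_j \sum_k \sum_l Y i l * X k j * A j i * A l k =
    \tr (Y *m A *m X *m A).
  apply: eq_bigr => i _; rewrite !mxE; apply: eq_bigr => j _.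
  rewrite !mxE mulr_suml; apply: eq_bigr => k _.
  by rewrite !mxE !mulr_suml; apply: eq_bigr => l _; ring.
rewrite -h1 -h2 -!big_split /=; apply: eq_bigr => i _.
rewrite -!big_split /=; apply: eq_bigr => j _.
rewrite -!big_split /=; apply: eq_bigr => k _.
rewrite -!big_split /=; apply: eq_bigr => l _.
by rewrite /tens; ring.
Qed.

Lemma sum_mx3 A : \sum_i \sum_j \sum_k A i j * A j k * A k i = \tr (A *m A *m A).
Proof.
apply: eq_bigr => i _; rewrite mxE exchange_big /=; apply: eq_bigr => k _.
by rewrite mxE mulr_suml.
Qed.

Variables (Q : 'M[F]_n) (QQ : Q *m Q = Q) (trQ : \tr Q = 1).

(** Eigenvalue [a] on the kernel of the projector [Q] and [b] on its range, so products are computed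
    eigenvalue by eigenvalue. *)
Definition qm (a b : F) : 'M[F]_n := a *: (1%:M - Q) + b *: Q.

Lemma qmM a b c d : qm a b *m qm c d = qm (a * c) (b * d).
Proof.
have PQ : (1%:M - Q) *m Q = 0 by rewrite mulmxBl mul1mx QQ subrr.
have QP : Q *m (1%:M - Q) = 0 by rewrite mulmxBr mulmx1 QQ subrr.
have PP : (1%:M - Q) *m (1%:M - Q) = 1%:M - Q by rewrite mulmxBr mulmx1 PQ subr0.
rewrite /qm !mulmxDl !mulmxDr -!scalemxAl -!scalemxAr QQ PQ QP PP !scaler0.
by rewrite addr0 add0r !scalerA.
Qed.

Lemma trqm a b : \tr (qm a b) = a * (n%:R - 1) + b.
Proof. by rewrite mxtraceD !mxtraceZ raddfB /= mxtrace1 trQ mulr1. Qed.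

Lemma qmD a b c d : qm a b + qm c d = qm (a + c) (b + d).
Proof. by rewrite /qm !scalerDl addrACA. Qed.

Lemma qmZ c a b : c *: qm a b = qm (c * a) (c * b).
Proof. by rewrite /qm scalerDr !scalerA. Qed.

Lemma qm_mix a c s : a *: 1%:M + c *: (s *: Q) = qm a (a + c * s).
Proof.
by rewrite /qm scalerBr scalerDl scalerA -addrA; congr (_ + _); rewrite addKr.
Qed.

(** The shape reached in a unitary frame, where the metric is [1] and [proj] is [s *: Q]. Writing
    [1] as [(1 - Q) + Q] separates tangential from radial components. *)
Lemma tens_mix a1 a2 a3 a4 s i j k l :
  tens 1%:M (a1 *: 1%:M + a2 *: (s *: Q)) i j k l
  + tens (s *: Q) (a3 *: 1%:M + a4 *: (s *: Q)) i j k l =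
  tens (qm 1 0) (qm a1 (a1 + a2 * s)) i j k l
  + tens (qm 0 1) (qm (a1 + a3 * s) (a1 + a2 * s + a3 * s + a4 * s ^+ 2)) i j k l.
Proof.
have qmE a b r t : qm a b r t = a * ((1%:M : 'M[F]_n) r t - Q r t) + b * Q r t.
  by rewrite !mxE.
rewrite !qm_mix /tens !qmE [(s *: Q) i j]mxE [(s *: Q) k j]mxE.
ring.
Qed.

Variables (e R2 H1 : F).

(** Curvature in a unitary frame: [e] is tangential, [R2] mixed, and the purely radial component is
    [2 * H1], since both terms of [tens Q Q] contribute to it. *)
Definition curv i j k l : F :=
  tens (qm 1 0) (qm e R2) i j k l + tens (qm 0 1) (qm R2 H1) i j k l.

(** This expansion shows the effect of exchanging [i] with [j] and [k] with [l], which is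
    conjugation when [Q] is Hermitian; [normsqR_frame] relies on it. *)
Lemma curvE i j k l : curv i j k l =
  let P := (1%:M - Q : 'M[F]_n) in
  e * (P i j * P k l + P i l * P k j)
  + R2 * (P i j * Q k l + Q i j * P k l + P i l * Q k j + Q i l * P k j)
  + H1 * (Q i j * Q k l + Q i l * Q k j).
Proof.
have qmE a b r t : qm a b r t = a * ((1%:M - Q : 'M[F]_n) r t) + b * Q r t.
  by rewrite !mxE.
by rewrite /curv /tens !qmE /=; ring.
Qed.

Let m1 : F := n%:R - 1.

Lemma contr_curv_curv j m :
  \sum_k \sum_p \sum_q curv j k p q * curv k m q p =
  qm (2 * R2 ^+ 2 + 2 * (m1 + 1) * e ^+ 2) (4 * H1 ^+ 2 + 2 * m1 * R2 ^+ 2) j m.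
Proof.
have -> : \sum_k \sum_p \sum_q curv j k p q * curv k m q p =
    \sum_k \sum_p \sum_q tens (qm 1 0) (qm e R2) j k p q * tens (qm 1 0) (qm e R2) k m q p
  + \sum_k \sum_p \sum_q tens (qm 1 0) (qm e R2) j k p q * tens (qm 0 1) (qm R2 H1) k m q p
  + \sum_k \sum_p \sum_q tens (qm 0 1) (qm R2 H1) j k p q * tens (qm 1 0) (qm e R2) k m q p
  + \sum_k \sum_p \sum_q tens (qm 0 1) (qm R2 H1) j k p q * tens (qm 0 1) (qm R2 H1) k m q p.
  rewrite -!big_split /=; apply: eq_bigr => k _.
  rewrite -!big_split /=; apply: eq_bigr => p _.
  rewrite -!big_split /=; apply: eq_bigr => q _.
  by rewrite /curv; ring.
have addE (A B : 'M[F]_n) : A j m + B j m = (A + B) j m by rewrite mxE.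
rewrite !contr_tens_tens !addE; congr (fun_of_matrix _ j m).
rewrite !qmM !trqm !qmZ !qmD -/m1; congr qm; ring.
Qed.

Lemma contr_curv_qm r2 r1 :
  \sum_i \sum_j \sum_k \sum_l curv i j k l * qm r2 r1 j i * qm r2 r1 l k =
  2 * H1 * r1 ^+ 2 + 2 * m1 * R2 * r1 * r2 + (m1 + 1) * m1 * e * r2 ^+ 2.
Proof.
have -> : \sum_i \sum_j \sum_k \sum_l curv i j k l * qm r2 r1 j i * qm r2 r1 l k =
  \sum_i \sum_j \sum_k \sum_l tens (qm 1 0) (qm e R2) i j k l * qm r2 r1 j i * qm r2 r1 l k +
  \sum_i \sum_j \sum_k \sum_l tens (qm 0 1) (qm R2 H1) i j k l * qm r2 r1 j i * qm r2 r1 l k.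
  rewrite -!big_split /=; apply: eq_bigr => i _.
  rewrite -!big_split /=; apply: eq_bigr => j _.
  rewrite -!big_split /=; apply: eq_bigr => k _.
  rewrite -!big_split /=; apply: eq_bigr => l _.
  by rewrite /curv; ring.
by rewrite !contr_tens_mx !qmM !trqm -/m1; ring.
Qed.

Lemma contr_curv5 r2 r1 :
  \sum_i \sum_j \sum_k \sum_p \sum_q qm r2 r1 i j * curv j k p q * curv k i q p =
  m1 * r2 * (2 * R2 ^+ 2 + 2 * (m1 + 1) * e ^+ 2) +
  r1 * (4 * H1 ^+ 2 + 2 * m1 * R2 ^+ 2).
Proof.
transitivity (\tr (qm r2 r1 *m qm (2 * R2 ^+ 2 + 2 * (m1 + 1) * e ^+ 2)
    (4 * H1 ^+ 2 + 2 * m1 * R2 ^+ 2))); last by rewrite qmM trqm -/m1; ring.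
apply: eq_bigr => i _; rewrite mxE; apply: eq_bigr => j _.
rewrite -contr_curv_curv mulr_sumr; apply: eq_bigr => k _.
rewrite mulr_sumr; apply: eq_bigr => p _.
by rewrite mulr_sumr; apply: eq_bigr => q _; rewrite mulrA.
Qed.

Lemma contr_curv4 :
  \sum_i \sum_j \sum_k \sum_l curv i j k l * curv j i l k =
  m1 * (2 * R2 ^+ 2 + 2 * (m1 + 1) * e ^+ 2) + (4 * H1 ^+ 2 + 2 * m1 * R2 ^+ 2).
Proof.
transitivity (\tr (qm (2 * R2 ^+ 2 + 2 * (m1 + 1) * e ^+ 2)
    (4 * H1 ^+ 2 + 2 * m1 * R2 ^+ 2))); last by rewrite trqm -/m1; ring.
by apply: eq_bigr => i _; rewrite -contr_curv_curv.
Qed.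

(** For the pairing of the second covariant derivative of Ricci with the curvature, where [b] and
    [c] are different. *)
Lemma contr_tens_curv a b c d :
  \sum_i \sum_j \sum_k \sum_l
    (tens (qm 1 0) (qm a b) i j k l + tens (qm 0 1) (qm c d) i j k l)
    * curv j i l k =
  4 * H1 * d + 2 * m1 * R2 * (b + c) + 2 * m1 * (m1 + 1) * e * a.
Proof.
pose S X Y X' Y' := \sum_i \sum_j \sum_k \sum_l tens X Y i j k l * tens X' Y' j i l k.
have SE X Y X' Y' : S X Y X' Y' = \tr (\tr (Y *m Y') *: (X *m X') + X *m Y' *m Y *m X'
    + Y *m Y' *m X *m X' + \tr (X *m Y') *: (Y *m X')).
  by apply: eq_bigr => i _; rewrite contr_tens_tens.
transitivity (S (qm 1 0) (qm a b) (qm 1 0) (qm e R2) + S (qm 1 0) (qm a b) (qm 0 1) (qm R2 H1)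
    + S (qm 0 1) (qm c d) (qm 1 0) (qm e R2) + S (qm 0 1) (qm c d) (qm 0 1) (qm R2 H1)).
  rewrite /S -!big_split /=; apply: eq_bigr => i _.
  rewrite -!big_split /=; apply: eq_bigr => j _.
  rewrite -!big_split /=; apply: eq_bigr => k _.
  rewrite -!big_split /=; apply: eq_bigr => l _.
  by rewrite /curv; ring.
rewrite !SE !qmM !trqm !qmZ !qmD !trqm -/m1; ring.
Qed.

End Contractions.

(** * Unitary frames *)

Section Frames.
Context {R : realType} {n : nat}.
Local Notation C := R[i].
Implicit Types (E A B : 'M[C]_n) (u : 'I_n -> C) (i j k l : 'I_n).

Lemma eq_frame2 E (T T' : 'I_n -> 'I_n -> C) i j :
  (forall a b, T a b = T' a b) -> frame2 E T i j = frame2 E T' i j.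
Proof. by move=> TT; do 2!apply: eq_bigr => ? _; rewrite TT. Qed.

Lemma eq_frame3 E (T T' : 'I_n -> 'I_n -> 'I_n -> C) i j k :
  (forall a b c, T a b c = T' a b c) -> frame3 E T i j k = frame3 E T' i j k.
Proof. by move=> TT; do 3!apply: eq_bigr => ? _; rewrite TT. Qed.

Lemma eq_frame4 E (T T' : 'I_n -> 'I_n -> 'I_n -> 'I_n -> C) i j k l :
  (forall a b c d, T a b c d = T' a b c d) ->
  frame4 E T i j k l = frame4 E T' i j k l.
Proof. by move=> TT; do 4!apply: eq_bigr => ? _; rewrite TT. Qed.

Lemma frame2_mx E A i j : frame2 E A i j = (E *m A *m E^t*) i j.
Proof.
rewrite /frame2 mxE exchange_big /=; apply: eq_bigr => b _.
rewrite !mxE mulr_suml; apply: eq_bigr => a _.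
by rewrite mulrAC.
Qed.

Lemma frame3M E A u i j k :
  frame3 E (fun a b c => A a b * u c) i j k = frame2 E A i j * frame1 E u k.
Proof.
rewrite /frame3 /frame2 /frame1 mulr_suml; apply: eq_bigr => a _.
rewrite mulr_suml; apply: eq_bigr => b _.
by rewrite mulr_sumr; apply: eq_bigr => c _; ring.
Qed.

Lemma frame3_swap E (T : 'I_n -> 'I_n -> 'I_n -> C) i j k :
  frame3 E (fun a b c => T c b a) i j k = frame3 E T k j i.
Proof.
rewrite /frame3; under eq_bigr do rewrite exchange_big /=.
rewrite exchange_big /=.
apply: eq_bigr => a _; rewrite exchange_big /=.
apply: eq_bigr => b _; apply: eq_bigr => c _; ring.
Qed.

Lemma frame3D E (T T' : 'I_n -> 'I_n -> 'I_n -> C) i j k :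
  frame3 E (fun a b c => T a b c + T' a b c) i j k =
  frame3 E T i j k + frame3 E T' i j k.
Proof.
rewrite /frame3; do 3!(rewrite -big_split /=; apply: eq_bigr => ? _).
by rewrite mulrDr.
Qed.

Lemma frame4D E (T T' : 'I_n -> 'I_n -> 'I_n -> 'I_n -> C) i j k l :
  frame4 E (fun a b c d => T a b c d + T' a b c d) i j k l =
  frame4 E T i j k l + frame4 E T' i j k l.
Proof.
rewrite /frame4; do 4!(rewrite -big_split /=; apply: eq_bigr => ? _).
by rewrite mulrDr.
Qed.

(** The first and third indices transform by [E], the others by its conjugate, so each of the two
    products in [tens] is transformed factor by factor. *)
Lemma frame4_tens E A B i j k l :
  frame4 E (tens A B) i j k l =
  tens (E *m A *m E^t*) (E *m B *m E^t*) i j k l.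
Proof.
rewrite /tens -!frame2_mx.
have -> : frame2 E A i j * frame2 E B k l =
    frame4 E (fun a b c d => A a b * B c d) i j k l.
  rewrite /frame4 /frame2 mulr_suml; apply: eq_bigr => a _.
  rewrite mulr_suml; apply: eq_bigr => b _.
  rewrite mulr_sumr; apply: eq_bigr => c _.
  by rewrite mulr_sumr; apply: eq_bigr => d _; ring.
have -> : frame2 E B i l * frame2 E A k j =
    frame4 E (fun a b c d => B a d * A c b) i j k l.
  rewrite /frame4 /frame2 mulr_suml; apply: eq_bigr => a _.
  under [in RHS]eq_bigr do rewrite exchange_big /=.
  rewrite [RHS]exchange_big /=.
  under [in RHS]eq_bigr do rewrite exchange_big /=.
  rewrite mulr_suml; apply: eq_bigr => d _.
  rewrite mulr_sumr; apply: eq_bigr => c _.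
  by rewrite mulr_sumr; apply: eq_bigr => b _; ring.
by rewrite -frame4D.
Qed.

Section UnitaryFrame.
Variables (A E : 'M[C]_n) (AE : unitary_frame A E).

Lemma unitary_frame_unit : (E \in unitmx) /\ (A \in unitmx).
Proof.
have [EA _] := mulmx1_unit AE.
by move: EA; rewrite unitmx_mul => /andP[].
Qed.

Lemma unitary_frame_inv : E^t* *m E = invmx A.
Proof.
have [Eu Au] := unitary_frame_unit.
have H : E^t* *m (E *m A) = 1%:M by exact: mulmx1C AE.
by rewrite -[LHS]mulmx1 -(mulmxV Au) mulmxA -(mulmxA _ E) H mul1mx.
Qed.

(** Taking determinants in the unitarity relation gives [|det E|^2 * det A = 1]. Positivity is what
    allows [ln] of the determinant to be differentiated. *)
Lemma unitary_frame_det : 0 < \det A.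
Proof.
have : \det E * \det A * (\det E)^* = 1.
  have := congr1 determinant AE.
  by rewrite !det_mulmx det_map_mx det_tr det1.
have E0 : \det E != 0 by rewrite -unitfE -/(_ \in unitmx) -unitmxE; case: unitary_frame_unit.
rewrite mulrAC mulrC => /(canRL (mulfK _)) -> //; last first.
  by rewrite mulf_neq0 // conjC_eq0.
by rewrite mul1r invr_gt0 -normCK exprn_gt0 // normr_gt0.
Qed.

End UnitaryFrame.
End Frames.

(** The matrix determinant lemma, from two block triangular factorisations of one block matrix. *)
Lemma det_1Dmul (F : comNzRingType) (n : nat) (u : 'cV[F]_n) (v : 'rV[F]_n) :
  \det (1%:M + u *m v) = 1 + (v *m u) 0 0.
Proof.
have h1 : block_mx 1%:M (- u) v 1%:M =
    block_mx 1%:M 0 v 1%:M *m block_mx 1%:M (- u) 0 (1%:M + v *m u).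
  rewrite mulmx_block !mul1mx !mulmx1 !mulmx0 !mul0mx !addr0 mulmxN.
  by congr block_mx; rewrite addrCA addNr addr0.
have h2 : block_mx 1%:M (- u) v 1%:M =
    block_mx (1%:M + u *m v) (- u) 0 1%:M *m block_mx 1%:M 0 v 1%:M.
  rewrite mulmx_block !mul1mx !mulmx1 !mulmx0 !add0r mulNmx.
  by congr block_mx; rewrite ?addrK.
have := congr1 determinant h2.
rewrite h1 !det_mulmx !det_lblock !det_ublock !det1 !mul1r !mulr1 => <-.
by rewrite det_mx11 !mxE eqxx.
Qed.

(** * Radial metrics *)

Section Forms.
Context {R : realType} {n : nat}.
Local Notation C := R[i].
Local Notation Cn := 'rV[C]_n.
Implicit Types (z w : Cn) (i j k l m : 'I_n) (a b : R -> R).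

Local Notation "''d_' ( i , j )" := ((i == j)%:R : C) (at level 8, i, j at level 2).

Definition form2 a b i j w : C := rad a w * 'd_(i, j) + rad b w * ((w 0 i)^* * w 0 j).

(** The shape of the antiholomorphic derivatives of the metric and, conjugated, of the covariant
    derivative of Ricci. The symmetry in [j] and [l] reflects that the Kähler and Ricci forms are
    closed. *)
Definition form3 a b i j l w : C :=
  rad a w * (w 0 j * 'd_(i, l) + w 0 l * 'd_(i, j))
  + rad b w * ((w 0 i)^* * w 0 j * w 0 l).

Lemma is_wirt_form2 a b (a' b' : R) i j k z :
  is_derive (sqn z) 1 a a' -> is_derive (sqn z) 1 b b' ->
  is_wirt k (form2 a b i j) z
    (a'%:C * (z 0 k)^* * 'd_(i, j) + b'%:C * (z 0 k)^* * ((z 0 i)^* * z 0 j)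
      + rad b z * (z 0 i)^* * 'd_(j, k))
    (a'%:C * z 0 k * 'd_(i, j) + b'%:C * z 0 k * ((z 0 i)^* * z 0 j)
      + rad b z * 'd_(i, k) * z 0 j).
Proof.
move=> da db.
have H := is_wirtD (is_wirtM (is_wirt_rad k da) (is_wirt_cst k z 'd_(i, j)))
  (is_wirtM (is_wirt_rad k db)
    (is_wirtM (is_wirt_conj (is_wirt_coord k i z)) (is_wirt_coord k j z))).
by apply: (eq_is_wirt H) => //; rewrite ?conjC0 ?conjC_nat; ring.
Qed.

Lemma is_wirt_form3 a b (a' b' : R) i j l k z :
  is_derive (sqn z) 1 a a' -> is_derive (sqn z) 1 b b' ->
  is_wirt k (form3 a b i j l) z
    (a'%:C * (z 0 k)^* * (z 0 j * 'd_(i, l) + z 0 l * 'd_(i, j))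
      + rad a z * ('d_(j, k) * 'd_(i, l) + 'd_(l, k) * 'd_(i, j))
      + b'%:C * (z 0 k)^* * ((z 0 i)^* * z 0 j * z 0 l)
      + rad b z * (z 0 i)^* * ('d_(j, k) * z 0 l + z 0 j * 'd_(l, k)))
    (a'%:C * z 0 k * (z 0 j * 'd_(i, l) + z 0 l * 'd_(i, j))
      + b'%:C * z 0 k * ((z 0 i)^* * z 0 j * z 0 l)
      + rad b z * 'd_(i, k) * z 0 j * z 0 l).
Proof.
move=> da db.
have H := is_wirtD (is_wirtM (is_wirt_rad k da)
    (is_wirtD (is_wirtM (is_wirt_coord k j z) (is_wirt_cst k z 'd_(i, l)))
              (is_wirtM (is_wirt_coord k l z) (is_wirt_cst k z 'd_(i, j)))))
  (is_wirtM (is_wirt_rad k db)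
    (is_wirtM (is_wirtM (is_wirt_conj (is_wirt_coord k i z)) (is_wirt_coord k j z))
      (is_wirt_coord k l z))).
by apply: (eq_is_wirt H) => //; rewrite ?conjC0 ?conjC_nat; ring.
Qed.

Lemma rad_conj a z : (rad a z)^* = rad a z.
Proof. by rewrite /rad conj_Creal // complex_real. Qed.

Lemma sum_delta (F : 'I_n -> C) i : \sum_q 'd_(i, q) * F q = F i.
Proof.
rewrite (bigD1 i)//= eqxx mul1r big1 ?addr0 // => q.
by rewrite eq_sym => /negbTE ->; rewrite mul0r.
Qed.

Lemma sum_zzb z : \sum_q z 0 q * (z 0 q)^* = (sqn z)%:C.
Proof. by rewrite sqnC sqnormE. Qed.

Definition proj z : 'M[C]_n := z^t* *m z.

Lemma projE z i j : proj z i j = (z 0 i)^* * z 0 j.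
Proof. by rewrite mxE big_ord1 !mxE. Qed.

Lemma form2_mx a b z i j :
  form2 a b i j z = ((rad a z)%:M + rad b z *: proj z) i j.
Proof. by rewrite /form2 mulr_natr !mxE big_ord1 !mxE. Qed.

Lemma mulmx_proj z : z *m proj z = (sqn z)%:C *: z.
Proof.
rewrite /proj mulmxA; have -> : z *m z^t* = ((sqn z)%:C)%:M.
  apply/matrixP => i j; rewrite !ord1 !mxE eqxx mulr1n -sum_zzb.
  by apply: eq_bigr => q _; rewrite !mxE.
by rewrite mul_scalar_mx.
Qed.

End Forms.

Section RadialMetric.
Context {R : realType} {n : nat}.
Local Notation C := R[i].
Local Notation Cn := 'rV[C]_n.
Variables (g : Cn -> 'M[C]_n) (V : set Cn) (Vo : open V).
Variables (p p1 p2 p3 : R -> R).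
Hypothesis gE : forall w, V w -> forall i j, g w i j = form2 p p1 i j w.
Hypothesis dp : forall w, V w -> is_derive (sqn w) 1 p (p1 (sqn w)).
Hypothesis dp1 : forall w, V w -> is_derive (sqn w) 1 p1 (p2 (sqn w)).
Hypothesis dp2 : forall w, V w -> is_derive (sqn w) 1 p2 (p3 (sqn w)).
Hypothesis p0 : forall w, V w -> p (sqn w) != 0.
Hypothesis q0 : forall w, V w -> p (sqn w) + sqn w * p1 (sqn w) != 0.
Hypothesis gpos : forall w, V w -> posdef_hermitian (g w).
Implicit Types (z w : Cn) (i j k l m : 'I_n).

Local Notation "''d_' ( i , j )" := ((i == j)%:R : C) (at level 8, i, j at level 2).

Lemma near_in z : V z -> \forall w \near z, V w.
Proof. by move=> Vz; apply: open_nbhs_nbhs. Qed.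

Lemma g_mx z : V z -> g z = (rad p z)%:M + rad p1 z *: proj z.
Proof. by move=> Vz; apply/matrixP => i j; rewrite gE // form2_mx. Qed.

Lemma g_unit z : V z -> g z \in unitmx.
Proof. by move=> Vz; have [] := unitary_frame_unit (frameP (gpos Vz)). Qed.

(** Eigenvalue of the metric on the radial direction, see [mulmx_g]. *)
Definition zq z : C := rad p z + (sqn z)%:C * rad p1 z.

Lemma zq_neq0 z : V z -> zq z != 0.
Proof.
move=> Vz; rewrite /zq /rad -rmorphM -rmorphD /=.
by apply: contra (q0 Vz) => /eqP[->].
Qed.

Lemma rp_neq0 z : V z -> rad p z != 0.
Proof. by move=> Vz; apply: contra (p0 Vz) => /eqP[->]. Qed.

Lemma mulmx_g z : V z -> z *m g z = zq z *: z.
Proof.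
move=> Vz; rewrite g_mx // mulmxDr mul_mx_scalar -scalemxAr mulmx_proj.
by rewrite scalerA -scalerDl mulrC.
Qed.

Lemma mulmx_ginv z : V z -> z *m invmx (g z) = (zq z)^-1 *: z.
Proof.
move=> Vz; rewrite -[RHS]mulmx1 -(mulmxV (g_unit Vz)) mulmxA -scalemxAl.
by rewrite mulmx_g // scalerA mulVf ?scale1r // zq_neq0.
Qed.

(** Avoids an explicit inverse matrix: to contract with the inverse metric it is enough to exhibit
    [B] and check the equation multiplied by [g]. *)
Lemma ginv_solve z q (A B : 'I_n -> C) : V z ->
  (forall j, \sum_q B q * g z q j = A j) ->
  \sum_j ginv g q j z * A j = B q.
Proof.
move=> Vz BA; have : (\row_j B j) *m g z = \row_j A j.
  by apply/rowP => j; rewrite !mxE -BA; apply: eq_bigr => i _; rewrite mxE.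
move=> /(canRL (mulmxK (g_unit Vz))) /rowP /(_ q); rewrite !mxE => ->.
by apply: eq_bigr => j _; rewrite mxE mulrC.
Qed.

Lemma wirt_g z i j k : V z -> is_wirt k (fun w => g w i j) z
    ((rad p1 z) * (z 0 k)^* * 'd_(i, j) + (rad p2 z) * (z 0 k)^* * ((z 0 i)^* * z 0 j)
      + rad p1 z * (z 0 i)^* * 'd_(j, k))
    (form3 p1 p2 i k j z).
Proof.
move=> Vz; apply: (is_wirt_near (f := form2 p p1 i j)).
  by near=> w; rewrite gE //; near: w; exact: near_in.
apply: (eq_is_wirt (is_wirt_form2 i j k (dp Vz) (dp1 Vz))) => //.
rewrite /form3 /rad; ring.
Unshelve. all: by end_near. Qed.

(** [chm] and [chc] solve Gamma g = dg for a radial ansatz: [chm] is read off the terms with a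
    Kronecker delta, and [chc] from the remaining multiple of [z], on which [g] acts by [zq]. *)
Definition chm z : C := rad p1 z / rad p z.
Definition chc z : C := (rad p2 z - 2 * rad p1 z ^+ 2 / rad p z) / zq z.

Lemma Gamma_radial z q k i : V z -> Gamma g q k i z =
  chm z * ((z 0 k)^* * 'd_(i, q) + (z 0 i)^* * 'd_(k, q))
  + chc z * ((z 0 k)^* * (z 0 i)^* * z 0 q).
Proof.
move=> Vz; rewrite /Gamma.
under eq_bigr do rewrite (dz_val (wirt_g i _ k Vz)).
apply: (@ginv_solve z q _ (fun q => chm z * ((z 0 k)^* * 'd_(i, q) + (z 0 i)^* * 'd_(k, q))
  + chc z * ((z 0 k)^* * (z 0 i)^* * z 0 q))) => // j.
transitivity (\sum_q (chm z * (z 0 k)^* * ('d_(i, q) * g z q j)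
   + chm z * (z 0 i)^* * ('d_(k, q) * g z q j)
   + chc z * ((z 0 k)^* * (z 0 i)^*) * (z 0 q * g z q j))).
  by apply: eq_bigr => r _; ring.
rewrite !big_split /= -!mulr_sumr !sum_delta.
have -> : \sum_q z 0 q * g z q j = zq z * z 0 j.
  by have /rowP/(_ j) := mulmx_g Vz; rewrite !mxE.
have := rp_neq0 Vz; have := zq_neq0 Vz; rewrite !gE // /form2 /chm /chc.
rewrite (eq_sym j k).
move: (zq z) (rad p z) (rad p1 z) (rad p2 z) (z 0 j) (z 0 i)^* (z 0 k)^* => a b c d e f h.
by move: ('d_(i, j)) ('d_(k, j)) => a0 b0 a1 b1; field; rewrite a1 b1.
Qed.

Lemma sum_z_form3 a b z j l :
  \sum_q z 0 q * form3 a b q j l z =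
  (2 * rad a z + (sqn z)%:C * rad b z) * (z 0 j * z 0 l).
Proof.
transitivity (\sum_q (rad a z * z 0 j * ('d_(l, q) * z 0 q)
   + rad a z * z 0 l * ('d_(j, q) * z 0 q)
   + rad b z * z 0 j * z 0 l * (z 0 q * (z 0 q)^* ))).
  by apply: eq_bigr => q _; rewrite /form3 (eq_sym j q) (eq_sym l q); ring.
by rewrite !big_split /= -!mulr_sumr !sum_delta sum_zzb; ring.
Qed.

Lemma mix_mx z a b i j : V z -> (a *: g z + b *: proj z) i j =
  a * form2 p p1 i j z + b * ((z 0 i)^* * z 0 j).
Proof. by move=> Vz; rewrite !(mxE, gE) // big_ord1 !mxE. Qed.

(** Coefficients with respect to [g z] and [proj z] rather than to the identity matrix, because it
    is [g z] that a unitary frame turns into the identity. [Riem_c] is halved below since [tens] of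
    [proj z] with itself counts twice. *)
Definition Riem_e z := rad p1 z / rad p z ^+ 2.
Definition Riem_b z := rad p2 z / rad p z - 2 * rad p1 z ^+ 2 / rad p z ^+ 2.
Definition Riem_c z := 2 * rad p1 z ^+ 3 / rad p z ^+ 2
  - 4 * (rad p2 z - rad p1 z ^+ 2 / rad p z) * rad p1 z / rad p z
  + rad p3 z - 2 * rad p1 z * rad p2 z / rad p z
  - chc z * (2 * rad p1 z + (sqn z)%:C * rad p2 z).

Lemma Riem_radial z i j k l : V z -> Riem g i j k l z =
  tens (g z) (Riem_e z *: g z + Riem_b z *: proj z) i j k l
  + tens (proj z) (Riem_b z *: g z + (Riem_c z / 2) *: proj z) i j k l.
Proof.
move=> Vz; rewrite /Riem.
have -> : dz k (dzb j (fun w => g w i l)) z =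
    rad p2 z * (z 0 k)^* * (z 0 j * 'd_(i, l) + z 0 l * 'd_(i, j))
      + rad p1 z * ('d_(j, k) * 'd_(i, l) + 'd_(l, k) * 'd_(i, j))
      + rad p3 z * (z 0 k)^* * ((z 0 i)^* * z 0 j * z 0 l)
      + rad p2 z * (z 0 i)^* * ('d_(j, k) * z 0 l + z 0 j * 'd_(l, k)).
  apply: (@dz_val _ _ k _ z); apply: is_wirt_near.
    2: exact: (is_wirt_form3 i j l k (dp1 Vz) (dp2 Vz)).
  near=> w; apply/esym/(dzb_val (wirt_g i l j _)).
  by near: w; exact: near_in.
(* Summing over [a] first turns the quadratic term of the curvature into Christoffel symbols
   contracted with the derivative of the metric. *)
have -> : \sum_a \sum_b ginv g b a z * dz k (fun w => g w i a) z * dzb j (fun w => g w b l) z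
    = \sum_q Gamma g q k i z * form3 p1 p2 q j l z.
  rewrite exchange_big; apply: eq_bigr => q _.
  by rewrite mulr_suml; apply: eq_bigr => a _; rewrite (dzb_val (wirt_g q l j Vz)).
have -> : \sum_q Gamma g q k i z * form3 p1 p2 q j l z =
   chm z * ((z 0 k)^* * form3 p1 p2 i j l z + (z 0 i)^* * form3 p1 p2 k j l z)
   + chc z * ((z 0 k)^* * (z 0 i)^* ) *
     ((2 * rad p1 z + (sqn z)%:C * rad p2 z) * (z 0 j * z 0 l)).
  rewrite -sum_z_form3.
  transitivity (\sum_q (chm z * (z 0 k)^* * ('d_(i, q) * form3 p1 p2 q j l z)
     + chm z * (z 0 i)^* * ('d_(k, q) * form3 p1 p2 q j l z)
     + chc z * ((z 0 k)^* * (z 0 i)^* ) * (z 0 q * form3 p1 p2 q j l z))).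
    by apply: eq_bigr => q _; rewrite Gamma_radial //; ring.
  by rewrite !big_split /= -!mulr_sumr !sum_delta; ring.
rewrite (eq_sym j k) (eq_sym l k) /tens.
have := fun r s => mix_mx (Riem_e z) (Riem_b z) r s Vz.
have := fun r s => mix_mx (Riem_b z) (Riem_c z / 2) r s Vz.
move: (Riem_b z *: g z + (Riem_c z / 2) *: proj z) => M2 E2.
move: (Riem_e z *: g z + Riem_b z *: proj z) => M1 E1.
rewrite !(E1, E2) !(projE z).
rewrite (gE Vz i j) (gE Vz k j) /form2 /form3.
have := rp_neq0 Vz; rewrite /Riem_e /Riem_b /Riem_c /chm.
move: (chc z) (rad p z) (rad p1 z) (rad p2 z) (rad p3 z) ((sqn z)%:C).
move: (z 0 i)^* (z 0 k)^* (z 0 j) (z 0 l).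
move: ('d_(i, j)) ('d_(i, l)) ('d_(k, j)) ('d_(k, l)).
move=> a1 a2 a3 a4 b1 b2 b3 b4 c1 c2 c3 c4 c5 c6 H.
by field.
Unshelve. all: by end_near. Qed.

(* The metric has eigenvalue p, n - 1 times, and p + x p1 once; L1 and L2 below
   are the first two derivatives of the logarithm of detR. *)
Definition detR (x : R) : R := p x ^+ n * ((p x + x * p1 x) / p x).

Lemma det_g z : V z -> \det (g z) = (detR (sqn z))%:C.
Proof.
move=> Vz; have pz := rp_neq0 Vz.
have -> : g z = rad p z *: (1%:M + z^t* *m ((rad p1 z / rad p z) *: z)).
  rewrite g_mx // scalerDr scale_scalar_mx mulr1 -scalemxAr scalerA mulrCA.
  by rewrite (mulfV pz) mulr1.
rewrite detZ det_1Dmul /detR rmorphM rmorphXn /=; congr (_ * _).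
rewrite -scalemxAl mxE [(z *m _) _ _](_ : _ = (sqn z)%:C); last first.
  by rewrite mxE -sum_zzb; apply: eq_bigr => q _; rewrite !mxE.
rewrite rmorphM fmorphV rmorphD rmorphM /= mulrDl mulfV //.
by rewrite /rad; congr (_ + _); rewrite mulrC mulrA.
Qed.

Lemma detR_gt0 z : V z -> 0 < detR (sqn z).
Proof.
move=> Vz; have := unitary_frame_det (frameP (gpos Vz)).
by rewrite det_g // ltcR.
Qed.

Definition L1 x : R := (n%:R - 1) * p1 x / p x + (2 * p1 x + x * p2 x) / (p x + x * p1 x).
Definition L2 x : R := (n%:R - 1) * (p2 x / p x - (p1 x / p x) ^+ 2)
  + (3 * p2 x + x * p3 x) / (p x + x * p1 x)
  - ((2 * p1 x + x * p2 x) / (p x + x * p1 x)) ^+ 2.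

Lemma der_L z : V z -> is_derive (sqn z) 1 (fun x => ln (detR x)) (L1 (sqn z)).
Proof.
move=> Vz; have D0 := detR_gt0 Vz.
have dx := is_derive1_id (sqn z).
have pz := p0 Vz; have qz := q0 Vz.
have dq := is_derive1D (dp Vz) (is_derive1M dx (dp1 Vz)).
have dD := is_derive1M (is_derive1X n (dp Vz)) (is_derive1M dq (is_derive1V pz (dp Vz))).
apply: (eq_is_derive1 (is_derive1_chain (is_derive1_ln D0) dD)) => //.
rewrite /detR /L1 /=; move: pz qz; move: (sqn z) => x.
move: (p x) (p1 x) (p2 x) (p3 x) => a b c d a0 q.
(* The power rule produces [n.-1]; splitting [n] lets the powers of [p] cancel. *)
case: (n) => [|m].
  by rewrite expr0; field; rewrite a0 q.
rewrite exprS /=.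
have am0 : a ^+ m != 0 by rewrite expf_neq0.
by field; rewrite a0 q am0.
Qed.

Lemma der_L1 z : V z -> is_derive (sqn z) 1 L1 (L2 (sqn z)).
Proof.
move=> Vz; have dx := is_derive1_id (sqn z).
have pz := p0 Vz; have qz := q0 Vz.
have dq := is_derive1D (dp Vz) (is_derive1M dx (dp1 Vz)).
have H := is_derive1D
  (is_derive1M (is_derive1M (is_derive1_cst (sqn z) (n%:R - 1)) (dp1 Vz))
    (is_derive1V pz (dp Vz)))
  (is_derive1M (is_derive1D (is_derive1M (is_derive1_cst (sqn z) 2) (dp1 Vz))
    (is_derive1M dx (dp2 Vz))) (is_derive1V (f := fun t => p t + t * p1 t) qz dq)).
apply: (eq_is_derive1 H) => //; rewrite /L2.
move: pz qz; move: (sqn z) (n%:R : R) => x N.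
move: (p x) (p1 x) (p2 x) (p3 x) => a b c d a0 q.
by field; rewrite a0 q.
Qed.

(** For a radial function F(|z|^2) the complex Hessian is [form2] of F' and F''; here F is minus the
    logarithm of [detR]. *)
Lemma Ric_radial z i j : V z -> Ric g i j z =
  form2 (fun x => - L1 x) (fun x => - L2 x) i j z.
Proof.
move=> Vz; rewrite /Ric.
have dL w k : V w -> is_wirt k (logdet g) w ((L1 (sqn w))%:C * (w 0 k)^* )
    ((L1 (sqn w))%:C * w 0 k).
  move=> Vw; apply: is_wirt_near (is_wirt_rad k (der_L Vw)).
  near=> v; rewrite /logdet det_g //.
  by near: v; exact: near_in.
have H := is_wirtM (is_wirt_rad i (der_L1 Vz)) (is_wirt_coord i j z).
rewrite (dz_val (is_wirt_near _ H)); last first.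
  near=> w; apply/esym/(dzb_val (dL w j _)).
  by near: w; exact: near_in.
rewrite /form2 /rad !rmorphN /= (eq_sym j i); ring.
Unshelve. all: by end_near. Qed.

Lemma tr_ginv z (A : 'I_n -> 'I_n -> C) (B : 'M[C]_n) : (forall i j, A i j = B i j) ->
  \sum_i \sum_j ginv g i j z * A i j = \tr (invmx (g z) *m B).
Proof.
move=> AB; rewrite exchange_big /=; apply: eq_bigr => i _.
by rewrite !mxE; apply: eq_bigr => j _; rewrite AB.
Qed.

(** The form is rewritten through [g z] and [proj z]: the first has trace [n] against the inverse
    metric, and the second [sqn z / zq z] because [z] is an eigenvector. *)
Lemma tr_ginv_form2 z a b : V z ->
  \sum_i \sum_j ginv g i j z * form2 a b i j z =
  rad a z / rad p z * n%:R
  + (rad b z - rad a z * rad p1 z / rad p z) * (sqn z)%:C / zq z.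
Proof.
move=> Vz; have pz := rp_neq0 Vz.
rewrite (tr_ginv _ (fun i j => form2_mx a b z i j)).
have -> : (rad a z)%:M + rad b z *: proj z = (rad a z / rad p z) *: g z
    + (rad b z - rad a z * rad p1 z / rad p z) *: proj z.
  rewrite (g_mx Vz) scalerDr scale_scalar_mx (divfK pz) -addrA; congr (_ + _).
  by rewrite scalerA -scalerDl; congr (_ *: _); rewrite mulrAC addrC subrK.
rewrite mulmxDr -!scalemxAr (mulVmx (g_unit Vz)) mxtraceD !mxtraceZ mxtrace1.
congr (_ + _); rewrite -[RHS]mulrA; congr (_ * _).
rewrite /proj mulmxA mxtrace_mulC mulmxA (mulmx_ginv Vz) -scalemxAl mxtraceZ.
rewrite [LHS]mulrC; congr (_ / _); rewrite -sum_zzb /mxtrace big_ord1 mxE.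
by apply: eq_bigr => q _; rewrite !mxE.
Qed.

Lemma scal_radial z : V z -> scal g z = - rad L1 z / rad p z * n%:R
  - (rad L2 z - rad L1 z * rad p1 z / rad p z) * (sqn z)%:C / zq z.
Proof.
move=> Vz; rewrite /scal.
under eq_bigr do under eq_bigr do rewrite Ric_radial //.
rewrite tr_ginv_form2 // /rad !rmorphN /=; ring.
Qed.

Lemma Lap_radial z f (F F1 F2 : R -> R) : V z ->
  (forall w, V w -> f w = rad F w) ->
  (forall w, V w -> is_derive (sqn w) 1 F (F1 (sqn w))) ->
  (forall w, V w -> is_derive (sqn w) 1 F1 (F2 (sqn w))) ->
  Lap g f z = rad F1 z / rad p z * n%:R
  + (rad F2 z - rad F1 z * rad p1 z / rad p z) * (sqn z)%:C / zq z.
Proof.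
move=> Vz fF dF dF1; rewrite -tr_ginv_form2 //; apply: eq_bigr => i _.
apply: eq_bigr => j _; congr (_ * _).
have H := is_wirtM (is_wirt_rad i (dF1 _ Vz)) (is_wirt_coord i j z).
rewrite (dz_val (is_wirt_near _ H)).
  by rewrite /form2 /rad (eq_sym j i); ring.
near=> w; apply/esym.
have Vw : V w by near: w; exact: near_in.
apply: (dzb_val (c := (F1 (sqn w))%:C * (w 0 j)^* )).
apply: is_wirt_near (is_wirt_rad j (dF _ Vw)).
by near=> v; rewrite fF //; near: v; exact: near_in.
Unshelve. all: by end_near. Qed.

(** Since [r1] is the derivative of [r0], the terms with deltas [i = j] and [k = j] get the same
    coefficient [mu]. The conjugate accounts for two holomorphic slots and one antiholomorphic. *)
Lemma DRic_radial (r0 r1 r2 mu nu : R -> R) z i j k :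
  (forall w, V w -> forall i j, Ric g i j w = form2 r0 r1 i j w) ->
  is_derive (sqn z) 1 r0 (r1 (sqn z)) -> is_derive (sqn z) 1 r1 (r2 (sqn z)) ->
  rad mu z = rad r1 z - chm z * rad r0 z ->
  rad nu z = rad r2 z - 2 * chm z * rad r1 z
    - chc z * (rad r0 z + (sqn z)%:C * rad r1 z) ->
  V z -> DRic g i j k z = (form3 mu nu j k i z)^*.
Proof.
move=> RicE dr0 dr1 muE nuE Vz; rewrite /DRic.
have -> : dz k (Ric g i j) z =
    (r1 (sqn z))%:C * (z 0 k)^* * 'd_(i, j) + (r2 (sqn z))%:C * (z 0 k)^* * ((z 0 i)^* * z 0 j)
      + rad r1 z * (z 0 i)^* * 'd_(j, k).
  apply: (@dz_val _ _ k _ z); apply: is_wirt_near.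
    2: exact: (is_wirt_form2 i j k dr0 dr1).
  near=> w; apply/esym/RicE.
  by near: w; exact: near_in.
have -> : \sum_q Gamma g q k i z * Ric g q j z =
   chm z * ((z 0 k)^* * form2 r0 r1 i j z + (z 0 i)^* * form2 r0 r1 k j z)
   + chc z * ((z 0 k)^* * (z 0 i)^* ) * ((rad r0 z + (sqn z)%:C * rad r1 z) * z 0 j).
  transitivity (\sum_q (chm z * (z 0 k)^* * ('d_(i, q) * form2 r0 r1 q j z)
     + chm z * (z 0 i)^* * ('d_(k, q) * form2 r0 r1 q j z)
     + chc z * ((z 0 k)^* * (z 0 i)^* ) * (rad r0 z * ('d_(j, q) * z 0 q)
         + rad r1 z * z 0 j * (z 0 q * (z 0 q)^* )))).
    apply: eq_bigr => q _; rewrite (Gamma_radial q k i Vz) (RicE _ Vz).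
    by rewrite /form2 (eq_sym j q); ring.
  rewrite !big_split /= -!mulr_sumr !sum_delta big_split /= -!mulr_sumr.
  by rewrite sum_delta sum_zzb; ring.
rewrite /form3 rmorphD !rmorphM rmorphD !rmorphM /= !rad_conj !conjCK !conjC_nat.
rewrite muE nuE -!/(rad _ z) /form2 (eq_sym j k) (eq_sym j i); ring.
Unshelve. all: by end_near. Qed.

(** The four equations compare coefficients after replacing [g z] by [p] times the identity plus
    [p1] times [proj z]. [A2] and [A3] are separate because the tensor need not be symmetric in [j]
    and [l]. *)
Lemma DDRic_radial (mu nu mu1 nu1 : R -> R) z i j k l :
  (forall w, V w -> forall i j k, DRic g i j k w = (form3 mu nu j k i w)^* ) ->
  is_derive (sqn z) 1 mu (mu1 (sqn z)) -> is_derive (sqn z) 1 nu (nu1 (sqn z)) ->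
  V z -> forall A1 A2 A3 A4 : C,
  rad mu z = A1 * rad p z ^+ 2 ->
  rad mu1 z - chm z * rad mu z = A2 * rad p z + A1 * rad p z * rad p1 z ->
  rad nu z - chm z * rad mu z = A3 * rad p z + A1 * rad p z * rad p1 z ->
  rad nu1 z - 2 * chm z * rad nu z - chc z * (2 * rad mu z + (sqn z)%:C * rad nu z) =
    A4 + 2 * A1 * rad p1 z ^+ 2 + 2 * (A2 + A3) * rad p1 z ->
  DDRic g i j k l z =
  tens (g z) (A1 *: g z + A2 *: proj z) i j k l
  + tens (proj z) (A3 *: g z + (A4 / 2) *: proj z) i j k l.
Proof.
move=> DRicE dmu dnu Vz A1 A2 A3 A4 eq1 eq2 eq3 eq4; rewrite /DDRic.
have -> : dzb l (DRic g i j k) z =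
   ((mu1 (sqn z))%:C * (z 0 l)^* * (z 0 k * 'd_(j, i) + z 0 i * 'd_(j, k))
      + rad mu z * ('d_(k, l) * 'd_(j, i) + 'd_(i, l) * 'd_(j, k))
      + (nu1 (sqn z))%:C * (z 0 l)^* * ((z 0 j)^* * z 0 k * z 0 i)
      + rad nu z * (z 0 j)^* * ('d_(k, l) * z 0 i + z 0 k * 'd_(i, l)))^*.
  apply: (@dzb_val _ _ l _ z); apply: is_wirt_near.
    2: exact: (is_wirt_conj (is_wirt_form3 j k i l dmu dnu)).
  near=> w; apply/esym/DRicE.
  by near: w; exact: near_in.
have -> : \sum_q (Gamma g q l j z)^* * DRic g i q k z =
   (chm z * (z 0 l * (form3 mu nu j k i z)^* + z 0 j * (form3 mu nu l k i z)^* )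
   + chc z * (z 0 l * z 0 j) *
      ((2 * rad mu z + (sqn z)%:C * rad nu z) * ((z 0 k)^* * (z 0 i)^* ))).
  have cchm : (chm z)^* = chm z by rewrite /chm rmorphM fmorphV /= !rad_conj.
  have cx : ((sqn z)%:C)^* = (sqn z)%:C by rewrite conj_Creal // complex_real.
  have cchc : (chc z)^* = chc z.
    rewrite /chc /zq !(rmorphM, rmorphB, rmorphD, fmorphV, rmorphXn) /= !rad_conj cx.
    by rewrite conjC1.
  transitivity ((\sum_q Gamma g q l j z * form3 mu nu q k i z)^* ).
    rewrite rmorph_sum; apply: eq_bigr => q _.
    by rewrite (DRicE _ Vz) rmorphM.
  rewrite (_ : \sum_q _ = chm z * ((z 0 l)^* * form3 mu nu j k i z + (z 0 j)^* * form3 mu nu l k i z)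
   + chc z * ((z 0 l)^* * (z 0 j)^* ) *
     ((2 * rad mu z + (sqn z)%:C * rad nu z) * (z 0 k * z 0 i))).
    move: cchm cchc cx (rad_conj mu z) (rad_conj nu z).
    move: (chm z) (chc z) ((sqn z)%:C) (rad mu z) (rad nu z).
    move: (form3 mu nu j k i z) (form3 mu nu l k i z) => F1 F2 a b c d d' ca cb cc cd cd'.
    by rewrite !(rmorphM, rmorphD) /= !conjCK ca cb cc cd cd' conjC1.
  rewrite -sum_z_form3.
  transitivity (\sum_q (chm z * (z 0 l)^* * ('d_(j, q) * form3 mu nu q k i z)
     + chm z * (z 0 j)^* * ('d_(l, q) * form3 mu nu q k i z)
     + chc z * ((z 0 l)^* * (z 0 j)^* ) * (z 0 q * form3 mu nu q k i z))).
    by apply: eq_bigr => q _; rewrite (Gamma_radial q l j Vz); ring.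
  by rewrite !big_split /= -!mulr_sumr !sum_delta; ring.
rewrite /form3 !(rmorphM, rmorphD) /= !conjCK !conjC_nat !rad_conj.
rewrite (eq_sym j i) (eq_sym j k) (eq_sym l i) (eq_sym l k) /tens.
have := fun r s => mix_mx A1 A2 r s Vz.
have := fun r s => mix_mx A3 (A4 / 2) r s Vz.
move: (A3 *: g z + (A4 / 2) *: proj z) => M2 E2.
move: (A1 *: g z + A2 *: proj z) => M1 E1.
rewrite !(E1, E2) !(projE z) (gE Vz i j) (gE Vz k j) /form2.
have {}eq2 : rad mu1 z = A2 * rad p z + A1 * rad p z * rad p1 z + chm z * rad mu z.
  by rewrite -eq2 subrK.
have {}eq3 : rad nu z = A3 * rad p z + A1 * rad p z * rad p1 z + chm z * rad mu z.
  by rewrite -eq3 subrK.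
have {}eq4 : rad nu1 z = A4 + 2 * A1 * rad p1 z ^+ 2 + 2 * (A2 + A3) * rad p1 z
    + chc z * (2 * rad mu z + (sqn z)%:C * rad nu z) + 2 * chm z * rad nu z.
  by rewrite -eq4 !subrK.
rewrite eq4 eq2 eq3 eq1; move: (chm z) (chc z) (rad p z) (rad p1 z) ((sqn z)%:C).
move: (z 0 i)^* (z 0 k)^* (z 0 j) (z 0 l).
move: ('d_(i, j)) ('d_(i, l)) ('d_(k, j)) ('d_(k, l)).
move=> a1 a2 a3 a4 b1 b2 b3 b4 c1 c2 c3 c4 c5.
by field.
Unshelve. all: by end_near. Qed.

Definition uproj z : 'M[C]_n := frame g z *m proj z *m (frame g z)^t*.
(** Squared length for the metric of the covector d'|z|^2, whose components are \bar z_i and whose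
    expression in the frame is [uvec]; see [uvec_sq]. *)
Definition usq z : C := (sqn z)%:C / zq z.

Lemma frame_g z : V z -> frame g z *m g z *m (frame g z)^t* = 1%:M.
Proof. by move=> Vz; exact: frameP (gpos Vz). Qed.

Lemma trmxCK (m' n' : nat) (A : 'M[C]_(m', n')) : (A^t*)^t* = A.
Proof. by apply/matrixP => i j; rewrite !mxE conjCK. Qed.

Lemma trmxCM (m' n' r' : nat) (A : 'M[C]_(m', n')) (B : 'M[C]_(n', r')) :
  (A *m B)^t* = B^t* *m A^t*.
Proof. by rewrite trmx_mul map_mxM. Qed.

Definition uvec z : 'cV[C]_n := frame g z *m z^t*.

Lemma uprojE z : uproj z = uvec z *m (uvec z)^t*.
Proof. by rewrite /uvec trmxCM trmxCK /uproj /proj !mulmxA. Qed.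

Lemma uvec_sq z : V z -> (uvec z)^t* *m uvec z = (usq z)%:M.
Proof.
move=> Vz; rewrite /uvec trmxCM trmxCK mulmxA -(mulmxA z).
rewrite (unitary_frame_inv (frameP (gpos Vz))) (mulmx_ginv Vz) -scalemxAl.
have -> : z *m z^t* = ((sqn z)%:C)%:M.
  apply/matrixP => i j; rewrite !ord1 !mxE eqxx mulr1n -sum_zzb.
  by apply: eq_bigr => q _; rewrite !mxE.
by rewrite scale_scalar_mx mulrC.
Qed.

(** Where [usq z] is nonzero the projector is the normalised [uproj z]. Otherwise [z = 0], both
    sides vanish and any Hermitian rank one projector will do, so the origin needs no separate
    treatment later. *)
Lemma exists_uproj z : (0 < n)%N -> V z -> exists Q : 'M[C]_n,
  [/\ Q *m Q = Q, \tr Q = 1, Q^t* = Q & uproj z = usq z *: Q].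
Proof.
move=> n0 Vz; case: (eqVneq (usq z) 0) => [s0|s0].
  have i0 : 'I_n := Ordinal n0.
  exists (delta_mx i0 i0); split.
  - by rewrite mul_delta_mx.
  - rewrite /mxtrace (bigD1 i0)//= mxE eqxx big1 ?addr0 // => i /negbTE ii0.
    by rewrite mxE ii0.
  - by rewrite trmx_delta map_delta_mx.
  - rewrite s0 scale0r uprojE; have /eqP := s0.
    rewrite /usq mulf_eq0 invr_eq0 (negbTE (zq_neq0 Vz)) orbF sqnC => /eqP sz0.
    suff -> : z = 0 by rewrite /uvec trmx0 map_mx0 mulmx0 mul0mx.
    apply/rowP => i; rewrite mxE; apply/eqP; rewrite -normr_eq0 -sqrf_eq0.
    by move/eqP: sz0; rewrite psumr_eq0 => [/allP/(_ i)|j _];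
      rewrite ?mem_index_enum ?exprn_ge0 //; exact.
exists ((usq z)^-1 *: uproj z); split.
- rewrite -scalemxAl -scalemxAr uprojE mulmxA -(mulmxA (uvec z)) (uvec_sq Vz).
  by rewrite mul_mx_scalar -scalemxAl (scalerA _ (usq z)) (mulVf s0) scale1r.
- by rewrite mxtraceZ uprojE mxtrace_mulC (uvec_sq Vz) mxtrace_scalar mulr1n mulVf.
- rewrite linearZ /= map_mxZ /= uprojE trmxCM trmxCK; congr (_ *: _).
  rewrite fmorphV /=; congr _^-1.
  have -> : usq z = ((sqn z / (p (sqn z) + sqn z * p1 (sqn z)))%:C).
    by rewrite /usq /zq /rad rmorphM fmorphV rmorphD rmorphM.
  by rewrite conj_Creal // complex_real.
- by rewrite scalerA mulfV // scale1r.
Qed.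

(** * Tensor components and squared norms in a unitary frame *)

Section FrameComponents.
Variables (z : Cn) (Vz : V z) (Q : 'M[C]_n) (QJ : Q^t* = Q).
Hypothesis NQ : uproj z = usq z *: Q.

Lemma frame4_mix (T : 'I_n -> 'I_n -> 'I_n -> 'I_n -> C) a1 a2 a3 a4 i j k l :
  (forall a b c d, T a b c d = tens (g z) (a1 *: g z + a2 *: proj z) a b c d
     + tens (proj z) (a3 *: g z + a4 *: proj z) a b c d) ->
  frame4 (frame g z) T i j k l =
  tens (qm Q 1 0) (qm Q a1 (a1 + a2 * usq z)) i j k l
  + tens (qm Q 0 1) (qm Q (a1 + a3 * usq z)
       (a1 + a2 * usq z + a3 * usq z + a4 * usq z ^+ 2)) i j k l.
Proof.
move=> TE; rewrite (eq_frame4 _ _ _ _ _ TE) frame4D !frame4_tens.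
rewrite !mulmxDr !mulmxDl -!scalemxAr -!scalemxAl (frame_g Vz) -/(uproj z) NQ.
exact: tens_mix.
Qed.

Lemma frame2_mix (T : 'I_n -> 'I_n -> C) r0 r1 i j :
  (forall a b, T a b = form2 r0 r1 a b z) ->
  frame2 (frame g z) T i j =
  qm Q (rad r0 z / rad p z)
    (rad r0 z / rad p z + (rad r1 z - rad r0 z / rad p z * rad p1 z) * usq z) i j.
Proof.
move=> TE; have pz := rp_neq0 Vz.
have TE' a b : T a b = ((rad r0 z / rad p z) *: g z
    + (rad r1 z - rad r0 z / rad p z * rad p1 z) *: proj z) a b.
  rewrite TE (mix_mx _ _ a b Vz) /form2.
  move: ((a == b)%:R : C) ((z 0 a)^* * z 0 b) pz => d q.
  by move: (rad p z) (rad p1 z) (rad r0 z) (rad r1 z) => x y u v x0; field.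
rewrite (eq_frame2 _ _ _ TE') frame2_mx mulmxDr mulmxDl -!scalemxAr -!scalemxAl.
by rewrite (frame_g Vz) -/(uproj z) NQ qm_mix.
Qed.

Lemma qm_conj (a b : C) i j : a^* = a -> b^* = b -> (qm Q a b i j)^* = qm Q a b j i.
Proof.
move=> aR bR; have QE : (Q i j)^* = Q j i by rewrite -[in RHS]QJ !mxE.
rewrite /qm !mxE rmorphD !rmorphM rmorphB /= aR bR QE conjC_nat.
by rewrite (eq_sym i j).
Qed.

(** As [Q] is Hermitian and the coefficients are real, conjugating a component exchanges [i] with
    [j] and [k] with [l], which reduces the norm to [contr_curv4]. *)
Lemma normsqR_frame e R2 H1 : e^* = e -> R2^* = R2 -> H1^* = H1 ->
  Q *m Q = Q -> \tr Q = 1 ->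
  (forall i j k l, uR g z i j k l = curv Q e R2 H1 i j k l) ->
  normsqR g z = (n%:R - 1) * (2 * R2 ^+ 2 + 2 * n%:R * e ^+ 2)
    + (4 * H1 ^+ 2 + 2 * (n%:R - 1) * R2 ^+ 2).
Proof.
move=> eR R2R H1R QQ trQ uRE.
transitivity (\sum_i \sum_j \sum_k \sum_l curv Q e R2 H1 i j k l * curv Q e R2 H1 j i l k).
  do 4!(apply: eq_bigr => ? _); rewrite uRE normCK; congr (_ * _).
  have QE a b : (Q a b)^* = Q b a by rewrite -[in RHS]QJ !mxE.
  have PE a b : ((1%:M - Q) a b)^* = (1%:M - Q) b a.
    by rewrite !mxE rmorphB /= QE conjC_nat eq_sym.
  rewrite !curvE /=; move: (1%:M - Q) PE => P PE.
  rewrite !(rmorphD, rmorphM) /= !QE !PE eR R2R H1R; ring.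
by rewrite contr_curv4 // subrK.
Qed.

Lemma normsqRic_frame r2 r1 : r2^* = r2 -> r1^* = r1 ->
  Q *m Q = Q -> \tr Q = 1 ->
  (forall i j, uRic g z i j = qm Q r2 r1 i j) ->
  normsqRic g z = (n%:R - 1) * r2 ^+ 2 + r1 ^+ 2.
Proof.
move=> r2R r1R QQ trQ uE.
transitivity (\tr (qm Q r2 r1 *m qm Q r2 r1)).
  apply: eq_bigr => i _; rewrite mxE; apply: eq_bigr => j _.
  by rewrite uE normCK qm_conj.
by rewrite qmM // trqm //; ring.
Qed.

(** The covariant derivative is A_ij \bar z_k + A_kj \bar z_i for a matrix [A] that becomes
    [qm Q al be] in the frame. The term with three coordinates is shared by both summands, hence the
    division by 2. The square expands into four traces. *)
Lemma normsqDRic_frame (mu nu : R -> R) (al : C) :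
  (forall i j k, DRic g i j k z = (form3 mu nu j k i z)^* ) ->
  Q *m Q = Q -> \tr Q = 1 ->
  rad mu z = al * rad p z -> al^* = al ->
  let be := al + (rad nu z - 2 * al * rad p1 z) / 2 * usq z in
  be^* = be ->
  normsqDRic g z = 2 * usq z * ((n%:R - 1) * al ^+ 2 + 2 * be ^+ 2).
Proof.
move=> DE QQ trQ muE alR be beR.
pose A : 'M[C]_n := al *: g z + ((rad nu z - 2 * al * rad p1 z) / 2) *: proj z.
have DE' i j k : DRic g i j k z = A i j * (z 0 k)^* + A k j * (z 0 i)^*.
  rewrite DE /A (mix_mx _ _ i j Vz) (mix_mx _ _ k j Vz) /form3 /form2.
  rewrite !(rmorphM, rmorphD) /= !rad_conj !conjCK !conjC_nat muE.
  rewrite (eq_sym j i) (eq_sym j k).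
  move: (rad p z) (rad p1 z) (rad nu z) ((i == j)%:R : C) ((k == j)%:R : C).
  by move: (z 0 i)^* (z 0 k)^* (z 0 j) => a b c d e f h l; field.
have AE : frame g z *m A *m (frame g z)^t* = qm Q al be.
  rewrite /A mulmxDr mulmxDl -!scalemxAr -!scalemxAl (frame_g Vz) -/(uproj z) NQ.
  exact: qm_mix.
pose u := uvec z; pose B := qm Q al be.
have uDE i j k : uDRic g z i j k = B i j * u k 0 + B k j * u i 0.
  rewrite /uDRic (eq_frame3 _ _ _ _ DE') frame3D frame3M.
  rewrite (frame3_swap _ (fun a b c => A a b * (z 0 c)^* )) frame3M.
  rewrite !frame2_mx AE; congr (_ * _ + _ * _).
    by rewrite /u /uvec mxE; apply: eq_bigr => a _; rewrite !mxE.
  by rewrite /u /uvec mxE; apply: eq_bigr => a _; rewrite !mxE.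
have BB i j : (B i j)^* = B j i by exact: qm_conj.
have uu i k : u i 0 * (u k 0)^* = (usq z *: Q) i k.
  by rewrite -NQ uprojE [in RHS]mxE big_ord1 !mxE.
transitivity (\sum_i \sum_j \sum_k
   (B i j * B j i * (usq z *: Q) k k + B i j * B j k * (usq z *: Q) k i
  + (B k j * B j i * (usq z *: Q) i k + B k j * B j k * (usq z *: Q) i i))).
  do 3!(apply: eq_bigr => ? _); rewrite uDE normCK rmorphD !rmorphM /= !BB -!uu; ring.
have h1 : \sum_i \sum_j \sum_k B i j * B j i * (usq z *: Q) k k =
    \tr (B *m B) * \tr (usq z *: Q).
  rewrite mulr_suml; apply: eq_bigr => i _; rewrite mxE mulr_suml.
  by apply: eq_bigr => j _; rewrite mulr_sumr.
have h2 : \sum_i \sum_j \sum_k B i j * B j k * (usq z *: Q) k i =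
    \tr (B *m B *m (usq z *: Q)).
  apply: eq_bigr => i _; rewrite exchange_big mxE; apply: eq_bigr => k _.
  by rewrite [(B *m B) i k]mxE big_distrl.
have h3 : \sum_i \sum_j \sum_k B k j * B j i * (usq z *: Q) i k =
    \tr (B *m B *m (usq z *: Q)).
  rewrite -h2; under eq_bigr do rewrite exchange_big /=.
  rewrite exchange_big /=; apply: eq_bigr => k _.
  by rewrite exchange_big.
have h4 : \sum_i \sum_j \sum_k B k j * B j k * (usq z *: Q) i i =
    \tr (B *m B) * \tr (usq z *: Q).
  rewrite -h1; under eq_bigr do rewrite exchange_big /=.
  rewrite exchange_big /=; apply: eq_bigr => k _.
  by rewrite exchange_big.
under eq_bigr do under eq_bigr do rewrite !big_split /=.
under eq_bigr do rewrite !big_split /=.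
rewrite !big_split /= h1 h2 h3 h4.
have -> : usq z *: Q = qm Q 0 (usq z) by rewrite /qm scale0r add0r.
by rewrite !qmM // !trqm //; ring.
Qed.

End FrameComponents.
End RadialMetric.

Definition a2_formula {F : fieldType} (N K b c : F) : F :=
  (N * (N ^+ 2 - 1) * ((N - 2) * b ^+ 2 + 2 * N * b * c + (N + 2) * c ^+ 2)
   + N * (N + 1) * (2 - 4 * (N + 1) + 3 * N * (N + 1)) * K ^+ 2) / 24.

(** In the notation of the overview, the argument called [y] receives 1 / y. The field is arbitrary
    because the formula is evaluated in [C] and also compared with polynomials. *)
Definition a3_formula {F : fieldType} (N K b c y : F) : F :=
  N * (N ^+ 2 - 1) / 48 *
  (N * (N + 1) * (N - 2) * K ^+ 3
   + 2 * ((N + 1) * (N + 2) * (N + 3) * c ^+ 2 * y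
       + (N + 1) * (N + 2) * (2 * N + 3) * c ^+ 3
       + 2 * N * (N + 1) * (N + 2) * b * c * y
       + 3 * (N + 1) * (2 * N ^+ 2 + 3 * N + 2) * b * c ^+ 2
       + N * (N - 2) * (N + 2) * b ^+ 2 * y
       + 3 * N ^+ 2 * (2 * N + 1) * b ^+ 2 * c
       + N * (N - 2) * (2 * N + 1) * b ^+ 3)
   - ((N + 1) * (N + 2) * (N + 6) * K * c ^+ 2
       + 2 * N * (N + 1) * (N + 4) * K * b * c
       + N * (N - 2) * (N + 3) * K * b ^+ 2)).

(** The final identity over bare variables, so that [field] meets no function values. [t], [s] are
    the Ricci eigenvalues, [e], [m], [r] the curvature coefficients, [sg] is [sig], [A] is [A1], and
    the zeros are the terms with derivatives of the scalar curvature. *)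
Lemma a3_assembly (F : numFieldType) (N k B D Y : F) :
  let e := B + D - k in let f := N * B + (N + 1) * D in
  let h := N ^+ 2 * B + (N + 1) ^+ 2 * D in
  let m := e - f in let r := e - 3 / 2 * f + h / 2 in
  let t := (N + 1) * k - B in let s := (N + 1) * k + (N - 1) * B in
  let sg := Y + e in let A := N * B * sg in
  let nR := (N - 1) * (2 * m ^+ 2 + 2 * N * e ^+ 2) + (4 * r ^+ 2 + 2 * (N - 1) * m ^+ 2) in
  let nRic := (N - 1) * t ^+ 2 + s ^+ 2 in
  let RRR := 2 * r * s ^+ 2 + 2 * (N - 1) * m * s * t + N * (N - 1) * e * t ^+ 2 in
  let RcRR := (N - 1) * t * (2 * m ^+ 2 + 2 * N * e ^+ 2)
     + s * (4 * r ^+ 2 + 2 * (N - 1) * m ^+ 2) in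
  let s3 := (N - 1) * t ^+ 3 + s ^+ 3 in
  let DDR := 4 * r * (N * B / 2 * ((1 - N) * (e - f) + N * (N - 1) * sg))
    + 2 * (N - 1) * m * (N * B * (e - f - N * sg) + - N * A) + 2 * (N - 1) * N * e * A in
  let sc := N * (N + 1) * k in
  let lap := N * (N - 1) * (N + 1) *
  (2 * N * (N - 2) * B ^+ 2 * ((N + 1) * Y - N * k + 2 * N * B + (2 * N + 1) * D)
   + 2 * N * (2 * N + 1) * B * D *
     ((N + 2) * Y - (N + 1) * k + (2 * N + 1) * B + (2 * N + 2) * D)
   + (N + 2) * (2 * N + 2) * D ^+ 2 *
     ((N + 3) * Y - (N + 2) * k + (2 * N + 2) * B + (2 * N + 3) * D)) in
  0 / 8 + (- 0 - 2 * (N ^+ 2 * (N ^+ 2 - 1) * B ^+ 2 * sg) + DDR - RRR - s3) / 24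
  - (2 * 0 + 0 + sc * 0) / 6 + lap / 48 + sc * (sc ^+ 2 - 4 * nRic + nR) / 48
  + (s3 - RcRR - RRR) / 24 = a3_formula N k B D Y.
Proof.
move=> e f h m r t s sg A nR nRic RRR RcRR s3 DDR sc lap.
rewrite /a3_formula /lap /sc /DDR /s3 /RcRR /RRR /nRic /nR /A /sg /s /t /r /m /h /f /e.
by field.
Qed.

(** * Metrics with p1 = p^2 (b + c - K) *)

Section LocalModel.
Context {R : realType} {n : nat}.
Local Notation C := R[i].
Local Notation Cn := 'rV[C]_n.
Variables (g : Cn -> 'M[C]_n) (V : set Cn) (Vo : open V).
(* Off the origin lam x = 1 / x, b = B / (x p)^n and c = D / (x p)^(n+1); near the
   origin b = c = lam = 0, and both situations satisfy the hypotheses below. *)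
Variables (p b c lam : R -> R) (K : R).
Implicit Types (z w : Cn) (i j k l : 'I_n) (x : R).

(* me' = - mf mk and mf' = - mh mk; mp2, mp3 and mk1 are the derivatives of mp1, mp2
   and mk. *)
Definition me x : R := b x + c x - K.
Definition mf x : R := n%:R * b x + (n%:R + 1) * c x.
Definition mh x : R := n%:R ^+ 2 * b x + (n%:R + 1) ^+ 2 * c x.
(** Off the origin this is the logarithmic derivative of y = x p, so each E / y^k has derivative
    [- k * mk] times itself. *)
Definition mk x : R := lam x + p x * me x.
Definition mp1 x : R := p x ^+ 2 * me x.
Definition mp2 x : R := 2 * p x ^+ 3 * me x ^+ 2 - p x ^+ 2 * (mf x * mk x).
Definition mk1 x : R := - lam x ^+ 2 + p x ^+ 2 * me x ^+ 2 - p x * (mf x * mk x).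
Definition mp3 x : R := 6 * p x ^+ 4 * me x ^+ 3 - 6 * p x ^+ 3 * me x * (mf x * mk x)
  + p x ^+ 2 * mh x * mk x ^+ 2 - p x ^+ 2 * mf x * mk1 x.

Hypothesis n0 : (0 < n)%N.
Hypothesis gE : forall w, V w -> forall i j, g w i j = form2 p mp1 i j w.
Hypothesis dp : forall w, V w -> is_derive (sqn w) 1 p (mp1 (sqn w)).
Hypothesis db : forall w, V w -> is_derive (sqn w) 1 b (- (n%:R * b (sqn w) * mk (sqn w))).
Hypothesis dc : forall w, V w ->
  is_derive (sqn w) 1 c (- ((n%:R + 1) * c (sqn w) * mk (sqn w))).
Hypothesis dl : forall w, V w -> is_derive (sqn w) 1 lam (- lam (sqn w) ^+ 2).
Hypothesis bl : forall w, V w -> b (sqn w) * (lam (sqn w) * sqn w) = b (sqn w).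
Hypothesis cl : forall w, V w -> c (sqn w) * (lam (sqn w) * sqn w) = c (sqn w).
Hypothesis p0 : forall w, V w -> p (sqn w) != 0.
Hypothesis w0 : forall w, V w -> 1 + sqn w * p (sqn w) * me (sqn w) != 0.
Hypothesis gpos : forall w, V w -> posdef_hermitian (g w).

(** Hypotheses [bl] and [cl] say that [lam x * x - 1] annihilates [b] and [c]. This is the
    alternative on which every identity of the model is checked. *)
Lemma model_cases w : V w ->
  (sqn w != 0 /\ lam (sqn w) = (sqn w)^-1) \/ (b (sqn w) = 0 /\ c (sqn w) = 0).
Proof.
move=> Vw; case: (eqVneq (lam (sqn w) * sqn w) 1) => [lx|lx].
  left; have x0 : sqn w != 0.
    by apply/eqP => x0; move/eqP: lx; rewrite x0 mulr0 eq_sym oner_eq0.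
  by split=> //; rewrite -[LHS](mulfK x0) lx mul1r.
have lx' : lam (sqn w) * sqn w - 1 != 0 by rewrite subr_eq0.
by right; split; apply/(mulIf lx'); rewrite mul0r mulrBr mulr1 ?bl ?cl // subrr.
Qed.

Lemma q0 w : V w -> p (sqn w) + sqn w * mp1 (sqn w) != 0.
Proof.
move=> Vw; have := mulf_neq0 (p0 Vw) (w0 Vw); congr (_ != 0).
by rewrite /mp1; ring.
Qed.

Lemma de w : V w -> is_derive (sqn w) 1 me (- (mf (sqn w) * mk (sqn w))).
Proof.
move=> Vw; apply: (eq_is_derive1 (is_derive1B (is_derive1D (db Vw) (dc Vw))
  (is_derive1_cst _ K))) => //; rewrite /mf; ring.
Qed.

Lemma df w : V w -> is_derive (sqn w) 1 mf (- (mh (sqn w) * mk (sqn w))).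
Proof.
move=> Vw; have cst (a : R) := is_derive1_cst (sqn w) a.
apply: (eq_is_derive1 (is_derive1D (is_derive1M (cst n%:R) (db Vw))
  (is_derive1M (cst (n%:R + 1)) (dc Vw)))) => //; rewrite /mh; ring.
Qed.

Lemma dk w : V w -> is_derive (sqn w) 1 mk (mk1 (sqn w)).
Proof.
move=> Vw; apply: (eq_is_derive1 (is_derive1D (dl Vw) (is_derive1M (dp Vw) (de Vw)))) => //.
by rewrite /mk1 /mp1; ring.
Qed.

Lemma dp1 w : V w -> is_derive (sqn w) 1 mp1 (mp2 (sqn w)).
Proof.
move=> Vw; apply: (eq_is_derive1 (is_derive1M (is_derive1X 2 (dp Vw)) (de Vw))) => //.
by rewrite /mp2 /mp1; ring.
Qed.

Lemma dp2 w : V w -> is_derive (sqn w) 1 mp2 (mp3 (sqn w)).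
Proof.
move=> Vw; have cst (a : R) := is_derive1_cst (sqn w) a.
apply: (eq_is_derive1 (is_derive1B
  (is_derive1M (is_derive1M (cst 2) (is_derive1X 3 (dp Vw))) (is_derive1X 2 (de Vw)))
  (is_derive1M (is_derive1X 2 (dp Vw)) (is_derive1M (df Vw) (dk Vw))))) => //.
by rewrite /mp3 /mp1 /=; ring.
Qed.

(** [mr0], [mr1] are the [form2] coefficients of Ricci, and [mmu], [mnu] the [form3] coefficients of
    its covariant derivative, with the derivatives of [p] eliminated by the ODE. The names ending in
    the next digit are derivatives. *)
Definition mr0 x : R := ((n%:R + 1) * K - b x) * p x.
Definition mr1 x : R := ((n%:R + 1) * K - b x) * mp1 x + n%:R * b x * p x * mk x.
Definition mmu x : R := n%:R * b x * p x * mk x.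
Definition mmu1 x : R := n%:R * (- (n%:R * b x * mk x) * p x * mk x
  + b x * mp1 x * mk x + b x * p x * mk1 x).
Definition mr2 x : R := n%:R * b x * mk x * mp1 x + ((n%:R + 1) * K - b x) * mp2 x + mmu1 x.
Definition mnu x : R := mmu x * (2 * p x * me x - (n%:R + 1) * mk x).
Definition mnu1 x : R := mmu1 x * (2 * p x * me x - (n%:R + 1) * mk x)
  + mmu x * (2 * (mp1 x * me x - p x * (mf x * mk x)) - (n%:R + 1) * mk1 x).

Lemma dr0 w : V w -> is_derive (sqn w) 1 mr0 (mr1 (sqn w)).
Proof.
move=> Vw; have cst (a : R) := is_derive1_cst (sqn w) a.
apply: (eq_is_derive1 (is_derive1M (is_derive1B (cst ((n%:R + 1) * K)) (db Vw))
  (dp Vw))) => //; rewrite /mr1; ring.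
Qed.

Lemma dmu w : V w -> is_derive (sqn w) 1 mmu (mmu1 (sqn w)).
Proof.
move=> Vw; have cst (a : R) := is_derive1_cst (sqn w) a.
apply: (eq_is_derive1 (is_derive1M (is_derive1M (is_derive1M (cst n%:R) (db Vw))
  (dp Vw)) (dk Vw))) => //; rewrite /mmu1; ring.
Qed.

Lemma dr1 w : V w -> is_derive (sqn w) 1 mr1 (mr2 (sqn w)).
Proof.
move=> Vw; have cst (a : R) := is_derive1_cst (sqn w) a.
apply: (eq_is_derive1 (is_derive1D
  (is_derive1M (is_derive1B (cst ((n%:R + 1) * K)) (db Vw)) (dp1 Vw)) (dmu Vw))) => //.
by rewrite /mr2; ring.
Qed.

Lemma dnu w : V w -> is_derive (sqn w) 1 mnu (mnu1 (sqn w)).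
Proof.
move=> Vw; have cst (a : R) := is_derive1_cst (sqn w) a.
apply: (eq_is_derive1 (is_derive1M (dmu Vw) (is_derive1B
  (is_derive1M (is_derive1M (cst 2) (dp Vw)) (de Vw)) (is_derive1M (cst (n%:R + 1)) (dk Vw))))) => //.
by rewrite /mnu1; ring.
Qed.

(** Off the origin this is the first integral [M1] of [const_scal_ode] divided by a power of [y]:
    the derivative of the logarithm of the determinant is linear in [b] and [K]. *)
Lemma model_L1 w : V w -> - L1 (n := n) p mp1 mp2 (sqn w) = mr0 (sqn w).
Proof.
move=> Vw; have := model_cases Vw; have := p0 Vw; have := w0 Vw.
have -> : L1 (n := n) p mp1 mp2 (sqn w) = (n%:R - 1) * mp1 (sqn w) / p (sqn w)
   + (2 * mp1 (sqn w) + sqn w * mp2 (sqn w)) / (p (sqn w) * (1 + sqn w * p (sqn w) * me (sqn w))).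
  by rewrite /L1; congr (_ + _ / _); rewrite /mp1; ring.
rewrite /mr0 /mp2 /mp1 /mk /mf /me.
move: (sqn w) => x; move: (p x) (b x) (c x) (lam x) (n%:R : R) => P B D l N.
move=> W P0 [[x0 ->]|[B0 D0]].
  by field; rewrite x0 P0 W.
rewrite B0 D0 !add0r in W *.
by field; rewrite P0 W.
Qed.

Lemma model_L2 w : V w -> - L2 (n := n) p mp1 mp2 mp3 (sqn w) = mr1 (sqn w).
Proof.
move=> Vw; have := model_cases Vw; have := p0 Vw; have := w0 Vw.
have E : p (sqn w) + sqn w * mp1 (sqn w) = p (sqn w) * (1 + sqn w * p (sqn w) * me (sqn w)).
  by rewrite /mp1; ring.
rewrite /L2 E /mr1 /mp3 /mp2 /mp1 /mk1 /mk /mf /mh /me.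
move: (sqn w) => x; move: (p x) (b x) (c x) (lam x) (n%:R : R) => P B D l N.
move=> W P0 [[x0 ->]|[B0 D0]].
  by field; rewrite x0 P0 W.
rewrite B0 D0 !add0r in W *.
by field; rewrite P0 W.
Qed.

Lemma model_Ric w i j : V w -> Ric g i j w = form2 mr0 mr1 i j w.
Proof.
move=> Vw; rewrite (Ric_radial Vo gE dp dp1 dp2 p0 q0 gpos i j Vw) /form2 /rad.
by rewrite model_L1 // model_L2.
Qed.

(** This family moves the real coefficient functions to [C], where the tensor identities live, one
    layer of definitions at a time. Generalising the real atoms keeps the morphism rules from
    descending into them. *)
Lemma rad_me z : rad me z = rad b z + rad c z - K%:C.
Proof.
rewrite /rad /me; move: (b (sqn z)) (c (sqn z)) => a0 a1.
by rewrite !(rmorphD, rmorphB, rmorphN, rmorphM, rmorphXn, rmorph_nat, rmorph1).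
Qed.

Lemma rad_mf z : rad mf z = n%:R * rad b z + (n%:R + 1) * rad c z.
Proof.
rewrite /rad /mf; move: (b (sqn z)) (c (sqn z)) => a0 a1.
by rewrite !(rmorphD, rmorphB, rmorphN, rmorphM, rmorphXn, rmorph_nat, rmorph1).
Qed.

Lemma rad_mh z : rad mh z = n%:R ^+ 2 * rad b z + (n%:R + 1) ^+ 2 * rad c z.
Proof.
rewrite /rad /mh; move: (b (sqn z)) (c (sqn z)) => a0 a1.
by rewrite !(rmorphD, rmorphB, rmorphN, rmorphM, rmorphXn, rmorph_nat, rmorph1).
Qed.

Lemma rad_mk z : rad mk z = rad lam z + rad p z * rad me z.
Proof.
rewrite /rad /mk; move: (lam (sqn z)) (p (sqn z)) (me (sqn z)) => a0 a1 a2.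
by rewrite !(rmorphD, rmorphB, rmorphN, rmorphM, rmorphXn, rmorph_nat, rmorph1).
Qed.

Lemma rad_mp1 z : rad mp1 z = rad p z ^+ 2 * rad me z.
Proof.
rewrite /rad /mp1; move: (p (sqn z)) (me (sqn z)) => a0 a1.
by rewrite !(rmorphD, rmorphB, rmorphN, rmorphM, rmorphXn, rmorph_nat, rmorph1).
Qed.

Lemma rad_mp2 z : rad mp2 z = 2 * rad p z ^+ 3 * rad me z ^+ 2
  - rad p z ^+ 2 * (rad mf z * rad mk z).
Proof.
rewrite /rad /mp2; move: (p (sqn z)) (me (sqn z)) (mf (sqn z)) (mk (sqn z)) => a0 a1 a2 a3.
by rewrite !(rmorphD, rmorphB, rmorphN, rmorphM, rmorphXn, rmorph_nat, rmorph1).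
Qed.

Lemma rad_mk1 z : rad mk1 z = - rad lam z ^+ 2 + rad p z ^+ 2 * rad me z ^+ 2
  - rad p z * (rad mf z * rad mk z).
Proof.
rewrite /rad /mk1.
move: (lam (sqn z)) (p (sqn z)) (me (sqn z)) (mf (sqn z)) (mk (sqn z)) => a0 a1 a2 a3 a4.
by rewrite !(rmorphD, rmorphB, rmorphN, rmorphM, rmorphXn, rmorph_nat, rmorph1).
Qed.

Lemma rad_mp3 z : rad mp3 z = 6 * rad p z ^+ 4 * rad me z ^+ 3
  - 6 * rad p z ^+ 3 * rad me z * (rad mf z * rad mk z)
  + rad p z ^+ 2 * rad mh z * rad mk z ^+ 2 - rad p z ^+ 2 * rad mf z * rad mk1 z.
Proof.
rewrite /rad /mp3; move: (p (sqn z)) (me (sqn z)) (mf (sqn z)) => a0 a1 a2.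
move: (mh (sqn z)) (mk (sqn z)) (mk1 (sqn z)) => a3 a4 a5.
by rewrite !(rmorphD, rmorphB, rmorphN, rmorphM, rmorphXn, rmorph_nat, rmorph1).
Qed.

Lemma rad_mmu z : rad mmu z = n%:R * rad b z * rad p z * rad mk z.
Proof.
rewrite /rad /mmu; move: (b (sqn z)) (p (sqn z)) (mk (sqn z)) => a0 a1 a2.
by rewrite !(rmorphD, rmorphB, rmorphN, rmorphM, rmorphXn, rmorph_nat, rmorph1).
Qed.

Lemma rad_mnu z : rad mnu z = rad mmu z * (2 * rad p z * rad me z - (n%:R + 1) * rad mk z).
Proof.
rewrite /rad /mnu; move: (mmu (sqn z)) (p (sqn z)) (me (sqn z)) (mk (sqn z)) => a0 a1 a2 a3.
by rewrite !(rmorphD, rmorphB, rmorphN, rmorphM, rmorphXn, rmorph_nat, rmorph1).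
Qed.

Lemma rad_mmu1 z : rad mmu1 z = n%:R * (- (n%:R * rad b z * rad mk z) * rad p z * rad mk z
  + rad b z * rad mp1 z * rad mk z + rad b z * rad p z * rad mk1 z).
Proof.
rewrite /rad /mmu1.
move: (b (sqn z)) (mk (sqn z)) (p (sqn z)) (mp1 (sqn z)) (mk1 (sqn z)) => a0 a1 a2 a3 a4.
by rewrite !(rmorphD, rmorphB, rmorphN, rmorphM, rmorphXn, rmorph_nat, rmorph1).
Qed.

Lemma rad_mr0 z : rad mr0 z = ((n%:R + 1) * K%:C - rad b z) * rad p z.
Proof.
rewrite /rad /mr0; move: (b (sqn z)) (p (sqn z)) => a0 a1.
by rewrite !(rmorphD, rmorphB, rmorphN, rmorphM, rmorphXn, rmorph_nat, rmorph1).
Qed.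

Lemma rad_mr1 z : rad mr1 z = ((n%:R + 1) * K%:C - rad b z) * rad mp1 z
  + n%:R * rad b z * rad p z * rad mk z.
Proof.
rewrite /rad /mr1; move: (b (sqn z)) (mp1 (sqn z)) (p (sqn z)) (mk (sqn z)) => a0 a1 a2 a3.
by rewrite !(rmorphD, rmorphB, rmorphN, rmorphM, rmorphXn, rmorph_nat, rmorph1).
Qed.

Lemma rad_mr2 z : rad mr2 z = n%:R * rad b z * rad mk z * rad mp1 z
  + ((n%:R + 1) * K%:C - rad b z) * rad mp2 z + rad mmu1 z.
Proof.
rewrite /rad /mr2.
move: (b (sqn z)) (mk (sqn z)) (mp1 (sqn z)) (mp2 (sqn z)) (mmu1 (sqn z)) => a0 a1 a2 a3 a4.
by rewrite !(rmorphD, rmorphB, rmorphN, rmorphM, rmorphXn, rmorph_nat, rmorph1).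
Qed.

Lemma rad_mnu1 z : rad mnu1 z = rad mmu1 z * (2 * rad p z * rad me z - (n%:R + 1) * rad mk z)
  + rad mmu z * (2 * (rad mp1 z * rad me z - rad p z * (rad mf z * rad mk z))
    - (n%:R + 1) * rad mk1 z).
Proof.
rewrite /rad /mnu1.
move: (mmu1 (sqn z)) (mmu (sqn z)) (p (sqn z)) (me (sqn z)) => a0 a1 a2 a3.
move: (mk (sqn z)) (mp1 (sqn z)) (mf (sqn z)) (mk1 (sqn z)) => a4 a5 a6 a7.
by rewrite !(rmorphD, rmorphB, rmorphN, rmorphM, rmorphXn, rmorph_nat, rmorph1).
Qed.

Lemma rad_cases w : V w ->
  ((sqn w)%:C != 0 :> C /\ rad lam w = (sqn w)%:C^-1) \/ (rad b w = 0 /\ rad c w = 0).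
Proof.
move=> Vw; case: (model_cases Vw) => [[x0 lx]|[b0 c0]]; [left|right].
  split; first by apply: contra x0 => /eqP[->].
  by rewrite /rad lx fmorphV.
by rewrite /rad b0 c0.
Qed.

Lemma rad_w0 w : V w -> 1 + (sqn w)%:C * rad p w * rad me w != 0.
Proof.
move=> Vw; rewrite /rad -!rmorphM -(rmorph1 (real_complex R)) -rmorphD.
by apply: contra (w0 Vw) => /eqP[->].
Qed.

Lemma model_zq w : zq p mp1 w = rad p w * (1 + (sqn w)%:C * rad p w * rad me w).
Proof. by rewrite /zq rad_mp1; ring. Qed.

Lemma rad_p0 w : V w -> rad p w != 0.
Proof. by move=> Vw; apply: contra (p0 Vw) => /eqP[->]. Qed.

(** Unfolds all coefficients down to x, [p], [b], [c], [lam], [n], [K] and runs [field] in the two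
    cases of [rad_cases]: [lam] is the inverse of x, or [b] and [c] vanish. *)
Local Ltac model_field z Vz :=
  have := rad_cases Vz; have := rad_p0 Vz; have := rad_w0 Vz;
  rewrite ?model_zq ?(rad_mnu1, rad_mnu, rad_mr2, rad_mr1, rad_mr0, rad_mmu1, rad_mmu)
    ?rad_mp3 ?rad_mk1 ?rad_mp2 ?rad_mp1 ?rad_mk ?rad_mh ?rad_mf ?rad_me;
  move: ((sqn z)%:C) (rad p z) (rad b z) (rad c z) (rad lam z) (n%:R : C) (K%:C);
  let x := fresh "x" in let P := fresh "P" in let B := fresh "B" in
  let D := fresh "D" in let l := fresh "l" in let N := fresh "N" in
  let k := fresh "k" in let W := fresh "W" in let P0 := fresh "P0" in
  let x0 := fresh "x0" in let L := fresh "L" in let B0 := fresh "B0" in let D0 := fresh "D0" in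
  move=> x P B D l N k W P0 [[x0 L]|[B0 D0]];
  [rewrite ?L; by field; rewrite ?x0 ?P0 ?W | rewrite ?B0 ?D0 ?add0r in W *; by field; rewrite ?P0 ?W].

Section AtPoint.
Variables (z : Cn) (Vz : V z).

Lemma model_Riem_e : Riem_e p mp1 z = rad me z.
Proof.
have P0 := rad_p0 Vz.
by rewrite /Riem_e rad_mp1 mulrAC mulfV ?mul1r // expf_neq0.
Qed.

Lemma model_Riem_b : rad me z + Riem_b p mp1 mp2 z * usq p mp1 z = rad me z - rad mf z.
Proof. rewrite /Riem_b /usq; model_field z Vz. Qed.

Lemma model_Riem_c : rad me z + Riem_b p mp1 mp2 z * usq p mp1 z
  + Riem_b p mp1 mp2 z * usq p mp1 z + Riem_c p mp1 mp2 mp3 z / 2 * usq p mp1 z ^+ 2 =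
  rad me z - 3 / 2 * rad mf z + rad mh z / 2.
Proof. rewrite /Riem_b /Riem_c /chc /usq; model_field z Vz. Qed.

Lemma model_mu : rad mmu z = rad mr1 z - chm p mp1 z * rad mr0 z.
Proof. rewrite /chm; model_field z Vz. Qed.

Lemma model_nu : rad mnu z = rad mr2 z - 2 * chm p mp1 z * rad mr1 z
    - chc p mp1 mp2 z * (rad mr0 z + (sqn z)%:C * rad mr1 z).
Proof. rewrite /chm /chc; model_field z Vz. Qed.

(** [A1] to [A4] are the solution of the four equations of [DDRic_radial]; [model_A1] to [model_A4]
    verify them. *)
Definition A1 : C := n%:R * rad b z * rad mk z / rad p z.
Definition A2 : C := n%:R * rad b z *
  (rad me z - rad mf z - (n%:R + 1) * rad mk z / rad p z) * (rad p z * rad mk z).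
Definition A3 : C := - (n%:R + 1) * A1 * (rad p z * rad mk z).
Definition A4 : C := - n%:R * (n%:R + 1) * rad b z *
  (rad me z - rad mf z - (n%:R + 2) * rad mk z / rad p z) * (rad p z * rad mk z) ^+ 2.

Lemma model_A1 : rad mmu z = A1 * rad p z ^+ 2.
Proof. rewrite /A1; model_field z Vz. Qed.

Lemma model_A2 : rad mmu1 z - chm p mp1 z * rad mmu z =
  A2 * rad p z + A1 * rad p z * rad mp1 z.
Proof. rewrite /A1 /A2 /chm; model_field z Vz. Qed.

Lemma model_A3 : rad mnu z - chm p mp1 z * rad mmu z =
  A3 * rad p z + A1 * rad p z * rad mp1 z.
Proof. rewrite /A3 /A1 /chm; model_field z Vz. Qed.

Lemma model_A4 : rad mnu1 z - 2 * chm p mp1 z * rad mnu z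
    - chc p mp1 mp2 z * (2 * rad mmu z + (sqn z)%:C * rad mnu z) =
    A4 + 2 * A1 * rad mp1 z ^+ 2 + 2 * (A2 + A3) * rad mp1 z.
Proof. rewrite /A4 /A3 /A2 /A1 /chm /chc; model_field z Vz. Qed.

(** Suffixes: [_t] tangential, of multiplicity n - 1 for Ricci, [_r] radial, [_m] mixed. [Rm_t],
    [Rm_m], [Rm_r] are the three parameters of [curv], so [Rm_r] is half the radial component. *)
Definition Ric_t : C := (n%:R + 1) * K%:C - rad b z.
Definition Ric_r : C := (n%:R + 1) * K%:C + (n%:R - 1) * rad b z.
Definition Rm_t : C := rad me z.
Definition Rm_m : C := rad me z - rad mf z.
Definition Rm_r : C := rad me z - 3 / 2 * rad mf z + rad mh z / 2.
Definition sig : C := rad mk z / rad p z.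

Lemma model_Ric_t : rad mr0 z / rad p z = Ric_t.
Proof. rewrite /Ric_t; model_field z Vz. Qed.

Lemma model_Ric_r : rad mr0 z / rad p z
  + (rad mr1 z - rad mr0 z / rad p z * rad mp1 z) * usq p mp1 z = Ric_r.
Proof. rewrite /Ric_r /usq; model_field z Vz. Qed.

Lemma model_tr_Ric : rad mr0 z / rad p z * n%:R
  + (rad mr1 z - rad mr0 z * rad mp1 z / rad p z) * (sqn z)%:C / zq p mp1 z =
  n%:R * (n%:R + 1) * K%:C.
Proof. model_field z Vz. Qed.

Lemma model_A2s : A1 + A2 * usq p mp1 z =
  n%:R * rad b z * (rad me z - rad mf z - n%:R * sig).
Proof. rewrite /sig /A1 /A2 /usq; model_field z Vz. Qed.

Lemma model_A3s : A1 + A3 * usq p mp1 z = - n%:R * A1.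
Proof. rewrite /A3 /A1 /usq; model_field z Vz. Qed.

Lemma model_A4s : A1 + A2 * usq p mp1 z + A3 * usq p mp1 z + A4 / 2 * usq p mp1 z ^+ 2 =
  n%:R * rad b z / 2 * ((1 - n%:R) * (rad me z - rad mf z) + n%:R * (n%:R - 1) * sig).
Proof. rewrite /sig /A4 /A3 /A2 /A1 /usq; model_field z Vz. Qed.

Lemma model_be : n%:R * rad b z * rad mk z
    + (rad mnu z - 2 * (n%:R * rad b z * rad mk z) * rad mp1 z) / 2 * usq p mp1 z =
  (1 - n%:R) / 2 * (n%:R * rad b z * rad mk z).
Proof. rewrite /usq; model_field z Vz. Qed.

(** Off the origin [mk * usq] equals [1 / p], and elsewhere [b] vanishes; so one factor [mk] is
    absorbed by the length of the radial covector. *)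
Lemma model_DRic_sq : 2 * usq p mp1 z * ((n%:R - 1) * (n%:R * rad b z * rad mk z) ^+ 2
    + 2 * ((1 - n%:R) / 2 * (n%:R * rad b z * rad mk z)) ^+ 2) =
  n%:R ^+ 2 * (n%:R ^+ 2 - 1) * rad b z ^+ 2 * sig.
Proof.
have H : rad b z * rad mk z * usq p mp1 z = rad b z / rad p z.
  by rewrite /usq; model_field z Vz.
transitivity (n%:R ^+ 2 * (n%:R ^+ 2 - 1) * rad b z * rad mk z *
    (rad b z * rad mk z * usq p mp1 z)).
  by move: (usq p mp1 z) (rad b z) (rad mk z) (n%:R : C) => s B k N; field.
rewrite H /sig; move: (rad p z)^-1 (rad b z) (rad mk z) (n%:R : C) => P B k N; ring.
Qed.

End AtPoint.

Lemma model_scal z : V z -> scal g z = n%:R * (n%:R + 1) * K%:C.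
Proof.
move=> Vz; rewrite -(model_tr_Ric Vz) /scal.
under eq_bigr do under eq_bigr do rewrite model_Ric //.
exact: (tr_ginv_form2 gE p0 q0 gpos).
Qed.

Lemma model_DRic z i j k : V z -> DRic g i j k z = (form3 mmu mnu j k i z)^*.
Proof.
move=> Vz; exact: (DRic_radial Vo gE dp dp1 p0 q0 gpos i j k
  (fun w Vw i j => model_Ric i j Vw) (dr0 Vz) (dr1 Vz) (model_mu Vz) (model_nu Vz) Vz).
Qed.

(** One and the same projector serves Ricci, curvature and second derivative of Ricci, which is what
    allows contractions mixing them. *)
Lemma model_frame z : V z -> exists Q : 'M[C]_n,
  [/\ Q *m Q = Q /\ \tr Q = 1,
      Q^t* = Q /\ uproj g z = usq p mp1 z *: Q,
      forall i j k l, uR g z i j k l = curv Q (Rm_t z) (Rm_m z) (Rm_r z) i j k l,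
      forall i j, uRic g z i j = qm Q (Ric_t z) (Ric_r z) i j &
      forall i j k l, uDDRic g z i j k l =
        tens (qm Q 1 0) (qm Q (A1 z) (n%:R * rad b z * (rad me z - rad mf z - n%:R * sig z))) i j k l
        + tens (qm Q 0 1) (qm Q (- n%:R * A1 z) (n%:R * rad b z / 2 *
           ((1 - n%:R) * (rad me z - rad mf z) + n%:R * (n%:R - 1) * sig z))) i j k l].
Proof.
move=> Vz; have [Q [QQ trQ QJ NQ]] := exists_uproj gE q0 gpos n0 Vz.
exists Q; split => //.
- move=> i j k l; rewrite /uR (frame4_mix gpos Vz NQ _ _ _ _
    (fun a b c d => Riem_radial Vo gE dp dp1 dp2 p0 q0 gpos a b c d Vz)).
  by rewrite /curv (model_Riem_e Vz) (model_Riem_c Vz) (model_Riem_b Vz).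
- move=> i j; rewrite /uRic (frame2_mix gE p0 gpos Vz NQ _ _
    (fun a b => model_Ric a b Vz)).
  by rewrite (model_Ric_r Vz) (model_Ric_t Vz).
- move=> i j k l; rewrite /uDDRic (frame4_mix gpos Vz NQ _ _ _ _
    (fun a b c d => DDRic_radial Vo gE dp dp1 p0 q0 gpos a b c d
      (fun w Vw i j k => model_DRic i j k Vw) (dmu Vz) (dnu Vz) Vz
      (model_A1 Vz) (model_A2 Vz) (model_A3 Vz) (model_A4 Vz))).
  by rewrite (model_A4s Vz) (model_A3s Vz) (model_A2s Vz).
Qed.

(** Up to the factor [mn3] and a constant, [mQ] is |R|^2 - 4 |Ric|^2. With weight n for [b] and n +
    1 for [c], [mQ1] and [mQ2] multiply each monomial by its weight once and twice, as
    differentiation does up to the sign and [mk]. *)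
Definition mQ x : R := (n%:R - 2) * b x ^+ 2 + 2 * n%:R * b x * c x + (n%:R + 2) * c x ^+ 2.
Definition mQ1 x : R := 2 * n%:R * (n%:R - 2) * b x ^+ 2
  + 2 * n%:R * (2 * n%:R + 1) * b x * c x + (n%:R + 2) * (2 * n%:R + 2) * c x ^+ 2.
Definition mQ2 x : R := 4 * n%:R ^+ 2 * (n%:R - 2) * b x ^+ 2
  + 2 * n%:R * (2 * n%:R + 1) ^+ 2 * b x * c x + (n%:R + 2) * (2 * n%:R + 2) ^+ 2 * c x ^+ 2.
Definition mn3 : R := n%:R * (n%:R - 1) * (n%:R + 1).
Definition mF x : R := mn3 * mQ x +
  (2 * n%:R * (n%:R + 1) - 4 * n%:R * (n%:R + 1) ^+ 2 + 8 * n%:R ^+ 2 * (n%:R + 1) ^+ 2) * K ^+ 2.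
Definition mF1 x : R := - (mn3 * (mQ1 x * mk x)).
Definition mF2 x : R := mn3 * (mQ2 x * mk x ^+ 2 - mQ1 x * mk1 x).

Lemma dF w : V w -> is_derive (sqn w) 1 mF (mF1 (sqn w)).
Proof.
move=> Vw; have cst (a : R) := is_derive1_cst (sqn w) a.
apply: (eq_is_derive1 (is_derive1D (is_derive1M (cst mn3) (is_derive1D (is_derive1D
  (is_derive1M (cst (n%:R - 2)) (is_derive1X 2 (db Vw)))
  (is_derive1M (is_derive1M (cst (2 * n%:R)) (db Vw)) (dc Vw)))
  (is_derive1M (cst (n%:R + 2)) (is_derive1X 2 (dc Vw)))))
  (cst _))) => //.
by rewrite /mF1 /mQ1 /=; ring.
Qed.

Lemma dF1 w : V w -> is_derive (sqn w) 1 mF1 (mF2 (sqn w)).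
Proof.
move=> Vw; have cst (a : R) := is_derive1_cst (sqn w) a.
apply: (eq_is_derive1 (is_derive1N (is_derive1M (cst mn3) (is_derive1M
  (is_derive1D (is_derive1D
  (is_derive1M (cst (2 * n%:R * (n%:R - 2))) (is_derive1X 2 (db Vw)))
  (is_derive1M (is_derive1M (cst (2 * n%:R * (2 * n%:R + 1))) (db Vw)) (dc Vw)))
  (is_derive1M (cst ((n%:R + 2) * (2 * n%:R + 2))) (is_derive1X 2 (dc Vw)))) (dk Vw))))) => //.
by rewrite /mF2 /mQ1 /mQ2 /=; ring.
Qed.

Lemma rad_mQ z : rad mQ z = (n%:R - 2) * rad b z ^+ 2 + 2 * n%:R * rad b z * rad c z
  + (n%:R + 2) * rad c z ^+ 2.
Proof.
rewrite /rad /mQ; move: (b (sqn z)) (c (sqn z)) => a0 a1.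
by rewrite !(rmorphD, rmorphB, rmorphN, rmorphM, rmorphXn, rmorph_nat, rmorph1).
Qed.

Lemma rad_mQ1 z : rad mQ1 z = 2 * n%:R * (n%:R - 2) * rad b z ^+ 2
  + 2 * n%:R * (2 * n%:R + 1) * rad b z * rad c z
  + (n%:R + 2) * (2 * n%:R + 2) * rad c z ^+ 2.
Proof.
rewrite /rad /mQ1; move: (b (sqn z)) (c (sqn z)) => a0 a1.
by rewrite !(rmorphD, rmorphB, rmorphN, rmorphM, rmorphXn, rmorph_nat, rmorph1).
Qed.

Lemma rad_mQ2 z : rad mQ2 z = 4 * n%:R ^+ 2 * (n%:R - 2) * rad b z ^+ 2
  + 2 * n%:R * (2 * n%:R + 1) ^+ 2 * rad b z * rad c z
  + (n%:R + 2) * (2 * n%:R + 2) ^+ 2 * rad c z ^+ 2.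
Proof.
rewrite /rad /mQ2; move: (b (sqn z)) (c (sqn z)) => a0 a1.
by rewrite !(rmorphD, rmorphB, rmorphN, rmorphM, rmorphXn, rmorph_nat, rmorph1).
Qed.

Lemma mn3C : mn3%:C = n%:R * (n%:R - 1) * (n%:R + 1) :> C.
Proof. by rewrite /mn3 !(rmorphD, rmorphN, rmorphM, rmorph_nat, rmorph1). Qed.

Lemma rad_mF z : rad mF z = n%:R * (n%:R - 1) * (n%:R + 1) * rad mQ z +
  (2 * n%:R * (n%:R + 1) - 4 * n%:R * (n%:R + 1) ^+ 2 + 8 * n%:R ^+ 2 * (n%:R + 1) ^+ 2)
   * K%:C ^+ 2.
Proof.
rewrite -mn3C /rad /mF; move: mn3 (mQ (sqn z)) => a0 a1.
by rewrite !(rmorphD, rmorphB, rmorphN, rmorphM, rmorphXn, rmorph_nat, rmorph1).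
Qed.

Lemma rad_mF1 z : rad mF1 z = - (n%:R * (n%:R - 1) * (n%:R + 1) * (rad mQ1 z * rad mk z)).
Proof.
rewrite -mn3C /rad /mF1; move: mn3 (mQ1 (sqn z)) (mk (sqn z)) => a0 a1 a2.
by rewrite !(rmorphN, rmorphM).
Qed.

Lemma rad_mF2 z : rad mF2 z = n%:R * (n%:R - 1) * (n%:R + 1) *
  (rad mQ2 z * rad mk z ^+ 2 - rad mQ1 z * rad mk1 z).
Proof.
rewrite -mn3C /rad /mF2; move: mn3 (mQ1 (sqn z)) (mQ2 (sqn z)) (mk (sqn z)) (mk1 (sqn z)).
by move=> a0 a1 a2 a3 a4; rewrite !(rmorphD, rmorphN, rmorphM, rmorphXn).
Qed.

Lemma real_Rm_t z : (Rm_t z)^* = Rm_t z. Proof. exact: rad_conj. Qed.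

Lemma real_Rm_m z : (Rm_m z)^* = Rm_m z.
Proof. by rewrite /Rm_m rmorphB /= !rad_conj. Qed.

Lemma real_Rm_r z : (Rm_r z)^* = Rm_r z.
Proof.
have -> : Rm_r z = rad (fun x => me x - 3 / 2 * mf x + mh x / 2) z.
  rewrite /Rm_r /rad; move: (me (sqn z)) (mf (sqn z)) (mh (sqn z)) => a0 a1 a2.
  by rewrite !(rmorphD, rmorphN, rmorphM, fmorphV, rmorph_nat).
exact: rad_conj.
Qed.

Lemma real_Ric_t z : (Ric_t z)^* = Ric_t z.
Proof.
have -> : Ric_t z = rad (fun x => (n%:R + 1) * K - b x) z.
  rewrite /Ric_t /rad; move: (b (sqn z)) => a0.
  by rewrite !(rmorphD, rmorphN, rmorphM, rmorph_nat, rmorph1).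
exact: rad_conj.
Qed.

Lemma real_Ric_r z : (Ric_r z)^* = Ric_r z.
Proof.
have -> : Ric_r z = rad (fun x => (n%:R + 1) * K + (n%:R - 1) * b x) z.
  rewrite /Ric_r /rad; move: (b (sqn z)) => a0.
  by rewrite !(rmorphD, rmorphN, rmorphM, rmorph_nat, rmorph1).
exact: rad_conj.
Qed.

Definition nR z : C := (n%:R - 1) * (2 * Rm_m z ^+ 2 + 2 * n%:R * Rm_t z ^+ 2)
    + (4 * Rm_r z ^+ 2 + 2 * (n%:R - 1) * Rm_m z ^+ 2).
Definition nRic z : C := (n%:R - 1) * Ric_t z ^+ 2 + Ric_r z ^+ 2.

Lemma model_normsqR z : V z -> normsqR g z = nR z.
Proof.
move=> Vz; have [Q [[QQ trQ] [QJ NQ] uRE _ _]] := model_frame Vz.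
exact: (normsqR_frame QJ (real_Rm_t z) (real_Rm_m z) (real_Rm_r z) QQ trQ uRE).
Qed.

Lemma model_normsqRic z : V z -> normsqRic g z = nRic z.
Proof.
move=> Vz; have [Q [[QQ trQ] [QJ NQ] _ uE _]] := model_frame Vz.
exact: (normsqRic_frame QJ (real_Ric_t z) (real_Ric_r z) QQ trQ uE).
Qed.

Lemma model_mF z : V z ->
  normsqR g z - 4 * normsqRic g z + 8 * scal g z ^+ 2 = rad mF z.
Proof.
move=> Vz; rewrite model_normsqR // model_normsqRic // model_scal // rad_mF rad_mQ.
rewrite /nR /nRic /Rm_m /Rm_r /Rm_t /Ric_t /Ric_r rad_mh rad_mf rad_me.
by move: (rad b z) (rad c z) (n%:R : C) (K%:C) => B D N k; field.
Qed.

Definition LapFv z : C := rad mF1 z / rad p z * n%:R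
  + (rad mF2 z - rad mF1 z * rad mp1 z / rad p z) * (sqn z)%:C / zq p mp1 z.

Lemma model_LapF z : V z ->
  Lap g (fun z => normsqR g z - 4 * normsqRic g z + 8 * scal g z ^+ 2) z = LapFv z.
Proof.
move=> Vz; exact: (Lap_radial Vo gE p0 q0 gpos Vz (fun w Vw => model_mF Vw) dF dF1).
Qed.

Lemma LapFE z : V z -> LapFv z = n%:R * (n%:R - 1) * (n%:R + 1) *
  (2 * n%:R * (n%:R - 2) * rad b z ^+ 2 *
     ((n%:R + 1) * (rad lam z / rad p z) - n%:R * K%:C + 2 * n%:R * rad b z + (2 * n%:R + 1) * rad c z)
   + 2 * n%:R * (2 * n%:R + 1) * rad b z * rad c z *
     ((n%:R + 2) * (rad lam z / rad p z) - (n%:R + 1) * K%:C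
       + (2 * n%:R + 1) * rad b z + (2 * n%:R + 2) * rad c z)
   + (n%:R + 2) * (2 * n%:R + 2) * rad c z ^+ 2 *
     ((n%:R + 3) * (rad lam z / rad p z) - (n%:R + 2) * K%:C
       + (2 * n%:R + 2) * rad b z + (2 * n%:R + 3) * rad c z)).
Proof.
move=> Vz; rewrite /LapFv rad_mF1 rad_mF2 rad_mQ1 rad_mQ2; model_field z Vz.
Qed.

Lemma near_scal z : V z -> \forall w \near z, scal g w = n%:R * (n%:R + 1) * K%:C.
Proof.
move=> Vz; near=> w; apply: model_scal.
by near: w; exact: near_in.
Unshelve. all: by end_near. Qed.

Lemma dzb_near_cst k f z a : (\forall w \near z, f w = a) -> dzb k f z = 0.
Proof.
move=> fa; apply: (dzb_val (c := 0)); apply: is_wirt_near (is_wirt_cst k z a).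
by near=> w; apply/esym; near: w.
Unshelve. all: by end_near. Qed.

Lemma dz_near_cst k f z a : (\forall w \near z, f w = a) -> dz k f z = 0.
Proof.
move=> fa; apply: (dz_val (d := 0)); apply: is_wirt_near (is_wirt_cst k z a).
by near=> w; apply/esym; near: w.
Unshelve. all: by end_near. Qed.

Lemma dz_dzb_scal i j z : V z -> dz i (dzb j (scal g)) z = 0.
Proof.
move=> Vz; apply: (@dz_near_cst _ _ _ 0); near=> w.
apply: (@dzb_near_cst _ _ _ (n%:R * (n%:R + 1) * K%:C)); apply: near_scal.
by near: w; exact: near_in.
Unshelve. all: by end_near. Qed.

Lemma Lap_scal z : V z -> Lap g (scal g) z = 0.
Proof.
move=> Vz; apply: big1 => i _; apply: big1 => j _.
by rewrite dz_dzb_scal // mulr0.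
Qed.

Lemma Lap_Lap_scal z : V z -> Lap g (Lap g (scal g)) z = 0.
Proof.
move=> Vz; apply: big1 => i _; apply: big1 => j _.
rewrite (@dz_near_cst _ _ _ 0) ?mulr0 //; near=> w.
apply: (@dzb_near_cst _ _ _ 0); near=> v; apply: Lap_scal.
near: v; apply: near_in => //.
by near: w; exact: near_in.
Unshelve. all: by end_near. Qed.

Lemma Ric_DDscal0 z : V z -> Ric_DDscal g z = 0.
Proof.
move=> Vz; apply: big1 => i _; apply: big1 => j _.
rewrite /uDDscal /frame2 [X in _ * X]big1 ?mulr0 // => a _; apply: big1 => e _.
by rewrite dz_dzb_scal // mulr0.
Qed.

Lemma normsqDscal0 z : V z -> normsqDscal g z = 0.
Proof.
move=> Vz; apply: big1 => i _.
rewrite /uDscal /frame1 big1 ?normr0 ?expr0n // => a _.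
by rewrite (dz_near_cst a (near_scal Vz)) mulr0.
Qed.

Lemma model_sigma3 z : V z ->
  sigma3 g z = (n%:R - 1) * Ric_t z ^+ 3 + Ric_r z ^+ 3.
Proof.
move=> Vz; have [Q [[QQ trQ] _ _ uE _]] := model_frame Vz.
rewrite /sigma3; under eq_bigr do under eq_bigr do under eq_bigr do rewrite !uE.
by rewrite sum_mx3 !qmM // trqm //; ring.
Qed.

Lemma model_R_Ric_Ric z : V z -> R_Ric_Ric g z = 2 * Rm_r z * Ric_r z ^+ 2
  + 2 * (n%:R - 1) * Rm_m z * Ric_r z * Ric_t z
  + n%:R * (n%:R - 1) * Rm_t z * Ric_t z ^+ 2.
Proof.
move=> Vz; have [Q [[QQ trQ] _ uRE uE _]] := model_frame Vz.
transitivity (\sum_i \sum_j \sum_k \sum_l curv Q (Rm_t z) (Rm_m z) (Rm_r z) i j k l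
   * qm Q (Ric_t z) (Ric_r z) j i * qm Q (Ric_t z) (Ric_r z) l k).
  by do 4!(apply: eq_bigr => ? _); rewrite uRE !uE.
by rewrite contr_curv_qm // subrK.
Qed.

Lemma model_Ric_R_R z : V z -> Ric_R_R g z =
  (n%:R - 1) * Ric_t z * (2 * Rm_m z ^+ 2 + 2 * n%:R * Rm_t z ^+ 2) +
  Ric_r z * (4 * Rm_r z ^+ 2 + 2 * (n%:R - 1) * Rm_m z ^+ 2).
Proof.
move=> Vz; have [Q [[QQ trQ] _ uRE uE _]] := model_frame Vz.
transitivity (\sum_i \sum_j \sum_k \sum_p \sum_q qm Q (Ric_t z) (Ric_r z) i j *
   curv Q (Rm_t z) (Rm_m z) (Rm_r z) j k p q * curv Q (Rm_t z) (Rm_m z) (Rm_r z) k i q p).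
  by do 5!(apply: eq_bigr => ? _); rewrite !uRE uE.
by rewrite contr_curv5 // subrK.
Qed.

Lemma model_DDRic_R z : V z ->
  \sum_i \sum_j \sum_k \sum_l uDDRic g z i j k l * uR g z j i l k =
  4 * Rm_r z * (n%:R * rad b z / 2 *
     ((1 - n%:R) * (rad me z - rad mf z) + n%:R * (n%:R - 1) * sig z))
  + 2 * (n%:R - 1) * Rm_m z * (n%:R * rad b z * (rad me z - rad mf z - n%:R * sig z)
      + - n%:R * A1 z)
  + 2 * (n%:R - 1) * n%:R * Rm_t z * A1 z.
Proof.
move=> Vz; have [Q [[QQ trQ] _ uRE _ uDE]] := model_frame Vz.
transitivity (\sum_i \sum_j \sum_k \sum_l
    (tens (qm Q 1 0) (qm Q (A1 z) (n%:R * rad b z * (rad me z - rad mf z - n%:R * sig z))) i j k l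
        + tens (qm Q 0 1) (qm Q (- n%:R * A1 z) (n%:R * rad b z / 2 *
           ((1 - n%:R) * (rad me z - rad mf z) + n%:R * (n%:R - 1) * sig z))) i j k l)
    * curv Q (Rm_t z) (Rm_m z) (Rm_r z) j i l k).
  by do 4!(apply: eq_bigr => ? _); rewrite uDE uRE.
by rewrite contr_tens_curv // subrK.
Qed.

Lemma model_normsqDRic z : V z -> normsqDRic g z =
  n%:R ^+ 2 * (n%:R ^+ 2 - 1) * rad b z ^+ 2 * sig z.
Proof.
move=> Vz; have [Q [[QQ trQ] [QJ NQ] _ _ _]] := model_frame Vz.
pose al := n%:R * rad b z * rad mk z.
have alR : al^* = al by rewrite /al !rmorphM /= !rad_conj conjC_nat.
have muE : rad mmu z = al * rad p z by rewrite rad_mmu /al; ring.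
have beR : (al + (rad mnu z - 2 * al * rad mp1 z) / 2 * usq p mp1 z)^* =
    al + (rad mnu z - 2 * al * rad mp1 z) / 2 * usq p mp1 z.
  rewrite /al (model_be Vz) -/al rmorphM /= alR; congr (_ * _).
  by rewrite rmorphM rmorphB fmorphV /= conjC1 !conjC_nat.
rewrite (normsqDRic_frame gE gpos Vz QJ NQ (fun i j k => model_DRic i j k Vz) QQ trQ muE alR beR).
by rewrite /al (model_be Vz) (model_DRic_sq Vz).
Qed.

Lemma model_a2 z : V z ->
  TYZ_a2 g z = a2_formula n%:R K%:C (rad b z) (rad c z).
Proof.
move=> Vz; rewrite /TYZ_a2 Lap_scal // model_normsqR // model_normsqRic // model_scal //.
rewrite /a2_formula /nR /nRic /Rm_m /Rm_r /Rm_t /Ric_t /Ric_r rad_mh rad_mf rad_me.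
by move: (rad b z) (rad c z) (n%:R : C) (K%:C) => B D N k; field.
Qed.

Lemma model_a3 z : V z ->
  TYZ_a3 g z = a3_formula n%:R K%:C (rad b z) (rad c z) (rad lam z / rad p z).
Proof.
move=> Vz; rewrite /TYZ_a3 /divdiv_R_Ric /divdiv_scal_Ric Lap_Lap_scal // Lap_scal //.
rewrite Ric_DDscal0 // normsqDscal0 // model_LapF // LapFE // model_normsqDRic //.
rewrite model_DDRic_R // model_R_Ric_Ric // model_Ric_R_R // model_sigma3 //.
rewrite model_normsqR // model_normsqRic // model_scal //.
(* Here 1 / y, in the form [lam / p], enters a_3 alongside [b], [c] and [K]. *)
have sigE : sig z = rad lam z / rad p z + rad me z.
  by rewrite /sig rad_mk mulrDl mulrAC mulfV ?mul1r // rad_p0.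
have A1E : A1 z = n%:R * rad b z * sig z by rewrite /A1 /sig mulrA.
rewrite A1E sigE /a3_formula /nR /nRic /Rm_m /Rm_r /Rm_t /Ric_t /Ric_r.
rewrite rad_mh rad_mf rad_me.
exact: (a3_assembly n%:R K%:C (rad b z) (rad c z) (rad lam z / rad p z)).
Qed.

End LocalModel.

(** * The scalar curvature equation *)

Section ScalarCurvatureODE.
Context {R : realType}.
Implicit Types (f : R -> R) (J : set R) (x : R).

Lemma is_derive1_continuous f x a : is_derive x 1 f a -> {for x, continuous f}.
Proof.
by case=> fx _; apply: differentiable_continuous; exact/derivable1_diffP.
Qed.

Lemma mvt_interval f (df : R -> R) J : is_interval J ->
  (forall x, J x -> is_derive x 1 f (df x)) ->
  forall a b, J a -> J b -> exists2 c, J c & f b - f a = df c * (b - a).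
Proof.
move=> Ji fd a b Ja Jb.
wlog ab : a b Ja Jb / a <= b => [hw|].
  have /orP[ab|ba] := le_total a b; first exact: hw.
  have [c Jc e] := hw b a Jb Ja ba; exists c => //.
  by rewrite -[LHS]opprB e -mulrN opprB.
have Jab x : x \in `[a, b] -> J x.
  by rewrite in_itv /= => /andP[ax xb]; apply: (Ji a b) => //; rewrite ax xb.
have [||c cab e] := @MVT_segment _ f df a b ab.
- move=> x; rewrite in_itv /= => /andP[ax xb]; apply: fd; apply: Jab.
  by rewrite in_itv /= (ltW ax) (ltW xb).
- apply: derivable_within_continuous => x /Jab /fd[].
  by [].
- by exists c => //; exact: Jab.
Qed.

Lemma constant_interval f J : is_interval J ->
  (forall x, J x -> is_derive x 1 f 0) -> forall a b, J a -> J b -> f a = f b.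
Proof.
move=> Ji fd a b Ja Jb; have [c _ /eqP] := mvt_interval Ji fd Ja Jb.
by rewrite mul0r subr_eq0 => /eqP ->.
Qed.

(** With q = y' and L the logarithmic derivative of the determinant, the equation reads d(y^(n-1) x
    L)/dy = - n (n + 1) K y^(n-1), which gives the constant B. Putting w = x q, one has x L = (n -
    1) (w / y - 1) + dw/dy - 1, so what remains is d(y^(n-1) w)/dy = n y^(n-1) + B - (n + 1) K y^n,
    exact again. Since w = y + x^2 p', the result is the stated equation. *)
Lemma const_scal_ode (n : nat) (J : set R) (p p1 p2 p3 : R -> R) (K : R) :
  (0 < n)%N -> is_interval J ->
  (forall x, J x -> 0 < x) ->
  (forall x, J x -> is_derive x 1 p (p1 x)) ->
  (forall x, J x -> is_derive x 1 p1 (p2 x)) ->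
  (forall x, J x -> is_derive x 1 p2 (p3 x)) ->
  (forall x, J x -> p x != 0) ->
  (forall x, J x -> p x + x * p1 x != 0) ->
  (forall x, J x -> is_derive x 1 (L1 (n := n) p p1 p2) (L2 (n := n) p p1 p2 p3 x)) ->
  (forall x, J x -> - L1 (n := n) p p1 p2 x / p x * n%:R
     - (L2 (n := n) p p1 p2 p3 x - L1 (n := n) p p1 p2 x * p1 x / p x) * x / (p x + x * p1 x)
     = n%:R * (n%:R + 1) * K) ->
  exists B C : R, forall x, J x ->
    p1 x = p x ^+ 2 * (B / (x * p x) ^+ n + C / (x * p x) ^+ n.+1 - K).
Proof.
case: n => // m _ Ji J0 dp dp1 dp2 p0 q0 dL scalE.
case: (pselect (exists x, J x)) => [[x0 Jx0]|nJ]; last first.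
  by exists 0, 0 => x Jx; case: nJ; exists x.
pose y x := x * p x; pose q x := p x + x * p1 x.
have dy x : J x -> is_derive x 1 y (q x).
  move=> Jx; apply: (eq_is_derive1 (is_derive1M (is_derive1_id x) (dp _ Jx))) => //.
  by rewrite mul1r.
have dq x : J x -> is_derive x 1 q (2 * p1 x + x * p2 x).
  move=> Jx; apply: (eq_is_derive1 (is_derive1D (dp _ Jx)
    (is_derive1M (is_derive1_id x) (dp1 _ Jx)))) => //; ring.
have y0 x : J x -> y x != 0 by move=> Jx; rewrite mulf_neq0 ?p0 // gt_eqF ?J0.
(* Dividing by [y x] instead of lowering the exponent keeps a single power as an atom for
   [field]. *)
have dX k x : J x -> is_derive x 1 (fun t => y t ^+ k) (k%:R * y x ^+ k * q x / y x).
  move=> Jx; apply: (eq_is_derive1 (is_derive1X k (dy _ Jx))) => //.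
  case: k => [|k /=]; first by rewrite !mul0r.
  by rewrite exprS; field; exact: y0.
pose N : R := m.+1%:R; pose M : R := m%:R.
have NM : N = M + 1 by rewrite /N /M natr1.
pose L := L1 (n := m.+1) p p1 p2.
(* M1 and M2 are first integrals of the equation. *)
pose M1 x := y x ^+ m * (x * L x) + (N + 1) * K * y x ^+ m.+1.
have M1E x : J x -> M1 x = M1 x0.
  move=> Jx; apply: (constant_interval Ji _ Jx Jx0) => {x Jx} x Jx.
  have cst (a : R) := is_derive1_cst x a.
  apply: (eq_is_derive1 (is_derive1D
    (is_derive1M (dX m _ Jx) (is_derive1M (is_derive1_id x) (dL _ Jx)))
    (is_derive1M (cst ((N + 1) * K)) (dX m.+1 _ Jx)))) => //.
  have xn0 : x != 0 by rewrite gt_eqF ?J0.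
  have := scalE _ Jx; have := p0 _ Jx; have := q0 _ Jx.
  rewrite -/L -/N -/M exprS /y /q NM; move: ((x * p x) ^+ m) => Z.
  move: (L x) (L2 _ _ _ _ x) (p x) (p1 x) => l l2 P P1 Q0 P0 E.
  (* The scalar curvature equation solved for the derivative of L. *)
  have -> : l2 = (l * P1 / P) + (P + x * P1) / x * (- l / P * (M + 1) - (M + 1) * (M + 1 + 1) * K).
    by rewrite -E; field; rewrite P0 xn0 Q0.
  by field; rewrite P0 xn0.
exists (M1 x0).
pose M2 x := y x ^+ m * (x * q x) - y x ^+ m.+1 + K * y x ^+ m.+2 - M1 x0 * y x.
have M2E x : J x -> M2 x = M2 x0.
  move=> Jx; apply: (constant_interval Ji _ Jx Jx0) => {x Jx} x Jx.
  have cst (a : R) := is_derive1_cst x a.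
  apply: (eq_is_derive1 (is_derive1B (is_derive1D (is_derive1B
    (is_derive1M (dX m _ Jx) (is_derive1M (is_derive1_id x) (dq _ Jx)))
    (dX m.+1 _ Jx)) (is_derive1M (cst K) (dX m.+2 _ Jx)))
    (is_derive1M (cst (M1 x0)) (dy _ Jx)))) => //.
  have xn0 : x != 0 by rewrite gt_eqF ?J0.
  have := p0 _ Jx; have := q0 _ Jx.
  rewrite -(M1E _ Jx) /M1 /L /L1 -/N -/M !exprS.
  have -> : (m.+2%:R : R) = M + 2 by rewrite -addn2 natrD.
  rewrite /y /q NM; move: ((x * p x) ^+ m) => Z.
  move: (p x) (p1 x) (p2 x) => P P1 P2 Q0 P0.
  by field; rewrite P0 xn0 Q0.
exists (M2 x0) => x Jx.
have xn0 : x != 0 by rewrite gt_eqF ?J0.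
have := p0 _ Jx; have := expf_neq0 m (y0 _ Jx); have := M2E _ Jx.
rewrite {1}/M2 => <-; rewrite !exprS /q /y; move: ((x * p x) ^+ m) => Z.
move: (p x) (p1 x) => P P1 Z0 P0.
by field; rewrite P0 xn0 Z0.
Qed.

End ScalarCurvatureODE.

(** * Smoothness of the profile of a radial function *)

Section IteratedDerivatives.
Context {R : realType}.
Implicit Types (f h : R -> R) (I N : set R) (t : R).

Fixpoint kder (k : nat) I f : Prop :=
  if k is k'.+1 then (forall t, I t -> derivable f t 1) /\ kder k' I (derive1 f)
  else True.

Lemma kder_ext k I f h : open I -> (forall t, I t -> f t = h t) -> kder k I f -> kder k I h.
Proof.
move=> Io; elim: k f h => // k IH f h fh [fd fk].
have near_fh t : I t -> \forall s \near t, f s = h s.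
  move=> It; near=> s; apply: fh.
  by near: s; apply: open_nbhs_nbhs.
have hd t : I t -> is_derive t 1 h (derive1 f t).
  by move=> It; apply: is_derive1_ext (near_fh _ It) _; exact/derivable_is_derive1/fd.
split; first by move=> t /hd[].
apply: IH fk => t It; exact/esym/is_derive1_val/hd.
Unshelve. all: by end_near. Qed.

Lemma kderS k I f (df : R -> R) : open I -> (forall t, I t -> is_derive t 1 f (df t)) ->
  kder k I df -> kder k.+1 I f.
Proof.
move=> Io fdf dfk; split; first by move=> t /fdf[].
by apply: kder_ext dfk => // t It; exact/esym/is_derive1_val/fdf.
Qed.

Lemma kder_is_derive k I f t : kder k.+1 I f -> I t -> is_derive t 1 f (derive1 f t).
Proof. by case=> fd _ It; exact/derivable_is_derive1/fd. Qed.

Lemma kderW k I f : kder k.+1 I f -> kder k I f.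
Proof. by elim: k f => // k IH f [fd fk]; split => //; exact: IH. Qed.

Lemma kder_sub k I N f : N `<=` I -> kder k I f -> kder k N f.
Proof.
move=> NI; elim: k f => // k IH f [fd fk]; split; last exact: IH.
by move=> t /NI; exact: fd.
Qed.

Lemma kder_cst k I a : open I -> kder k I (fun=> a).
Proof.
move=> Io; elim: k a => // k IH a; apply: kderS (IH 0) => // t _.
Qed.

Lemma kderD k I f h : open I -> kder k I f -> kder k I h -> kder k I (fun t => f t + h t).
Proof.
move=> Io; elim: k f h => // k IH f h fk hk.
apply: kderS (IH _ _ fk.2 hk.2) => // t It.
exact: is_derive1D (kder_is_derive fk It) (kder_is_derive hk It).
Qed.

Lemma kderM k I f h : open I -> kder k I f -> kder k I h -> kder k I (fun t => f t * h t).
Proof.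
move=> Io; elim: k f h => // k IH f h fk hk.
apply: kderS (kderD Io (IH _ _ fk.2 (kderW hk)) (IH _ _ (kderW fk) hk.2)) => // t It.
exact: is_derive1M (kder_is_derive fk It) (kder_is_derive hk It).
Qed.

Lemma kderV k I f : open I -> (forall t, I t -> f t != 0) -> kder k I f ->
  kder k I (fun t => (f t)^-1).
Proof.
move=> Io f0; elim: k => // k IH fk.
have IHk := IH (kderW fk).
apply: kderS (kderM Io (kderM Io (kder_cst k (-1) Io) fk.2) (kderM Io IHk IHk)) => // t It.
apply: (eq_is_derive1 (is_derive1V (f0 _ It) (kder_is_derive fk It))) => //.
by rewrite mulN1r expr2 invfM.
Qed.

Lemma kder_id k I : open I -> kder k I (fun t => t).
Proof.
by move=> Io; case: k => // k; apply: kderS (kder_cst k 1 Io) => // t _; exact: is_derive1_id.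
Qed.

(** The autonomous equation tau' = G(tau) is what makes induction work: the derivative of f(tau) is
    (f' G)(tau), again a function composed with the same [tau]. *)
Lemma kder_comp k I N f (tau G : R -> R) : open I -> open N ->
  (forall s, N s -> I (tau s)) -> (forall s, N s -> is_derive s 1 tau (G (tau s))) ->
  kder k I G -> kder k I f -> kder k N (fun s => f (tau s)).
Proof.
move=> Io No NI dtau; elim: k f => // k IH f Gk fk.
have fGk := kderM Io fk.2 (kderW Gk).
apply: kderS (IH _ (kderW Gk) fGk) => // s Ns.
exact: is_derive1_chain (kder_is_derive fk (NI _ Ns)) (dtau _ Ns).
Qed.

End IteratedDerivatives.

(** * From a smooth radial potential to a differentiable profile *)

Section RadialFunctions.
Context {R : realType} {n : nat}.
Local Notation C := R[i].
Local Notation Cn := 'rV[C]_n.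
Implicit Types (U : set Cn) (z w v : Cn) (k : 'I_n) (f : Cn -> C).

Lemma is_derive_line v f z (t : R) : derivable_dir f (z + t%:C *: v) v ->
  is_derive t 1 (fun s => complex.Re (line f z v s))
    (complex.Re (ddir v f (z + t%:C *: v))).
Proof.
move=> /derivable_is_ddir [h _].
have dt : is_derive t 1 (fun s => s - t) 1.
  apply: (eq_is_derive1 (is_derive1B (is_derive1_id t) (is_derive1_cst t t))) => //.
  by rewrite subr0.
have h' : is_derive (t - t) 1 (fun s => complex.Re (line f (z + t%:C *: v) v s))
    (complex.Re (ddir v f (z + t%:C *: v))) by rewrite subrr.
apply: (eq_is_derive1 (@is_derive1_chain _ _ (fun s => s - t) t _ _ h' dt)); last by rewrite mulr1.
by move=> s; rewrite /line -addrA -scalerDl -rmorphD /= (addrC t) subrK.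
Qed.

Lemma open_line U z v : open U -> open [set t : R | U (z + t%:C *: v)].
Proof.
move=> Uo; have /continuousP/(_ _ Uo) := @continuous_line R n z v.
exact.
Qed.

(** Only coordinate directions are allowed, since [class_C] controls just those; differentiating
    repeatedly in one of them stays within [class_C]. *)
Lemma class_C_kder m U f v z : open U -> class_C m U f ->
  (exists k, v = xdir k) \/ (exists k, v = ydir k) ->
  kder m [set t : R | U (z + t%:C *: v)] (fun t => complex.Re (line f z v t)).
Proof.
move=> Uo fm vk; have Io := @open_line U z v Uo.
elim: m f fm => [//|m IH f [_ fk]].
have [fd mv] : (forall w, U w -> derivable_dir f w v) /\ class_C m U (ddir v f).
  case: vk => [[k ->]|[k ->]]; have [fx fy mx my] := fk k.
    exact: (conj fx mx).
  exact: (conj fy my).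
apply: (@kderS _ m _ _ _ Io _ (IH _ mv)) => t Ut.
exact: is_derive_line (fd _ Ut).
Qed.

Lemma sqnE z : sqn z = \sum_i (complex.Re (z 0 i) ^+ 2 + complex.Im (z 0 i) ^+ 2).
Proof.
apply: (@complexI R); rewrite sqnC rmorph_sum /=; apply: eq_bigr => i _.
case: (z 0 i) => a b; rewrite sqr_normc; apply/eqP; rewrite eq_complex /=.
by apply/andP; split; apply/eqP; ring.
Qed.

Lemma sqn_ge0 z : 0 <= sqn z.
Proof. by rewrite sqnE; apply: sumr_ge0 => i _; rewrite addr_ge0 ?sqr_ge0. Qed.

Lemma sqn_eq0 z : (sqn z == 0) = (z == 0).
Proof.
apply/idP/eqP => [|->]; last first.
  by rewrite sqnE big1 // => i _; rewrite mxE /= expr0n addr0.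
rewrite sqnE psumr_eq0 => [/allP H|i _]; last by rewrite addr_ge0 ?sqr_ge0.
apply/rowP => i; rewrite mxE; have /= := H i (mem_index_enum _).
rewrite paddr_eq0 ?sqr_ge0 // !sqrf_eq0.
by case: (z 0 i) => a b /= /andP[/eqP -> /eqP ->].
Qed.

Lemma sqn_gt0 z : z != 0 -> 0 < sqn z.
Proof. by move=> z0; rewrite lt_neqAle sqn_ge0 eq_sym sqn_eq0 z0. Qed.

Lemma sqn_xdir z k (t : R) :
  sqn (z + t%:C *: xdir k) = sqn z + 2 * complex.Re (z 0 k) * t + t ^+ 2.
Proof.
rewrite !sqnE (bigD1 k) //= [in RHS](bigD1 k) //= !mxE !eqxx /= mulr1.
rewrite (eq_bigr (fun i => complex.Re (z 0 i) ^+ 2 + complex.Im (z 0 i) ^+ 2)); last first.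
  by move=> i /negbTE ik; rewrite !mxE eq_sym eq_sym ik andbF mulr0 addr0.
by case: (z 0 k) => a b /=; ring.
Qed.

Lemma sqn_ydir z k (t : R) :
  sqn (z + t%:C *: ydir k) = sqn z + 2 * complex.Im (z 0 k) * t + t ^+ 2.
Proof.
rewrite !sqnE (bigD1 k) //= [in RHS](bigD1 k) //= !mxE !eqxx /= mulr1.
rewrite (eq_bigr (fun i => complex.Re (z 0 i) ^+ 2 + complex.Im (z 0 i) ^+ 2)); last first.
  by move=> i /negbTE ik; rewrite !mxE ik andbF mulr0 mulr0 addr0.
by rewrite -complexiE; case: (z 0 k) => a b /=; ring.
Qed.

(** A nonzero real or imaginary part X of a coordinate gives a direction in which |z|^2 has
    derivative 2 X, so |z|^2 is a local parameter on that line. *)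
Lemma exists_dir z : z != 0 -> exists2 v, (exists k, v = xdir k) \/ (exists k, v = ydir k) &
  exists2 X : R, X != 0 & forall t, sqn (z + t%:C *: v) = sqn z + 2 * X * t + t ^+ 2.
Proof.
move=> z0; have [k zk] : exists k, z 0 k != 0.
  apply/existsP; apply: contraNT z0; rewrite negb_exists => /forallP H.
  by apply/eqP/rowP => k; rewrite mxE; apply/eqP; rewrite -[_ == _]negbK H.
case: (eqVneq (complex.Re (z 0 k)) 0) => [re0|re0].
  exists (ydir k); first by right; exists k.
  exists (complex.Im (z 0 k)) => [|t]; last exact: sqn_ydir.
  apply: contraNneq zk => im0; rewrite -[z 0 k]/(z 0 k); case: (z 0 k) re0 im0 => a b /=.
  by move=> -> ->.
exists (xdir k); first by left; exists k.
by exists (complex.Re (z 0 k)) => // t; exact: sqn_xdir.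
Qed.

Lemma continuous_Re : continuous (fun c : C => complex.Re c).
Proof.
move=> c; apply: (proj2 (@cvgrPdist_lt _ _ _ (nbhs c) (nbhs_filter c) _ _)) => e e0; near=> d.
have : `|c - d| < e%:C :> C.
  near: d; apply: (@cvgr_dist_lt _ _ _ (nbhs c) (nbhs_filter c) id c) => //.
  by rewrite ltcR.
rewrite normc_def ltcR; apply: le_lt_trans.
have -> : complex.Re c - complex.Re d = complex.Re (c - d).
  by case: (c) (d) => [? ?] [? ?].
by rewrite -sqrtr_sqr ler_sqrt ?addr_ge0 ?sqr_ge0 // lerDl sqr_ge0.
Unshelve. all: by end_near. Qed.

Lemma continuous_Im : continuous (fun c : C => complex.Im c).
Proof.
move=> c; apply: (proj2 (@cvgrPdist_lt _ _ _ (nbhs c) (nbhs_filter c) _ _)) => e e0; near=> d.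
have : `|c - d| < e%:C :> C.
  near: d; apply: (@cvgr_dist_lt _ _ _ (nbhs c) (nbhs_filter c) id c) => //.
  by rewrite ltcR.
rewrite normc_def ltcR; apply: le_lt_trans.
have -> : complex.Im c - complex.Im d = complex.Im (c - d).
  by case: (c) (d) => [? ?] [? ?].
by rewrite -sqrtr_sqr ler_sqrt ?addr_ge0 ?sqr_ge0 // lerDr sqr_ge0.
Unshelve. all: by end_near. Qed.

Lemma continuous_sqn : continuous (@sqn R n).
Proof.
rewrite (funext sqnE); apply: continuous_big => [|i _ z]; first exact: add_continuous.
have FF : Filter (nbhs z) := nbhs_filter z.
have ci := @coord_continuous _ 1 n 0 i z.
have cre : (fun w : Cn => complex.Re (w 0 i)) @ z --> complex.Re (z 0 i).
  exact: (continuous_comp ci (@continuous_Re _)).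
have cim : (fun w : Cn => complex.Im (w 0 i)) @ z --> complex.Im (z 0 i).
  exact: (continuous_comp ci (@continuous_Im _)).
apply: (@cvgD _ _ _ (nbhs z) FF).
  exact: (@cvgM _ _ (nbhs z) FF _ _ _ _ cre cre).
exact: (@cvgM _ _ (nbhs z) FF _ _ _ _ cim cim).
Qed.

Section RadialPotential.
Variables (U : set Cn) (Phi : Cn -> R).
Hypothesis Uo : open U.
Hypothesis Phi_smooth : smooth_on U (fun z => (Phi z)%:C).
Hypothesis Phi_radial : forall z w, U z -> U w -> sqnorm z = sqnorm w -> Phi z = Phi w.

(** The value 0 is left out: smoothness of the potential at the origin does not directly give
    derivatives of the profile there. *)
Definition radii : set R := [set s | 0 < s /\ exists2 z, U z & sqn z = s].

(* The potential as a function of |z|^2; outside of radii U its value is junk. *)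
Definition profile (s : R) : R := Phi (xget 0 [set z | U z /\ sqn z = s]).

Lemma profileE z : U z -> profile (sqn z) = Phi z.
Proof.
move=> Uz; have ex : exists w, [set w | U w /\ sqn w = sqn z] w by exists z.
have [Uw wz] := xgetPex 0 ex.
by apply: Phi_radial => //; rewrite -!sqnC wz.
Qed.

(** Near [s] the profile is the potential restricted to a line, composed with the explicit local
    inverse [tau] of t |-> s + 2 X t + t^2. *)
Lemma radii_kder s m : radii s ->
  exists N : set R, [/\ open N, N s, N `<=` radii & kder m N profile].
Proof.
move=> [s0 [z Uz zs]].
have z0 : z != 0 by rewrite -sqn_eq0 zs gt_eqF.
have [v vk [X X0 sqnv]] := exists_dir z0.
have := class_C_kder z Uo (Phi_smooth m) vk.
set I := [set t : R | U (z + t%:C *: v)] => kI.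
(* |z + t v|^2 = s + 2 X t + t^2, and tau inverts this near t = 0. *)
pose r s' : R := 1 + (s' - s) / X ^+ 2.
pose tau s' : R := X * (Num.sqrt (r s') - 1).
have X2 : 0 < X ^+ 2 by rewrite exprn_even_gt0.
have r_cont : continuous r.
  move=> t; apply: cvgD; first exact: cvg_cst.
  by apply: cvgMr_tmp; apply: cvgB; [exact: cvg_id|exact: cvg_cst].
have tau_cont : continuous tau.
  move=> t; apply: cvgMl_tmp; apply: cvgB; last exact: cvg_cst.
  by apply: (continuous_comp (r_cont t)); exact: sqrt_continuous.
pose N := r @^-1` [set t | 0 < t] `&` tau @^-1` I.
have Io : open I by exact: open_line.
have No : open N.
  apply: openI; first by move/continuousP: r_cont; apply; exact: open_gt.
  by move/continuousP: tau_cont; apply.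
have Xtau t : X + tau t = X * Num.sqrt (r t) by rewrite /tau; ring.
have sq_tau t : N t -> sqn z + 2 * X * tau t + tau t ^+ 2 = t.
  move=> [rt _]; have : (X + tau t) ^+ 2 = X ^+ 2 * r t.
    by rewrite Xtau exprMn sqr_sqrtr // ltW.
  rewrite zs => H; have -> : s + 2 * X * tau t + tau t ^+ 2 = s - X ^+ 2 + (X + tau t) ^+ 2 by ring.
  by rewrite H /r; field.
have X0tau t : N t -> X + tau t != 0.
  by move=> [rt _]; rewrite Xtau mulf_neq0 // sqrtr_eq0 -ltNge.
exists N; split => //.
- rewrite /N /= /r subrr mul0r addr0 /tau /r subrr mul0r addr0 sqrtr1 subrr mulr0.
  by rewrite /I /= scale0r addr0.
- move=> t Nt; have [rt It] := Nt; split; last first.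
    by exists (z + (tau t)%:C *: v) => //; rewrite sqnv sq_tau.
  (* At t = - X the quadratic takes its minimum s - X^2, which is a value of |.|^2, so X^2 <= s.
     Positivity of [r t] then forces t > 0. *)
  have : 0 <= sqn (z + (- X)%:C *: v) by exact: sqn_ge0.
  rewrite sqnv zs => H; have {}H : X ^+ 2 <= s.
    by rewrite -subr_ge0; move: H; congr (_ <= _); ring.
  have : 0 < X ^+ 2 * r t by rewrite mulr_gt0.
  rewrite /r mulrDr mulr1 mulrCA divff ?gt_eqF // mulr1; lra.
- pose I' := I `&` [set t | X + t != 0].
  have I'o : open I'.
    apply: openI => //.
    have /continuousP : continuous (fun t : R => X + t).
      by move=> t; apply: cvgD; [exact: cvg_cst|exact: cvg_id].
    by move=> /(_ [set t : R | t != 0]); apply; exact: open_neq.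
  apply: (@kder_ext _ _ _ (fun t => complex.Re (line (fun z => (Phi z)%:C) z v (tau t))) _ No).
    move=> t Nt; have [rt It] := Nt; rewrite /line /= -profileE //.
    by rewrite sqnv sq_tau.
  (* Differentiating 2 X tau + tau^2 shows that tau' = 1 / (2 (X + tau)), which has the form
     [kder_comp] asks for. *)
  apply: (@kder_comp _ m I' N (fun t => complex.Re (line (fun z => (Phi z)%:C) z v t))
     tau (fun t => (2 * (X + t))^-1)) => //.
  + by move=> t Nt; split; [case: Nt|exact: X0tau].
  + move=> t Nt; have [rt It] := Nt.
    have dr : is_derive t 1 r (X ^- 2).
      apply: (eq_is_derive1 (is_derive1D (is_derive1_cst t 1) (is_derive1M
        (is_derive1B (is_derive1_id t) (is_derive1_cst t s)) (is_derive1_cst t (X ^- 2))))) => //.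
      by ring.
    apply: (eq_is_derive1 (is_derive1M (is_derive1_cst t X) (is_derive1B
      (is_derive1_chain (is_derive1_sqrt rt) dr) (is_derive1_cst t 1)))) => //.
    have := X0tau _ Nt; rewrite Xtau => H.
    by field; rewrite X0 andbT; apply: contraNneq H => ->; rewrite mulr0.
  + apply: kderV => //; first by move=> t [_ ?]; rewrite mulf_neq0.
    by apply: kderM => //; [exact: kder_cst|apply: kderD => //; [exact: kder_cst|exact: kder_id]].
  + by apply: kder_sub kI => t [].
Qed.

Lemma radii_open : open radii.
Proof.
rewrite openE => s /(radii_kder 0) [N [No Ns NS _]].
by apply: filterS NS _; exact: open_nbhs_nbhs.
Qed.

Lemma radii_interval : connected U -> is_interval radii.
Proof.
move=> Uc; have : connected (@sqn R n @` U).
  apply: connected_continuous_connected => //.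
  by apply: continuous_subspaceT; exact: continuous_sqn.
move=> /connected_intervalP Si a b [a0 [z Uz za]] [b0 [w Uw wb]] t /andP[at_ tb].
have [u Uu ut] : (@sqn R n @` U) t.
  by apply: (Si a b); [exists z|exists w|rewrite at_ tb].
by split; [exact: lt_le_trans at_|exists u].
Qed.

End RadialPotential.
End RadialFunctions.

(** * Constancy of the explicit coefficients *)

Section Constancy.
Variable F : numFieldType.
Implicit Types (K B D w : F) (n : nat).

Lemma poly0_inj (P : {poly F}) (w : nat -> F) : injective w ->
  (forall k, root P (w k)) -> P = 0.
Proof.
move=> wi Pw; apply/eqP/negPn/negP => P0.
have := max_poly_roots P0 (rs := map w (iota 0 (size P))).
rewrite size_map size_iota ltnn => H; apply/notF/H.
  by apply/allP => _ /mapP[k _ ->].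
by rewrite map_inj_uniq ?iota_uniq.
Qed.

Definition constancy (n : nat) (B D : F) := n = 1%N \/ D = 0 /\ (n = 2%N \/ B = 0).

Lemma a2_constancy n K B D (y : F) : constancy n B D ->
  a2_formula n%:R K (B / y ^+ n) (D / y ^+ n.+1) = a2_formula n%:R K 0 0.
Proof.
rewrite /a2_formula => -[->|[-> [->|->]]]; rewrite ?mul0r.
- by move: (B / _) (D / _) => b d; ring.
- by move: (B / _) => b; ring.
- by [].
Qed.

(** [z] is arbitrary because the last argument of [a3_formula] is always multiplied by [b] or
    [c]. *)
Lemma a3_constancy n K B D (y z : F) : constancy n B D ->
  a3_formula n%:R K (B / y ^+ n) (D / y ^+ n.+1) y^-1 = a3_formula n%:R K 0 0 z.
Proof.
rewrite /a3_formula => -[->|[-> [->|->]]]; rewrite ?mul0r.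
- by move: (y^-1) (B / _) (D / _) => u b d; ring.
- by move: (y^-1) (B / _) => u b; ring.
- by move: (y^-1) => u; ring.
Qed.

Section Converse.
Variables (n : nat) (K B D c : F) (w : nat -> F).
Hypothesis n1 : (1 < n)%N.
Hypothesis w_inj : injective w.

(** The polynomial [P], which is 24 (a_2 - c) in the variable 1 / y, vanishes at all [w k]. Degree
    2n + 2 yields [D = 0], then degree 2n yields [n = 2] or [B = 0]. *)
Lemma a2_constancy_conv :
  (forall k, a2_formula n%:R K (B * w k ^+ n) (D * w k ^+ n.+1) = c) -> constancy n B D.
Proof.
move=> H; right.
pose N : F := n%:R.
pose P : {poly F} := (N * (N ^+ 2 - 1) * (N - 2) * B ^+ 2) *: 'X^(2 * n)
  + (N * (N ^+ 2 - 1) * 2 * N * B * D) *: 'X^(2 * n + 1)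
  + (N * (N ^+ 2 - 1) * (N + 2) * D ^+ 2) *: 'X^(2 * n + 2)
  + (N * (N + 1) * (2 - 4 * (N + 1) + 3 * N * (N + 1)) * K ^+ 2 - 24 * c)%:P.
have P0 : P = 0.
  apply: (poly0_inj w_inj) => k; rewrite /root; apply/eqP.
  rewrite /P !(hornerD, hornerN, hornerZ, hornerXn, hornerC) -(H k) /a2_formula -/N.
  rewrite !(exprD _ (2 * n)) !(mulnC 2%N) !exprM (exprSr _ n) expr1.
  by move: (w k) (w k ^+ n) => x X; field.
have N0 : N != 0 by rewrite pnatr_eq0 -lt0n ltnW.
have N1 : N ^+ 2 - 1 != 0.
  by rewrite subr_eq0 -natrX pnatr_eq1; case: (n) n1 => [|[|m]].
have N2 : N + 2 != 0 by rewrite -natrD pnatr_eq0 addn_eq0 andbF.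
have cf k : P`_k = 0 by rewrite P0 coef0.
have := cf (2 * n + 2)%N; rewrite /P !coefD !coefZ !coefXn coefC eqxx addn_eq0 andbF.
have -> : (2 * n + 2 == 2 * n)%N = false by lia.
have -> : (2 * n + 2 == 2 * n + 1)%N = false by lia.
rewrite !mulr0 !add0r addr0 mulr1 => /eqP.
rewrite !mulf_eq0 (negbTE N0) (negbTE N1) (negbTE N2) ?orbb /= ?orbb => /eqP D0; split=> //.
have := cf (2 * n)%N; rewrite /P D0 !coefD !coefZ !coefXn coefC eqxx.
have -> : (2 * n == 2 * n + 1)%N = false by lia.
have -> : (2 * n == 2 * n + 2)%N = false by lia.
have -> : (2 * n == 0)%N = false by lia.
rewrite !mulr0 !addr0 mulr1 => /eqP.
rewrite !mulf_eq0 (negbTE N0) (negbTE N1) ?orbb /= ?orbb => /orP[|/eqP ->]; last by right.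
by rewrite subr_eq0 eqr_nat => /eqP; left.
Qed.

(** Degree 3n + 3 stands alone and yields [D = 0]. Degree 3n may coincide with 2n + 3 or 2n + 2, but
    those coefficients contain [D]; it differs from the surviving 2n + 1, 2n and 0 because n > 1. *)
Lemma a3_constancy_conv :
  (forall k, a3_formula n%:R K (B * w k ^+ n) (D * w k ^+ n.+1) (w k) = c) -> constancy n B D.
Proof.
move=> H; right.
pose N : F := n%:R.
(* This is a_3 - c as a polynomial in 1 / y, multiplied by 48 / (N (N^2 - 1)), which is legitimate
   as n > 1. *)
pose P : {poly F} :=
    ((N + 1) * (N + 2) * (2 * N + 3) * 2 * D ^+ 3) *: 'X^(3 * n + 3)
  + (3 * (N + 1) * (2 * N ^+ 2 + 3 * N + 2) * 2 * B * D ^+ 2) *: 'X^(3 * n + 2)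
  + (3 * N ^+ 2 * (2 * N + 1) * 2 * B ^+ 2 * D) *: 'X^(3 * n + 1)
  + (N * (N - 2) * (2 * N + 1) * 2 * B ^+ 3) *: 'X^(3 * n)
  + ((N + 1) * (N + 2) * (N + 3) * 2 * D ^+ 2) *: 'X^(2 * n + 3)
  + (2 * N * (N + 1) * (N + 2) * 2 * B * D - (N + 1) * (N + 2) * (N + 6) * K * D ^+ 2)
      *: 'X^(2 * n + 2)
  + (N * (N - 2) * (N + 2) * 2 * B ^+ 2 - 2 * N * (N + 1) * (N + 4) * K * B * D)
      *: 'X^(2 * n + 1)
  - (N * (N - 2) * (N + 3) * K * B ^+ 2) *: 'X^(2 * n)
  + (N * (N + 1) * (N - 2) * K ^+ 3 - 48 * c / (N * (N ^+ 2 - 1)))%:P.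
have N0 : N != 0 by rewrite pnatr_eq0 -lt0n ltnW.
have N1 : N ^+ 2 - 1 != 0.
  by rewrite subr_eq0 -natrX pnatr_eq1; case: (n) n1 => [|[|m]].
have N1' : N + 1 != 0 by rewrite natr1 pnatr_eq0.
have N2 : N + 2 != 0 by rewrite -natrD pnatr_eq0 addn_eq0 andbF.
have N3 : 2 * N + 3 != 0 by rewrite -natrM -natrD pnatr_eq0 addn_eq0 andbF.
have N4 : 2 * N + 1 != 0 by rewrite -natrM natr1 pnatr_eq0.
have two0 : (2 : F) != 0 by rewrite pnatr_eq0.
have P0 : P = 0.
  apply: (poly0_inj w_inj) => k; rewrite /root; apply/eqP.
  rewrite /P !(hornerD, hornerN, hornerZ, hornerXn, hornerC) -(H k) /a3_formula -/N.
  rewrite !(exprD _ (2 * n)) !(exprD _ (3 * n)) !(mulnC 2%N) !(mulnC 3%N) !exprM (exprSr _ n) expr1.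
  by move: (w k) (w k ^+ n) => x X; field; rewrite N0 N1.
have cf k : P`_k = 0 by rewrite P0 coef0.
have := cf (3 * n + 3)%N; rewrite /P !coefD coefN !coefZ !coefXn coefC eqxx addn_eq0 andbF.
have -> : (3 * n + 3 == 3 * n + 2)%N = false by lia.
have -> : (3 * n + 3 == 3 * n + 1)%N = false by lia.
have -> : (3 * n + 3 == 3 * n)%N = false by lia.
have -> : (3 * n + 3 == 2 * n + 3)%N = false by lia.
have -> : (3 * n + 3 == 2 * n + 2)%N = false by lia.
have -> : (3 * n + 3 == 2 * n + 1)%N = false by lia.
have -> : (3 * n + 3 == 2 * n)%N = false by lia.
rewrite !mulr0 oppr0 !addr0 mulr1 => /eqP.
rewrite !mulf_eq0 (negbTE N1') (negbTE N2) (negbTE N3) (negbTE two0) ?orbb /= ?orbb => /eqP D0.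
split=> //; have [->|n2] := eqVneq n 2%N; first by left.
right; have := cf (3 * n)%N; rewrite /P D0 !coefD coefN !coefZ !coefXn coefC eqxx.
have -> : (3 * n == 2 * n + 1)%N = false by lia.
have -> : (3 * n == 2 * n)%N = false by lia.
have -> : (3 * n == 0)%N = false by lia.
rewrite !(expr0n, mulr0, mul0r, addr0, add0r, oppr0) /= mulr1 => /eqP.
have N5 : N - 2 != 0 by rewrite subr_eq0 eqr_nat.
by rewrite !mulf_eq0 (negbTE N0) (negbTE N4) (negbTE N5) (negbTE two0) ?orbb /= ?orbb => /eqP.
Qed.

End Converse.
End Constancy.

(** * Radial metrics of constant scalar curvature *)

Lemma scal_expr_rmorph (F F' : fieldType) (f : {rmorphism F -> F'}) (l l2 p p1 x : F) (n : nat) :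
  - f l / f p * n%:R - (f l2 - f l * f p1 / f p) * f x / (f p + f x * f p1) =
  f (- l / p * n%:R - (l2 - l * p1 / p) * x / (p + x * p1)).
Proof. by rewrite !(rmorphB, rmorphM, fmorphV, rmorphN, rmorphD, rmorph_nat). Qed.

Section ConstantScalarCurvature.
Context {R : realType} {n : nat}.
Local Notation C := R[i].
Local Notation Cn := 'rV[C]_n.
Variables (U : set Cn) (g : Cn -> 'M[C]_n) (Phi : Cn -> R) (K : R).
Hypothesis n0 : (0 < n)%N.
Hypothesis Uo : open U.
Hypothesis gpos : forall z, U z -> posdef_hermitian (g z).
Hypothesis Phi_smooth : smooth_on U (fun z => (Phi z)%:C).
Hypothesis Phi_pot : forall z, U z -> forall i j,
  g z i j = dz i (dzb j (fun z => (Phi z)%:C)) z.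
Hypothesis Phi_radial : forall z w, U z -> U w -> sqnorm z = sqnorm w -> Phi z = Phi w.
Hypothesis scalK : forall z, U z -> scal g z = (n%:R * (n%:R + 1) * K)%:C.
Implicit Types (z w : Cn) (i j k : 'I_n) (s t x a : R).

Let phi := profile U Phi.
Let f1 : R -> R := derive1 phi.
Let f2 : R -> R := derive1 f1.
Let f3 : R -> R := derive1 f2.
Let f4 : R -> R := derive1 f3.

Lemma profile_derive s : radii U s ->
  [/\ is_derive s 1 phi (f1 s), is_derive s 1 f1 (f2 s),
      is_derive s 1 f2 (f3 s) & is_derive s 1 f3 (f4 s)].
Proof.
move=> /(radii_kder Uo Phi_smooth Phi_radial 4) [N [No Ns _ kN]].
have k1 : kder 3 N f1 := kN.2; have k2 : kder 2 N f2 := k1.2.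
have k3 : kder 1 N f3 := k2.2.
by split; [exact: kder_is_derive kN Ns|exact: kder_is_derive k1 Ns
          |exact: kder_is_derive k2 Ns|exact: kder_is_derive k3 Ns].
Qed.

Lemma radii_sqn z : U z -> z != 0 -> radii U (sqn z).
Proof. by move=> Uz z0; split; [exact: sqn_gt0|exists z]. Qed.

Lemma metric_profile z i j : U z -> z != 0 -> g z i j = form2 f1 f2 i j z.
Proof.
move=> Uz z0; rewrite Phi_pot //.
have nearU w : U w -> w != 0 -> \forall v \near w, U v /\ v != 0.
  move=> Uw w0; near=> v; split.
    by near: v; exact: open_nbhs_nbhs.
  rewrite -sqn_eq0; near: v.
  have := @continuous_sqn R n w; rewrite /continuous_at => H.
  apply: (H [set t : R | t != 0]).
  by apply: open_nbhs_nbhs; split; [exact: open_neq|rewrite /= sqn_eq0].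
have d1 w k : U w -> w != 0 ->
    is_wirt k (fun z => (Phi z)%:C) w ((f1 (sqn w))%:C * (w 0 k)^* ) ((f1 (sqn w))%:C * w 0 k).
  move=> Uw w0; have [dphi _ _ _] := profile_derive (radii_sqn Uw w0).
  apply: is_wirt_near (is_wirt_rad k dphi).
  have := nearU _ Uw w0; apply: filterS => v [Uv _].
  by rewrite /rad /phi profileE.
have [_ df1 _ _] := profile_derive (radii_sqn Uz z0).
have H := is_wirtM (is_wirt_rad i df1) (is_wirt_coord i j z).
rewrite (dz_val (is_wirt_near _ H)); last first.
  have := nearU _ Uz z0; apply: filterS => w [Uw w0].
  exact/esym/(dzb_val (d1 w j Uw w0)).
by rewrite /form2 /rad (eq_sym j i); ring.
Unshelve. all: by end_near. Qed.

(** * The metric over an interval of positive radii *)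

Section OffOrigin.
Variables (J : set R) (a : R).
Hypothesis Jo : open J.
Hypothesis Ji : is_interval J.
Hypothesis JU : J `<=` radii U.
Hypothesis na : n = 1%N \/ a = 0.
(* For n = 1 only p + x p1 matters, so the shift a, chosen to make p nonzero, does
   not change the metric. *)
Let p s := f1 s + a / s.
Let p1 s := f2 s - a / s ^+ 2.
Let p2 s := f3 s + 2 * a / s ^+ 3.
Let p3 s := f4 s - 6 * a / s ^+ 4.
Hypothesis p0 : forall s, J s -> p s != 0.

Let V : set Cn := U `&` @sqn R n @^-1` J.

Let J0 s : J s -> 0 < s. Proof. by move=> /JU[]. Qed.

Let Vo : open V.
Proof.
apply: openI => //; have /continuousP := @continuous_sqn R n.
exact.
Qed.

Let Vn0 z : V z -> z != 0.
Proof. by move=> [_ /J0]; rewrite -sqn_eq0 => /gt_eqF ->. Qed.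

Let surj s : J s -> exists2 z, V z & sqn z = s.
Proof.
move=> Js; have [_ [z Uz zs]] := JU Js; exists z => //; split => //=.
by rewrite zs.
Qed.

Let dp s : J s -> is_derive s 1 p (p1 s).
Proof.
move=> Js; have [_ d1 _ _] := profile_derive (JU Js).
have s0 : s != 0 by rewrite gt_eqF ?J0.
apply: (eq_is_derive1 (is_derive1D d1 (is_derive1M (is_derive1_cst s a)
  (is_derive1V (f := fun t : R => t) s0 (is_derive1_id s))))) => //.
by rewrite /p1; field.
Qed.

Let dp1 s : J s -> is_derive s 1 p1 (p2 s).
Proof.
move=> Js; have [_ _ d2 _] := profile_derive (JU Js).
have s0 : s != 0 by rewrite gt_eqF ?J0.
have s20 : s ^+ 2 != 0 by rewrite expf_neq0.
apply: (eq_is_derive1 (is_derive1B d2 (is_derive1M (is_derive1_cst s a)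
  (is_derive1V (f := fun t : R => t ^+ 2) s20 (is_derive1X 2 (is_derive1_id s)))))) => //.
by rewrite /p2 /=; field.
Qed.

Let dp2 s : J s -> is_derive s 1 p2 (p3 s).
Proof.
move=> Js; have [_ _ _ d3] := profile_derive (JU Js).
have s0 : s != 0 by rewrite gt_eqF ?J0.
have s30 : s ^+ 3 != 0 by rewrite expf_neq0.
apply: (eq_is_derive1 (is_derive1D d3 (is_derive1M (is_derive1_cst s (2 * a))
  (is_derive1V (f := fun t : R => t ^+ 3) s30 (is_derive1X 3 (is_derive1_id s)))))) => //.
by rewrite /p3 /=; field.
Qed.

Let gE z : V z -> forall i j, g z i j = form2 p p1 i j z.
Proof.
move=> Vz i j; have z0 := Vn0 Vz; rewrite metric_profile ?Vz.1 //; last by case: Vz.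
rewrite /form2 /rad /p /p1; case: na => [n1|->]; last by rewrite !mul0r addr0 subr0.
have ord1E (k : 'I_n) : k = i.
  have lt1 (l : 'I_n) : (l < 1)%N by apply: leq_trans (ltn_ord l) _; rewrite n1.
  by apply/val_inj; have := lt1 k; have := lt1 i; rewrite /= !ltnS !leqn0 => /eqP -> /eqP.
have zz : (z 0 i)^* * z 0 j = (sqn z)%:C.
  rewrite -sum_zzb (bigD1 i) //= big1 => [|k]; first by rewrite addr0 (ord1E j) mulrC.
  by rewrite (ord1E k) eqxx.
have x0 : (sqn z)%:C != 0 :> C.
  by apply: contraNneq z0 => -[x0]; rewrite -sqn_eq0 x0.
rewrite zz (ord1E j) eqxx !rmorphD rmorphN !rmorphM !fmorphV rmorphXn /=.
by move: ((sqn z)%:C) (_ (f1 _)) (_ (f2 _)) (a%:C) x0 => x u v b0 x0; field.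
Qed.

(** Positivity tested on the eigenvector [z] itself. *)
Let q0 z : V z -> p (sqn z) + sqn z * p1 (sqn z) != 0.
Proof.
move=> Vz; have [_ gp] := gpos Vz.1; have := gp z (Vn0 Vz).
rewrite (mulmx_g gE Vz) -scalemxAl mxE => H.
apply: contraTneq H => q0; suff -> : zq p p1 z = 0 by rewrite mul0r ltxx.
by rewrite /zq /rad -rmorphM -rmorphD q0.
Qed.

Let Vp0 z : V z -> p (sqn z) != 0. Proof. by case=> _ /p0. Qed.
Let Vdp z : V z -> is_derive (sqn z) 1 p (p1 (sqn z)). Proof. by case=> _ /dp. Qed.
Let Vdp1 z : V z -> is_derive (sqn z) 1 p1 (p2 (sqn z)). Proof. by case=> _ /dp1. Qed.
Let Vdp2 z : V z -> is_derive (sqn z) 1 p2 (p3 (sqn z)). Proof. by case=> _ /dp2. Qed.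
Let Vgpos z : V z -> posdef_hermitian (g z). Proof. by case=> /gpos. Qed.

Lemma scal_off_origin z : U z -> J (sqn z) -> scal g z =
  (- L1 (n := n) p p1 p2 (sqn z) / p (sqn z) * n%:R
   - (L2 (n := n) p p1 p2 p3 (sqn z) - L1 (n := n) p p1 p2 (sqn z) * p1 (sqn z) / p (sqn z))
     * sqn z / (p (sqn z) + sqn z * p1 (sqn z)))%:C.
Proof.
move=> Uz Jz; have Vz : V z by split.
rewrite (scal_radial Vo gE Vdp Vdp1 Vdp2 Vp0 q0 Vgpos Vz) /zq /rad.
exact: scal_expr_rmorph.
Qed.

(** The derivative of y = s p(s) is the radial eigenvalue, which never vanishes; the mean value
    theorem concludes. *)
Lemma profile_inj s t : J s -> J t -> s * p s = t * p t -> s = t.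
Proof.
move=> Js Jt e.
have df r : J r -> is_derive r 1 (fun u => u * p u) (p r + r * p1 r).
  by move=> Jr; apply: (eq_is_derive1 (is_derive1M (is_derive1_id r) (dp Jr))) => //; rewrite mul1r.
have [r Jr /esym/eqP] := mvt_interval Ji df Js Jt.
have [w Vw wr] := surj Jr.
by rewrite e subrr mulf_eq0 -wr (negbTE (q0 Vw)) /= subr_eq0 => /eqP.
Qed.

Lemma profile_ode : exists B D : R, forall s, J s ->
  p1 s = p s ^+ 2 * (B / (s * p s) ^+ n + D / (s * p s) ^+ n.+1 - K).
Proof.
apply: (const_scal_ode (p2 := p2) (p3 := p3) n0 Ji J0 dp dp1 dp2 p0).
- by move=> s /surj[z Vz <-]; exact: q0.
- by move=> s /surj[z Vz <-]; exact: (der_L1 Vdp Vdp1 Vdp2 Vp0 q0 Vz).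
- move=> s Js; have [z Vz zs] := surj Js; apply: (@complexI R).
  by rewrite -(scalK Vz.1) (scal_off_origin Vz.1 Vz.2) zs.
Qed.

Lemma TYZ_off_origin : exists B D : R, forall z, U z -> J (sqn z) ->
  let y := sqn z * p (sqn z) in
  y != 0 /\
  TYZ_a2 g z = a2_formula n%:R K%:C (B / y ^+ n)%:C (D / y ^+ n.+1)%:C /\
  TYZ_a3 g z = a3_formula n%:R K%:C (B / y ^+ n)%:C (D / y ^+ n.+1)%:C (y^-1)%:C.
Proof.
have [B [D ode]] := profile_ode; exists B, D => z Uz Jz y.
pose b s := B / (s * p s) ^+ n; pose c s := D / (s * p s) ^+ n.+1.
pose lam s : R := s^-1.
have y0 s : J s -> s * p s != 0.
  by move=> Js; rewrite mulf_neq0 ?p0 // gt_eqF ?J0.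
have p1E s : J s -> p1 s = mp1 p b c K s by move=> /ode.
have gE' w : V w -> forall i j, g w i j = form2 p (mp1 p b c K) i j w.
  by move=> Vw i j; rewrite gE // /form2 /rad -p1E //; case: Vw.
have dp' w : V w -> is_derive (sqn w) 1 p (mp1 p b c K (sqn w)).
  by move=> [_ Jw]; rewrite -p1E //; exact: dp.
(* Exponents [n] and [n.+1] give the two equations that the local model requires of [b] and [c]. *)
have dpow (k : nat) (E : R) s : J s -> is_derive s 1 (fun t => E / (t * p t) ^+ k)
    (- (k%:R * (E / (s * p s) ^+ k) * mk p b c lam K s)).
  move=> Js; have s0 : s != 0 by rewrite gt_eqF ?J0.
  have ys := y0 _ Js.
  apply: (eq_is_derive1 (is_derive1M (is_derive1_cst s E)
    (is_derive1V (f := fun t : R => (t * p t) ^+ k) (expf_neq0 k ys)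
    (is_derive1X k (is_derive1M (is_derive1_id s) (dp Js)))))) => //.
  rewrite (p1E _ Js) /mk /mp1 /lam; move: (me b c K s) (expf_neq0 k ys).
  case: (k) => [|m] e; first by move=> _; rewrite /= !expr0; field.
  rewrite /= exprS mulf_eq0 negb_or => /andP[_]; move: (p0 Js).
  by move: ((s * p s) ^+ m) (p s) => Z P P0 Z0; field; rewrite s0 P0 Z0.
have db w : V w -> is_derive (sqn w) 1 b (- (n%:R * b (sqn w) * mk p b c lam K (sqn w))).
  by move=> [_ Jw]; exact: dpow.
have dc w : V w -> is_derive (sqn w) 1 c (- ((n%:R + 1) * c (sqn w) * mk p b c lam K (sqn w))).
  by move=> [_ Jw]; rewrite natr1; exact: dpow.
have dl w : V w -> is_derive (sqn w) 1 lam (- lam (sqn w) ^+ 2).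
  move=> [_ Jw]; have s0 : sqn w != 0 by rewrite gt_eqF ?J0.
  apply: (eq_is_derive1 (is_derive1V (f := fun t : R => t) s0 (is_derive1_id _))) => //.
  by rewrite /lam; field.
have lx w : V w -> lam (sqn w) * sqn w = 1.
  by move=> [_ Jw]; rewrite /lam mulVf // gt_eqF ?J0.
have bl w : V w -> b (sqn w) * (lam (sqn w) * sqn w) = b (sqn w).
  by move=> Vw; rewrite lx // mulr1.
have cl w : V w -> c (sqn w) * (lam (sqn w) * sqn w) = c (sqn w).
  by move=> Vw; rewrite lx // mulr1.
have w0 w : V w -> 1 + sqn w * p (sqn w) * me b c K (sqn w) != 0.
  move=> Vw; have := q0 Vw; rewrite (p1E _ Vw.2) /mp1; apply: contraNneq => e.
  have -> : p (sqn w) + sqn w * (p (sqn w) ^+ 2 * me b c K (sqn w)) =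
    p (sqn w) * (1 + sqn w * p (sqn w) * me b c K (sqn w)) by ring.
  by rewrite e mulr0.
have Vz : V z by split.
split; first exact: y0.
rewrite (model_a2 Vo n0 gE' dp' db dc dl bl cl Vp0 w0 Vgpos Vz).
rewrite (model_a3 Vo n0 gE' dp' db dc dl bl cl Vp0 w0 Vgpos Vz).
have lamE : rad lam z / rad p z = (y^-1)%:C.
  by rewrite /rad /lam /y invfM rmorphM !fmorphV.
by rewrite lamE; split.
Qed.

End OffOrigin.

Lemma is_derive1_cvg (f : R -> R) x l : is_derive x 1 f l ->
  t^-1 * (f (x + t) - f x) @[t --> (0 : R)^'] --> l.
Proof.
move=> [d <-].
have -> : (fun t => t^-1 * (f (x + t) - f x)) =
    (fun h => h^-1 *: ((f \o shift x) (h *: 1) - f x)).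
  by apply/funext => t; rewrite /= /GRing.scale /= mulr1 (addrC x).
exact: d.
Qed.

(** * The metric near the origin *)

Section Origin.
Hypothesis g_cont : forall i j z, U z -> {for z, continuous (fun w => g w i j)}.
Hypothesis U0 : U 0.

Let i0 : 'I_n := Ordinal n0.
Let v : Cn := xdir i0.
Let I : set R := [set t : R | U (0 + t%:C *: v)].
(* phi is not known to extend smoothly to 0, but t |-> phi (t ^+ 2) = H t does. *)
Let H t : R := complex.Re (line (fun z => (Phi z)%:C) 0 v t).
Let H1 : R -> R := derive1 H.
Let H2 : R -> R := derive1 H1.

Let sqn_line t : sqn (0 + t%:C *: v) = t ^+ 2.
Proof.
rewrite sqn_xdir mxE /= mulr0 mul0r addr0.
have -> : sqn (0 : Cn) = 0 by apply/eqP; rewrite sqn_eq0.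
by rewrite add0r.
Qed.

Let Io : open I. Proof. exact: open_line. Qed.

Let I0 : I 0. Proof. by rewrite /I /= scale0r addr0. Qed.

Let kH : kder 3 I H.
Proof. by apply: class_C_kder => //; left; exists i0. Qed.

Let dH t : I t -> is_derive t 1 H (H1 t). Proof. exact: kder_is_derive kH. Qed.
Let dH1 t : I t -> is_derive t 1 H1 (H2 t).
Proof. by have k1 : kder 2 I H1 := kH.2; exact: kder_is_derive k1. Qed.

Let H2_cont : {for 0, continuous H2}.
Proof.
have kH2 : kder 1 I H2 := kH.2.2.
exact: is_derive1_continuous (kder_is_derive kH2 I0).
Qed.

Let line_n0 t : t != 0 -> 0 + t%:C *: v != 0.
Proof. by move=> t0; rewrite -sqn_eq0 sqn_line expf_neq0. Qed.

Let radii_sq t : I t -> t != 0 -> radii U (t ^+ 2).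
Proof. by move=> It t0; rewrite -sqn_line; apply: radii_sqn => //; exact: line_n0. Qed.

Let HE t : I t -> H t = phi (t ^+ 2).
Proof. by move=> It; rewrite -sqn_line /phi profileE. Qed.

Let near_I (t : R) : I t -> \forall s \near t, I s.
Proof. by move=> It; exact: open_nbhs_nbhs. Qed.

Let near_n0 (t : R) : t != 0 -> \forall s \near t, s != 0.
Proof. by move=> t0; apply: open_nbhs_nbhs; split => //; exact: open_neq. Qed.

Let dsq t : is_derive t 1 (fun s : R => s ^+ 2) (2 * t).
Proof.
apply: (eq_is_derive1 (is_derive1X 2 (is_derive1_id t))) => //.
by rewrite mulr1.
Qed.

Let H1E t : I t -> t != 0 -> H1 t = 2 * t * f1 (t ^+ 2).
Proof.
move=> It t0; apply: is_derive1_val.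
have [dphi _ _ _] := profile_derive (radii_sq It t0).
apply: (is_derive1_ext (f := fun s => phi (s ^+ 2))).
  by apply: filterS (near_I It) => s /HE ->.
apply: (eq_is_derive1 (@is_derive1_chain _ phi (fun s => s ^+ 2) t _ _ dphi (dsq t))) => //.
by rewrite mulrC.
Qed.

Let H2E t : I t -> t != 0 -> H2 t = 2 * f1 (t ^+ 2) + 4 * (t ^+ 2 * f2 (t ^+ 2)).
Proof.
move=> It t0; apply: is_derive1_val.
have [_ df1 _ _] := profile_derive (radii_sq It t0).
apply: (is_derive1_ext (f := fun s => 2 * s * f1 (s ^+ 2))).
  by apply: filterS2 (near_I It) (near_n0 t0) => s Is s0; rewrite (H1E Is s0).
apply: (eq_is_derive1 (is_derive1M (is_derive1M (is_derive1_cst t 2) (is_derive1_id t))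
  (@is_derive1_chain _ f1 (fun s => s ^+ 2) t _ _ df1 (dsq t)))) => //.
by ring.
Qed.

Let near_IN : \forall s \near (0 : R), I (- s).
Proof.
have Io' : open [set t : R | U (0 + t%:C *: - v)] by exact: open_line.
have I0' : U (0 + (0 : R)%:C *: - v) by rewrite scale0r addr0.
apply: filterS (open_nbhs_nbhs (conj Io' I0')) => s.
by rewrite /I /= rmorphN scalerN scaleNr.
Qed.

(** [H] is even, being a function of the square. *)
Let H10 : H1 0 = 0.
Proof.
have dN : is_derive (0 : R) 1 (fun s => H (- s)) (- H1 0).
  have h' : is_derive (- (0 : R)) 1 H (H1 0) by rewrite oppr0; exact: dH.
  apply: (eq_is_derive1 (@is_derive1_chain _ H (fun s => - s) 0 _ _ h'
     (is_derive1N (is_derive1_id 0)))) => //.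
  by rewrite mulrN1.
have : is_derive (0 : R) 1 H (- H1 0).
  apply: is_derive1_ext dN; apply: filterS2 (near_I I0) near_IN => s Is INs.
  by rewrite (HE Is) (HE INs) sqrrN.
move=> /is_derive1_val; rewrite -/H1 => e; apply/eqP.
by move/eqP: e; rewrite -subr_eq0 opprK -mulr2n mulrn_eq0.
Qed.

(** The limit of phi' at 0, by [F_lim]; [g0E] shows that the metric at the origin is [c0] times the
    identity. *)
Let c0 : R := H2 0 / 2.

Let near_I' : \forall t \near (0 : R)^', I t /\ t != 0.
Proof.
have h1 : \forall t \near (0 : R)^', I t by exact: (nbhs_dnbhs (near_I I0)).
have h2 : \forall t \near (0 : R)^', t != 0 by exact: nbhs_dnbhs_neq.
by apply: filterS2 h1 h2.
Qed.



Let cvg_near_eq (u w : R -> R) (a b : R) :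
  (\forall t \near (0 : R)^', u t = w t) ->
  u t @[t --> (0 : R)^'] --> a -> w t @[t --> (0 : R)^'] --> b -> a = b.
Proof.
move=> uw ua wb; apply: (cvg_unique _ ua); first exact: Rhausdorff.
apply: cvg_trans wb; apply: near_eq_cvg.
by apply: filterS uw.
Qed.

Let F_lim : f1 (t ^+ 2) @[t --> (0 : R)^'] --> c0.
Proof.
have cv : 2^-1 * (t^-1 * (H1 (0 + t) - H1 0)) @[t --> (0 : R)^'] --> 2^-1 * H2 0.
  by apply: cvgM; [exact: cvg_cst|exact: is_derive1_cvg (dH1 I0)].
rewrite /c0 mulrC; apply: cvg_trans cv; apply: near_eq_cvg.
apply: filterS near_I' => t [It t0].
rewrite add0r H10 subr0 (H1E It t0).
by move: (f1 _) => F; field; rewrite t0.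
Qed.

(** From H'' = 2 phi' + 4 t^2 phi'', where H'' tends to [2 * c0] and phi' to [c0]. *)
Let G_lim : t ^+ 2 * f2 (t ^+ 2) @[t --> (0 : R)^'] --> (0 : R).
Proof.
have h2 : H2 t @[t --> (0 : R)^'] --> H2 0.
  by apply: cvg_trans H2_cont; apply: cvg_fmap2; exact: nbhs_dnbhs.
have cv : (H2 t - 2 * f1 (t ^+ 2)) / 4 @[t --> (0 : R)^'] --> (H2 0 - 2 * c0) / 4.
  by apply: cvgM; [apply: cvgB => //; apply: cvgM => //; exact: cvg_cst|exact: cvg_cst].
have e : (H2 0 - 2 * c0) / 4 = 0 by rewrite /c0; field.
rewrite e in cv; apply: cvg_trans cv; apply: near_eq_cvg.
apply: filterS near_I' => t [It t0]; rewrite (H2E It t0).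
by move: (f1 _) (f2 _) => F F'; field.
Qed.

Let X_lim : t ^+ 2 @[t --> (0 : R)^'] --> (0 : R).
Proof.
have h : t ^+ 2 @[t --> (0 : R)] --> (0 : R) ^+ 2 by exact: (@exprn_continuous R 2 0).
rewrite expr0n /= in h.
by apply: cvg_trans h; apply: cvg_fmap2; exact: nbhs_dnbhs.
Qed.

Let cvg_to (u : R -> R) (a b : R) : a = b ->
  u t @[t --> (0 : R)^'] --> a -> u t @[t --> (0 : R)^'] --> b.
Proof. by move=> ->. Qed.

Let cvgXn (u : R -> R) (l : R) (m : nat) : u t @[t --> (0 : R)^'] --> l ->
  u t ^+ m @[t --> (0 : R)^'] --> l ^+ m.
Proof.
move=> ul; elim: m => [|m ih]; first by rewrite expr0; exact: cvg_cst.
have -> : (fun t => u t ^+ m.+1) = (fun t => u t * u t ^+ m).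
  by apply/funext => t; rewrite exprS.
by rewrite exprS; exact: (cvgM ul ih).
Qed.

Let near_g (h : C -> R) i j : continuous h ->
  h (g (0 + t%:C *: v) i j) @[t --> (0 : R)^'] --> h (g 0 i j).
Proof.
move=> hc.
have c1 : 0 + t%:C *: v @[t --> (0 : R)^'] --> (0 : Cn).
  by apply: cvg_trans (@cvg_line R n 0 v); apply: cvg_fmap2; exact: nbhs_dnbhs.
have c2 : (fun w => h (g w i j)) @ (0 : Cn) --> h (g 0 i j).
  exact: (continuous_comp (g_cont (i := i) (j := j) U0) (hc _)).
exact: (@cvg_comp _ _ _ (fun t : R => 0 + t%:C *: v) (fun w => h (g w i j)) _ _ _ c1 c2).
Qed.

Let g_line t i j : I t -> t != 0 -> g (0 + t%:C *: v) i j =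
  (f1 (t ^+ 2) * (i == j)%:R
   + t ^+ 2 * f2 (t ^+ 2) * ((i == i0)%:R * (j == i0)%:R))%:C.
Proof.
move=> It t0; rewrite (metric_profile i j It (line_n0 t0)) /form2 /rad sqn_line.
have vE k : (0 + t%:C *: v) 0 k = (t * (k == i0)%:R)%:C.
  by rewrite !mxE add0r eqxx rmorphM rmorph_nat.
have cr (x : R) : (x%:C)^* = x%:C :> C by rewrite conj_Creal // complex_real.
rewrite !vE cr -!rmorphM -(rmorph_nat (real_complex R)) -rmorphM -rmorphD.
by congr (_%:C); move: (f1 _) (f2 _) => F G; ring.
Qed.

Let g0E i j : g 0 i j = (c0 * (i == j)%:R)%:C.
Proof.
have lim : f1 (t ^+ 2) * (i == j)%:R
   + t ^+ 2 * f2 (t ^+ 2) * ((i == i0)%:R * (j == i0)%:R) @[t --> (0 : R)^'] -->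
   c0 * (i == j)%:R + 0 * ((i == i0)%:R * (j == i0)%:R).
  by apply: cvgD; (apply: cvgM; [assumption|exact: cvg_cst]).
rewrite mul0r addr0 in lim.
apply/eqP; rewrite eq_complex; apply/andP; split; apply/eqP.
  have l2 := near_g (i := i) (j := j) (@continuous_Re R).
  refine (cvg_near_eq _ l2 lim).
  by apply: filterS near_I' => t [It t0]; rewrite (g_line i j It t0).
have l2 := near_g (i := i) (j := j) (@continuous_Im R).
refine (cvg_near_eq _ l2 (cvg_cst (0 : R))).
by apply: filterS near_I' => t [It t0]; rewrite (g_line i j It t0).
Qed.

Let c0_n0 : c0 != 0.
Proof.
have [_ /(_ (delta_mx 0 i0))] := gpos U0.
have d0 : delta_mx 0 i0 != 0 :> Cn.
  apply/eqP => /rowP/(_ i0)/eqP; rewrite !mxE !eqxx; exact/negP/oner_neq0.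
move=> /(_ d0); apply: contraTneq => e.
have -> : g 0 = 0 by apply/matrixP => i j; rewrite g0E e mul0r mxE.
by rewrite mulmx0 mul0mx mxE ltxx.
Qed.

Let small_radii : exists2 e : R, 0 < e & forall s, 0 < s -> s < e ->
  radii U s /\ f1 s != 0.
Proof.
have F0 : \forall t \near (0 : R)^', f1 (t ^+ 2) != 0.
  have hN : nbhs c0 [set r : R | r != 0].
    by apply: open_nbhs_nbhs; split => //; exact: open_neq.
  exact: (F_lim hN).
have IF : \forall t \near (0 : R)^', I t /\ f1 (t ^+ 2) != 0.
  by apply: filterS2 near_I' F0 => t [].
have /nbhs_ballP[e /= e0 He] : nbhs (0 : R) (fun t => t != 0 -> I t /\ f1 (t ^+ 2) != 0) := IF.
exists (e ^+ 2); first by rewrite exprn_gt0.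
move=> s s0 se.
have r0 : 0 < Num.sqrt s by rewrite sqrtr_gt0.
have re : Num.sqrt s < e.
  by rewrite -(ltr_pXn2r (n := 2)) ?nnegrE ?ltW // sqr_sqrtr // ltW.
have rn0 : Num.sqrt s != 0 by rewrite gt_eqF.
have [|Ir Fr] := He (Num.sqrt s) _ rn0.
  by rewrite /ball /= sub0r normrN gtr0_norm.
rewrite sqr_sqrtr in Fr; last exact: ltW.
by split=> //; have := radii_sq Ir rn0; rewrite sqr_sqrtr // ltW.
Qed.

(** Once B = D = 0, the ODE phi'' = - K phi'^2 makes 1 / phi' affine in the radius. This explicit
    phi' extends across 0, so the local model with [b], [c] and [lam] zero applies on a full
    neighbourhood of the origin. *)
Lemma TYZ_origin : TYZ_a2 g 0 = a2_formula n%:R K%:C 0 0 /\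
  exists y, TYZ_a3 g 0 = a3_formula n%:R K%:C 0 0 y.
Proof.
have [e e0 He] := small_radii.
pose J := [set s : R | 0 < s < e].
have Jo : open J.
  have -> : J = [set` `]0, e[] by apply/seteqP; split=> s /=; rewrite in_itv.
  exact: interval_open.
have Ji : is_interval J.
  move=> x y /= /andP[x0 xe] /andP[y0 ye] r /andP[xr ry].
  by apply/andP; split; [exact: lt_le_trans xr|exact: le_lt_trans ye].
have JU : J `<=` radii U by move=> s /andP[s0 se]; have [] := He _ s0 se.
have f10 s : J s -> f1 s != 0 by move=> /andP[s0 se]; have [] := He _ s0 se.
have p0' s : J s -> f1 s + 0 / s != 0 by move=> Js; rewrite mul0r addr0 f10.
have [B [D ode]] := profile_ode Jo Ji JU (or_intror (erefl (0 : R))) p0'.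
have near_J : \forall t \near (0 : R)^', J (t ^+ 2) /\ t != 0.
  have Xe : \forall t \near (0 : R)^', t ^+ 2 < e.
    have hN : nbhs (0 : R) [set r : R | r < e].
      by apply: open_nbhs_nbhs; split => //; exact: open_lt.
    exact: (X_lim hN).
  apply: filterS2 near_I' Xe => t [_ t0] te; split => //.
  by apply/andP; split => //; rewrite exprn_even_gt0.
have ode' s : J s -> f2 s = f1 s ^+ 2 * (B / (s * f1 s) ^+ n + D / (s * f1 s) ^+ n.+1 - K).
  by move=> /ode; rewrite !mul0r subr0 addr0.
(* The ODE times y^(n+1), which removes all denominators before the limit is taken. *)
have mul_ode (m : nat) : n = m.+1 -> forall s, J s ->
    s ^+ m.+1 * f1 s ^+ m * (s * f2 s) = B * (s * f1 s) + D - K * (s * f1 s) ^+ m.+2.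
  move=> nm s Js; rewrite (ode' _ Js) nm.
  have s0 : s != 0 by move: Js => /andP[/gt_eqF ->].
  have := f10 _ Js; move: (f1 s) => F F0.
  have E0 : s ^+ m != 0 by rewrite expf_neq0.
  have G0 : F ^+ m != 0 by rewrite expf_neq0.
  rewrite !exprMn !exprS; move: (s ^+ m) (F ^+ m) E0 G0 => E G E0 G0.
  by field; rewrite s0 F0 E0 G0.
have [m nm] : exists m, n = m.+1 by exists n.-1; rewrite prednK.
have X_lim' (k : nat) : (t ^+ 2) ^+ k @[t --> (0 : R)^'] --> (0 : R) ^+ k by exact: cvgXn.
have F_lim' (k : nat) : f1 (t ^+ 2) ^+ k @[t --> (0 : R)^'] --> c0 ^+ k by exact: cvgXn.
have XF_lim : t ^+ 2 * f1 (t ^+ 2) @[t --> (0 : R)^'] --> (0 : R).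
  by apply: (cvg_to (mul0r c0)); apply: cvgM; [exact: X_lim|exact: F_lim].
have XF_lim' (k : nat) : (t ^+ 2 * f1 (t ^+ 2)) ^+ k.+1 @[t --> (0 : R)^'] --> (0 : R).
  have : (t ^+ 2 * f1 (t ^+ 2)) ^+ k.+1 @[t --> (0 : R)^'] --> (0 : R) ^+ k.+1 by exact: cvgXn.
  by rewrite expr0n.
have lhs_lim (k : nat) : (t ^+ 2) ^+ k * f1 (t ^+ 2) ^+ m * (t ^+ 2 * f2 (t ^+ 2))
    @[t --> (0 : R)^'] --> (0 : R).
  apply: (cvg_to (mulr0 (0 ^+ k * c0 ^+ m))).
  by apply: cvgM; [apply: cvgM; [exact: X_lim'|exact: F_lim']|exact: G_lim].
(* In [mul_ode] everything except [D] tends to 0. *)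
have D0 : D = 0.
  have l2 : B * (t ^+ 2 * f1 (t ^+ 2)) + D - K * (t ^+ 2 * f1 (t ^+ 2)) ^+ m.+2
      @[t --> (0 : R)^'] --> B * 0 + D - K * 0.
    apply: cvgB; last by apply: cvgM; [exact: cvg_cst|exact: XF_lim'].
    by apply: cvgD; [apply: cvgM; [exact: cvg_cst|exact: XF_lim]|exact: cvg_cst].
  rewrite !mulr0 add0r subr0 in l2.
  apply/esym; refine (cvg_near_eq _ (lhs_lim m.+1) l2).
  by apply: filterS near_J => t [Jt _]; exact: mul_ode.
(* With [D] gone, the equation is divided by the radius before the limit; what survives is
   [B * c0]. *)
have B0 : B = 0.
  suff /eqP : B * c0 = 0 by rewrite mulf_eq0 (negbTE c0_n0) orbF => /eqP.
  have l2 : B * f1 (t ^+ 2) - K * ((t ^+ 2 * f1 (t ^+ 2)) ^+ m.+1 * f1 (t ^+ 2))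
      @[t --> (0 : R)^'] --> B * c0 - K * (0 * c0).
    apply: cvgB; first by apply: cvgM; [exact: cvg_cst|exact: F_lim].
    by apply: cvgM; [exact: cvg_cst|apply: cvgM; [exact: XF_lim'|exact: F_lim]].
  rewrite mul0r mulr0 subr0 in l2.
  apply/esym; refine (cvg_near_eq _ (lhs_lim m) l2).
  apply: filterS near_J => t [Jt t0]; have := mul_ode m nm _ Jt.
  have : t ^+ 2 != 0 by rewrite expf_neq0.
  rewrite D0; move: (t ^+ 2) (f1 _) (f2 _) => x F G x0 e'.
  apply: (mulfI x0); have -> : x * (x ^+ m * F ^+ m * (x * G)) = x ^+ m.+1 * F ^+ m * (x * G).
    by rewrite exprS; ring.
  by rewrite e' (exprS _ m.+1); ring.
have df1 s : J s -> is_derive s 1 f1 (- K * f1 s ^+ 2).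
  move=> Js; have [_ d1 _ _] := profile_derive (JU _ Js).
  by apply: (eq_is_derive1 d1) => //; rewrite ode' // B0 D0 !mul0r add0r sub0r mulrC.
pose kap := c0^-1.
have invf1 s : J s -> (f1 s)^-1 = kap + K * s.
  move=> Js.
  have cst t : J t -> (f1 t)^-1 - K * t = (f1 s)^-1 - K * s.
    move=> Jt; apply: (constant_interval Ji _ Jt Js (f := fun t => (f1 t)^-1 - K * t)) => r Jr.
    apply: (eq_is_derive1 (is_derive1B (is_derive1V (f := f1) (f10 _ Jr) (df1 _ Jr))
      (is_derive1M (is_derive1_cst r K) (is_derive1_id r)))) => //.
    by have := f10 _ Jr; move: (f1 r) => F F0; field.
  have : kap - K * 0 = (f1 s)^-1 - K * s.
    apply: (cvg_near_eq _ (cvgB (cvgV c0_n0 F_lim) (cvgM (cvg_cst K) X_lim))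
      (cvg_cst ((f1 s)^-1 - K * s))).
    by apply: filterS near_J => t [Jt _]; exact: cst.
  by rewrite mulr0 subr0 => ->; rewrite subrK.
(* Agrees with phi' on positive radii of [J] and is also defined at 0, with value [c0]. *)
pose p s := (kap + K * s)^-1.
have pE s : J s -> f1 s = p s by move=> /invf1 e'; rewrite /p -e' invrK.
pose z0 : R -> R := fun=> 0.
have f2E s : J s -> f2 s = mp1 p z0 z0 K s.
  by move=> Js; rewrite ode' // B0 D0 !mul0r /mp1 /me /z0 pE.
pose V : set Cn := U `&` @sqn R n @^-1` [set s | s < e].
have Vo : open V.
  by apply: openI => //; have /continuousP := @continuous_sqn R n; apply; exact: open_lt.
have VJ w : V w -> w != 0 -> J (sqn w).
  by move=> [_ /= we] w0; apply/andP; split => //; exact: sqn_gt0.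
have sqn0 : sqn (0 : Cn) = 0 by apply/eqP; rewrite sqn_eq0.
have d0 w : V w -> kap + K * sqn w != 0.
  move=> Vw; have [->|wn0] := eqVneq w 0.
    by rewrite sqn0 mulr0 addr0 invr_eq0.
  by rewrite -invf1 ?invr_eq0 ?f10 //; exact: VJ.
have gE w : V w -> forall i j, g w i j = form2 p (mp1 p z0 z0 K) i j w.
  move=> Vw i j; have [->|wn0] := eqVneq w 0.
    have z0j : (0 : Cn) 0 j = 0 by rewrite mxE.
    rewrite g0E /form2 z0j mulr0 mulr0 addr0 /rad sqn0 /p mulr0 addr0 /kap invrK.
    by rewrite rmorphM rmorph_nat.
  rewrite metric_profile ?Vw.1 //; last by case: Vw.
  by rewrite /form2 /rad f2E ?pE //; exact: VJ.
have dp w : V w -> is_derive (sqn w) 1 p (mp1 p z0 z0 K (sqn w)).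
  move=> Vw; have dw := d0 _ Vw.
  apply: (eq_is_derive1 (is_derive1V (f := fun s => kap + K * s) dw
    (is_derive1D (is_derive1_cst _ kap) (is_derive1M (is_derive1_cst _ K) (is_derive1_id _))))) => //.
  by rewrite /mp1 /me /z0 /p; move: (sqn w) dw => x dw; field.
have dz0 w (a : R) : a = 0 -> is_derive (sqn w) 1 z0 a.
  by move=> ->; exact: is_derive1_cst.
have db w : V w -> is_derive (sqn w) 1 z0 (- (n%:R * z0 (sqn w) * mk p z0 z0 z0 K (sqn w))).
  by move=> _; apply: dz0; rewrite /z0 mulr0 mul0r oppr0.
have dc w : V w -> is_derive (sqn w) 1 z0 (- ((n%:R + 1) * z0 (sqn w) * mk p z0 z0 z0 K (sqn w))).
  by move=> _; apply: dz0; rewrite /z0 mulr0 mul0r oppr0.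
have dl w : V w -> is_derive (sqn w) 1 z0 (- z0 (sqn w) ^+ 2).
  by move=> _; apply: dz0; rewrite /z0 expr0n oppr0.
have bl w : V w -> z0 (sqn w) * (z0 (sqn w) * sqn w) = z0 (sqn w) by rewrite /z0 mul0r.
have pn0 w : V w -> p (sqn w) != 0 by move=> Vw; rewrite invr_eq0 d0.
have w0 w : V w -> 1 + sqn w * p (sqn w) * me z0 z0 K (sqn w) != 0.
  move=> Vw; have dw := d0 _ Vw; rewrite /me /z0 /p.
  have -> : 1 + sqn w * (kap + K * sqn w)^-1 * (0 + 0 - K) = kap / (kap + K * sqn w).
    by move: (sqn w) dw => x dw; field.
  by rewrite mulf_neq0 ?invr_eq0.
have Vgpos w : V w -> posdef_hermitian (g w) by case=> /gpos.
have V0 : V 0 by split=> //=; rewrite sqn0.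
have r0 : rad z0 (0 : Cn) = 0 by rewrite /rad /z0.
split; last exists (rad z0 (0 : Cn) / rad p (0 : Cn)).
  by rewrite (model_a2 Vo n0 gE dp db dc dl bl bl pn0 w0 Vgpos V0) r0.
by rewrite (model_a3 Vo n0 gE dp db dc dl bl bl pn0 w0 Vgpos V0) r0.
Qed.

End Origin.

Lemma profile_shift s : n = 1%N -> radii U s -> exists (J : set R) (a : R),
  [/\ open J, is_interval J, J s, J `<=` radii U & forall t, J t -> f1 t + a / t != 0].
Proof.
move=> n1 rs; have s0 : 0 < s by case: rs.
(* Chosen so that the shifted function is 1 at [s], hence nonzero nearby. *)
pose a := s * (1 - f1 s); pose h t := f1 t + a / t.
have hs : h s = 1 by rewrite /h /a mulrAC mulfV ?gt_eqF // mul1r addrC subrK.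
have hc : {for s, continuous h}.
  have [_ d1 _ _] := profile_derive rs.
  apply: is_derive1_continuous (is_derive1D d1 (is_derive1M (is_derive1_cst s a)
    (is_derive1V (f := fun t : R => t) _ (is_derive1_id s)))).
  by rewrite gt_eqF.
have h0 : \forall t \near s, h t != 0.
  apply: (hc [set r : R | r != 0]); apply: open_nbhs_nbhs; split; first exact: open_neq.
  by rewrite /= hs oner_neq0.
have rn : \forall t \near s, radii U t.
  by apply: open_nbhs_nbhs; split => //; exact: radii_open Uo Phi_smooth Phi_radial.
have /nbhs_ballP[e /= e0 He] : \forall t \near s, radii U t /\ h t != 0.
  by apply: filterS2 rn h0.
pose J := [set t : R | s - e < t < s + e].
have JH t : J t -> radii U t /\ h t != 0.
  move=> /andP[t1 t2]; apply: He; rewrite /ball /= ltr_norml; apply/andP; split.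
    by rewrite ltrBrDl ltrBlDr.
  by rewrite ltrBlDr -ltrBlDl.
exists J, a; split.
- have -> : J = [set` `]s - e, s + e[] by apply/seteqP; split=> t /=; rewrite in_itv.
  exact: interval_open.
- move=> x y /= /andP[x0 xe] /andP[y0 ye] r /andP[xr ry].
  by apply/andP; split; [exact: lt_le_trans xr|exact: le_lt_trans ye].
- by apply/andP; split; [rewrite ltrBlDr ltrDl|rewrite ltrDl].
- by move=> t /JH[].
- by move=> t /JH[].
Qed.

(** If phi' vanished, the metric would be a multiple of [proj z], of rank at most one, yet it is
    invertible of size n > 1. *)
Lemma profile_neq0 s : (1 < n)%N -> radii U s -> f1 s != 0.
Proof.
move=> n1 [s0 [z Uz zs]]; apply/eqP => f10.
have z0 : z != 0 by rewrite -sqn_eq0 zs gt_eqF.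
have gE : g z = rad f2 z *: proj z.
  apply/matrixP => i j; rewrite metric_profile // form2_mx /rad zs f10.
  by rewrite raddf0 add0r.
have [_ gu] := unitary_frame_unit (frameP (gpos Uz)).
have := mxrank_unit gu; rewrite gE => rk.
have := leq_trans (mxrankS (scalemx_sub (rad f2 z) (submx_refl (proj z))))
  (mulmx_max_rank (z^t*) z).
by rewrite rk leqNgt n1.
Qed.

(** The hypothesis of the theorem supplies a complex constant, whereas the ODE is solved with a real
    [K]. *)
Lemma scal_real z : U z -> z != 0 -> exists r : R, scal g z = r%:C.
Proof.
move=> Uz z0; have rs := radii_sqn Uz z0.
have [n1|n1] := leqP n 1.
  have n1' : n = 1%N by apply/eqP; rewrite eqn_leq n1.
  have [J [a [Jo Ji Js JU p0]]] := profile_shift n1' rs.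
  by eexists; exact: (scal_off_origin Jo JU (or_introl n1') p0 Uz Js).
have p0 t : radii U t -> f1 t + 0 / t != 0.
  by move=> rt; rewrite mul0r addr0 profile_neq0.
have Ro := radii_open Uo Phi_smooth Phi_radial.
by eexists; exact: (scal_off_origin Ro (@subset_refl _ _) (or_intror (erefl (0 : R))) p0 Uz rs).
Qed.

(** * Equivalence of the two constancy statements *)

Section Constancy.
Hypothesis g_cont : forall i j z, U z -> {for z, continuous (fun w => g w i j)}.
Hypothesis Uc : connected U.

Let a3_formula0 y : a3_formula n%:R K%:C 0 0 y = a3_formula n%:R K%:C 0 0 0 :> C.
Proof. by rewrite /a3_formula; move: (K%:C) => k; ring. Qed.

Lemma TYZ_off_origin_complex (J : set R) (a : R) : open J -> is_interval J ->
  J `<=` radii U -> n = 1%N \/ a = 0 -> (forall s, J s -> f1 s + a / s != 0) ->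
  exists B D : C, forall z, U z -> J (sqn z) ->
  let y := (sqn z * (f1 (sqn z) + a / sqn z))%:C in
  TYZ_a2 g z = a2_formula n%:R K%:C (B / y ^+ n) (D / y ^+ n.+1) /\
  TYZ_a3 g z = a3_formula n%:R K%:C (B / y ^+ n) (D / y ^+ n.+1) y^-1.
Proof.
move=> Jo Ji JU na p0; have [B [D H]] := TYZ_off_origin Jo Ji JU na p0.
exists B%:C, D%:C => z Uz Jz y; have [_ [-> ->]] := H z Uz Jz.
by rewrite !fmorph_div !rmorphXn fmorphV.
Qed.

Lemma TYZ_constant_iff : (exists2 z, U z & z != 0) ->
  constant_on U (TYZ_a3 g) <-> constant_on U (TYZ_a2 g).
Proof.
move=> [z1 Uz1 z1n0].
(* Both statements are shown equivalent to a common [P]: [True] when n = 1, and [constancy n B D]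
   otherwise. *)
suff [P [P2 P3] [C2 C3]] : exists2 P : Prop,
    (P -> constant_on U (TYZ_a2 g)) /\ (P -> constant_on U (TYZ_a3 g)) &
    (constant_on U (TYZ_a2 g) -> P) /\ (constant_on U (TYZ_a3 g) -> P).
  by split=> [/C3/P2|/C2/P3].
(* If the coefficients take their values at b = c = 0 away from the origin, then [TYZ_origin] gives
   the same values at the origin. *)
have const : (forall z, U z -> z != 0 ->
      TYZ_a2 g z = a2_formula n%:R K%:C 0 0 /\ TYZ_a3 g z = a3_formula n%:R K%:C 0 0 0) ->
    constant_on U (TYZ_a2 g) /\ constant_on U (TYZ_a3 g).
  move=> H; split.
    exists (a2_formula n%:R K%:C 0 0) => z Uz; have [z0|/H[]//] := eqVneq z 0.
    by rewrite z0 in Uz *; have [-> _] := TYZ_origin g_cont Uz.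
  exists (a3_formula n%:R K%:C 0 0 0) => z Uz; have [z0|/H[]//] := eqVneq z 0.
  by rewrite z0 in Uz *; have [_ [y ->]] := TYZ_origin g_cont Uz; exact: a3_formula0.
have [n1|n1] := leqP n 1.
  have n1' : n = 1%N by apply/eqP; rewrite eqn_leq n1.
  have [T2 T3] : constant_on U (TYZ_a2 g) /\ constant_on U (TYZ_a3 g).
    apply: const => z Uz z0.
    (* For n = 1 the interval, the shift and thus [B], [D] may change from point to point; this is
       harmless because the formulas then do not depend on [B] and [D]. *)
    have [J [a [Jo Ji Js JU p0]]] := profile_shift n1' (radii_sqn Uz z0).
    have [B [D H]] := TYZ_off_origin_complex Jo Ji JU (or_introl n1') p0.
    have [-> ->] := H z Uz Js.
    by split; [apply: a2_constancy|apply: a3_constancy]; left.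
  by exists True.
have p0 t : radii U t -> f1 t + 0 / t != 0.
  by move=> rt; rewrite mul0r addr0 profile_neq0.
have Ro : open (radii U) := radii_open Uo Phi_smooth Phi_radial.
have Ri : is_interval (radii U) := radii_interval Uc.
have n0' : n = 1%N \/ (0 : R) = 0 by right.
(* For n > 1 the whole interval of radii is used at once, so [B] and [D] are the same on all of [U]
   minus the origin. Connectedness of [U] enters here through [Ri]. *)
have [B [D H]] := TYZ_off_origin_complex Ro Ri (@subset_refl _ _) n0' p0.
have inj s t : radii U s -> radii U t ->
    s * (f1 s + 0 / s) = t * (f1 t + 0 / t) -> s = t.
  by apply: (profile_inj (J := radii U) (a := 0)) => //; right.
have r1 := radii_sqn Uz1 z1n0.
have /nbhs_ballP[e /= e0 He] : \forall t \near sqn z1, radii U t by exact: open_nbhs_nbhs.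
(* Infinitely many distinct radii; the denominator starts at 2 so that each stays strictly within
   distance [e] of [sqn z1]. *)
pose s (k : nat) := sqn z1 + e / k.+2%:R.
have rs (k : nat) : radii U (s k).
  apply: He; rewrite /ball /= /s opprD addrA subrr sub0r normrN ger0_norm; last first.
    by rewrite divr_ge0 // ltW.
  by rewrite ltr_pdivrMr ?ltr0n // ltr_pMr // ltr1n.
pose w (k : nat) : C := ((s k * (f1 (s k) + 0 / s k))^-1)%:C.
have w_inj : injective w.
  move=> m l /complexI/invr_inj/(inj _ _ (rs m) (rs l))/addrI/(mulfI (lt0r_neq0 e0))/invr_inj/eqP.
  by rewrite eqr_nat !eqSS => /eqP.
exists (constancy n B D).
  suff h : constancy n B D -> constant_on U (TYZ_a2 g) /\ constant_on U (TYZ_a3 g).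
    by split=> /h[].
  move=> c; apply: const => z Uz z0; have [-> ->] := H z Uz (radii_sqn Uz z0).
  by rewrite (a2_constancy _ _ c) (a3_constancy _ _ 0 c).
have Hw (k : nat) : exists2 z, U z &
   TYZ_a2 g z = a2_formula n%:R K%:C (B * w k ^+ n) (D * w k ^+ n.+1) /\
   TYZ_a3 g z = a3_formula n%:R K%:C (B * w k ^+ n) (D * w k ^+ n.+1) (w k).
  have [_ [z Uz zs]] := rs k; exists z => //.
  have [|-> ->] := H z Uz; first by rewrite zs.
  by rewrite zs /w fmorphV !exprVn.
split=> -[c cE].
  apply: (a2_constancy_conv n1 w_inj (K := K%:C) (c := c)) => k.
  by have [z Uz [<- _]] := Hw k; exact: cE.
apply: (a3_constancy_conv n1 w_inj (K := K%:C) (c := c)) => k.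
by have [z Uz [_ <-]] := Hw k; exact: cE.
Qed.

End Constancy.
End ConstantScalarCurvature.

Theorem theorem1p1 (R : realType) (n : nat) (hn : (1 <= n)%N)
    (U : set 'rV[R[i]]_n) (g : 'rV[R[i]]_n -> 'M[R[i]]_n)
    (hUo : open U) (hUc : connected U)
    (hg : kahler_metric U g) (hrad : radial U g)
    (hscal : constant_on U (scal g)) :
  constant_on U (TYZ_a3 g) <-> constant_on U (TYZ_a2 g).
Proof.
have [g_smooth gpos _] := hg; have [Phi [Phi_smooth Phi_pot] Phi_radial] := hrad.
have g_cont i j z : U z -> {for z, continuous (fun w => g w i j)}.
  by have [H _] := g_smooth i j 0%N; exact: H.
(* If [U] has no point other than the origin, every function is constant on it. *)
have [[z Uz z0]|U0] := pselect (exists2 z, U z & z != 0); last first.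
  have H f : constant_on U f.
    by exists (f 0) => z Uz; have [->//|z0] := eqVneq z 0; case: U0; exists z.
  by split.
have [r rE] := scal_real hn hUo gpos Phi_smooth Phi_pot Phi_radial Uz z0.
pose K := r / (n%:R * (n%:R + 1)).
have scalK w : U w -> scal g w = (real_complex R (n%:R * (n%:R + 1) * K)).
  have [c cE] := hscal; move=> Uw; rewrite (cE w Uw) -(cE z Uz) rE /K mulrC divfK //.
  by rewrite mulf_neq0 ?natr1 // pnatr_eq0 // -lt0n.
apply: (TYZ_constant_iff hn hUo gpos Phi_smooth Phi_pot Phi_radial scalK g_cont hUc).
by exists z.
Qed.
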